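(* Let $M^m$, $m>2$, be a proper biharmonic submanifold of dimension $m$ in the unit Euclidean sphere $\mathbb{S}^n$, with mean curvature vector field $H$ and Weingarten operator $A_H$ associated to $H$, such that $\nabla^\perp H=0$, $\nabla A_H=0$ and $|H|\in\left(0,\frac{m-2}{m}\right)$. Then, locally, $$M=M_1^{m_1}\times M_2^{m_2}\subset\mathbb{S}^{n_1}(1/\sqrt2)\times\mathbb{S}^{n_2}(1/\sqrt2)\subset\mathbb{S}^n,$$ where $M_i$ is a minimal submanifold (of dimension $m_i$) of $\mathbb{S}^{n_i}(1/\sqrt2)$, $i=1,2$, $m_1+m_2=m$, $n_1+n_2=n-1$.
   Context: All manifolds, metrics and maps are smooth, and all manifolds are connected. A map $\phi:(M,g)\to(N,h)$ between Riemannian manifolds has tension field $\tau(\phi)=\mathrm{trace}\,\nabla d\phi$; it is harmonic if $\tau(\phi)=0$, and biharmonic if $\tau_2(\phi)=-\Delta\tau(\phi)-\mathrm{trace}\,R^N(d\phi\cdot,\tau(\phi))d\phi\cdot=0$, where $\Delta V=-\mathrm{trace}\,\nabla^2V$ for sections $V$ of $\phi^{-1}(TN)$ and $R^N(X,Y)=[\nabla_X,\nabla_Y]-\nabla_{[X,Y]}$. A submanifold (with the induced metric) is called proper biharmonic if its inclusion map is biharmonic but not harmonic (i.e. the submanifold is not minimal). For a submanifold $M^m\subset\mathbb{S}^n$: $B$ is the second fundamental form, $H=\frac1m\,\mathrm{trace}\,B$ is the mean curvature vector field, $|H|$ is the mean curvature, $\nabla^\perp$ is the normal connection, $\nabla$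 is the Levi-Civita connection of $M$, and for a normal vector field $\eta$ the Weingarten operator $A_\eta$ is given by $\langle A_\eta(X),Y\rangle=\langle B(X,Y),\eta\rangle$. The standard product $\mathbb{S}^{n_1}(1/\sqrt2)\times\mathbb{S}^{n_2}(1/\sqrt2)\subset\mathbb{S}^n$, $n_1+n_2=n-1$, is $\{(x,y)\in\mathbb{R}^{n_1+1}\oplus\mathbb{R}^{n_2+1}=\mathbb{R}^{n+1}:|x|^2=|y|^2=1/2\}$. ''Locally'' means that every point of $M$ has an open neighbourhood in $M$ of the stated form; identifications of submanifolds of $\mathbb{S}^n$ are understood up to an isometry of $\mathbb{S}^n$. *)

(* Defs.v *)
From HB Require Import structures.
From mathcomp Require Import all_boot all_order all_algebra.
From mathcomp Require Import all_classical all_reals all_analysis.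

Set Implicit Arguments.
Unset Strict Implicit.
Unset Printing Implicit Defensive.

Import Order.TTheory GRing.Theory Num.Theory.
Import numFieldNormedType.Exports.

Local Open Scope classical_set_scope.
Local Open Scope ring_scope.

(* Submanifolds of spheres are treated as embedded submanifolds of the ambient
   Euclidean space R^N = 'rV[R]_N, and tensor fields on them through their
   components in local parametrizations X : U -> M, U open in R^m. *)

Section Euclidean.
Variables (R : realType) (N : nat).
Implicit Types (p v w : 'rV[R]_N).

Definition dot v w : R := \sum_(a < N) v 0 a * w 0 a.

(* The library norm `|v| on 'rV[R]_N is the sup norm: same topology, but not
   the Euclidean length. *)
Definition enorm v : R := Num.sqrt (dot v v).

Definition sphere (r : R) : set 'rV[R]_N := [set p | enorm p = r].

(* Orthogonal projection of R^N onto the tangent space at p != 0 of the sphere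
   of radius enorm p centred at 0. *)
Definition tproj p w : 'rV[R]_N := w - (dot w p / dot p p) *: p.

(* Levi-Civita connection of the concentric spheres: the tangential part of
   the flat derivative, for vector fields tangent to them. *)
Definition covS (V W : 'rV[R]_N -> 'rV[R]_N) : 'rV[R]_N -> 'rV[R]_N :=
  fun p => tproj p ('D_(V p) W p).

Definition bracket (V W : 'rV[R]_N -> 'rV[R]_N) : 'rV[R]_N -> 'rV[R]_N :=
  fun p => 'D_(V p) W p - 'D_(W p) V p.

(* R^S(a,b)c = [nabla_a, nabla_b]c - nabla_[a,b]c at p.  The curvature being a
   tensor, it is computed on the vector fields q |-> tproj q a, which are
   tangent to the spheres and take the value a at p when a is tangent at p. *)
Definition curvS p (a b c : 'rV[R]_N) : 'rV[R]_N :=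
  let A := tproj^~ a in let B := tproj^~ b in let C := tproj^~ c in
  covS A (covS B C) p - covS B (covS A C) p - covS (bracket A B) C p.

End Euclidean.

Section Charts.
Variables (R : realType) (m : nat).

Definition pd (W : normedModType R) (i : 'I_m) (f : 'rV[R]_m -> W) :
    'rV[R]_m -> W :=
  fun u => 'D_(delta_mx 0 i) f u.

Fixpoint Ck (W : normedModType R) (k : nat) (U : set 'rV[R]_m)
    (f : 'rV[R]_m -> W) : Prop :=
  (forall u, U u -> {for u, continuous f}) /\
  if k is k'.+1 then
    forall i : 'I_m,
      (forall u, U u -> derivable f u (delta_mx 0 i)) /\ Ck k' U (pd i f)
  else True.

Definition smooth_on (W : normedModType R) (U : set 'rV[R]_m)
    (f : 'rV[R]_m -> W) : Prop := forall k, Ck k U f.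

Definition immersive N (X : 'rV[R]_m -> 'rV[R]_N) (u : 'rV[R]_m) : Prop :=
  row_free (\matrix_(i < m, a < N) pd i X u 0 a).

(* The last clause says that X : U -> M is an open map for the subspace
   topology of M; with continuity and injectivity, X is a homeomorphism of U
   onto an open subset of M. *)
Definition local_param N (M : set 'rV[R]_N) (U : set 'rV[R]_m)
    (X : 'rV[R]_m -> 'rV[R]_N) : Prop :=
  [/\ open U, smooth_on U X, (forall u, U u -> immersive X u),
      {in U &, injective X} &
      forall O, open O -> O `<=` U ->
        exists2 W : set 'rV[R]_N, open W & X @` O = M `&` W].

Definition sphere_submanifold N (r : R) (M : set 'rV[R]_N) : Prop :=
  [/\ M `<=` sphere r, M !=set0, connected M &
      forall p, M p -> exists U X, local_param M U X /\ (X @` U) p].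

(* A pointwise property P X u of parametrizations holds on M. *)
Definition on_charts N (M : set 'rV[R]_N)
    (P : ('rV[R]_m -> 'rV[R]_N) -> 'rV[R]_m -> Prop) : Prop :=
  forall U X, local_param M U X -> forall u, U u -> P X u.

End Charts.

Section RiemannianDomain.
Variables (R : realType) (m : nat) (g : 'rV[R]_m -> 'M[R]_m).

Definition ginv (u : 'rV[R]_m) : 'M[R]_m := invmx (g u).

(* christoffel k i j = Gamma^k_ij *)
Definition christoffel (k i j : 'I_m) (u : 'rV[R]_m) : R :=
  2^-1 * \sum_(l < m) ginv u k l *
    (pd i (fun v => g v j l) u + pd j (fun v => g v i l) u
     - pd l (fun v => g v i j) u).

Definition mtrace N (T : 'I_m -> 'I_m -> 'rV[R]_N) (u : 'rV[R]_m) : 'rV[R]_N :=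
  \sum_(i < m) \sum_(j < m) ginv u i j *: T i j.

Section MapToSphere.
Variables (N : nat) (phi : 'rV[R]_m -> 'rV[R]_N).

(* nablaphi i V = nabla_{d/du_i} V in phi^{-1}(TS), where V u is tangent at
   phi u to the sphere containing phi. *)
Definition nablaphi (i : 'I_m) (V : 'rV[R]_m -> 'rV[R]_N) :
    'rV[R]_m -> 'rV[R]_N :=
  fun u => tproj (phi u) (pd i V u).

Definition hessphi (i j : 'I_m) (u : 'rV[R]_m) : 'rV[R]_N :=
  nablaphi i (pd j phi) u - \sum_(k < m) christoffel k i j u *: pd k phi u.

Definition tension (u : 'rV[R]_m) : 'rV[R]_N := mtrace (fun i j => hessphi i j u) u.

Definition rough_laplacian (V : 'rV[R]_m -> 'rV[R]_N) (u : 'rV[R]_m) :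
    'rV[R]_N :=
  - mtrace (fun i j => nablaphi i (nablaphi j V) u
                       - \sum_(k < m) christoffel k i j u *: nablaphi k V u) u.

Definition bitension (u : 'rV[R]_m) : 'rV[R]_N :=
  - rough_laplacian tension u
  - mtrace (fun i j => curvS (phi u) (pd i phi u) (tension u) (pd j phi u)) u.

End MapToSphere.
End RiemannianDomain.

Section SubmanifoldGeometry.
Variables (R : realType) (m N : nat) (X : 'rV[R]_m -> 'rV[R]_N).
Implicit Types (u : 'rV[R]_m) (i j k l : 'I_m).

Definition induced_metric u : 'M[R]_m :=
  \matrix_(i, j) dot (pd i X u) (pd j X u).

Let g := induced_metric.

(* Component normal to M of a vector w tangent to the sphere. *)
Definition nproj u (w : 'rV[R]_N) : 'rV[R]_N :=
  w - \sum_(k < m) \sum_(l < m) (ginv g u k l * dot w (pd l X u)) *: pd k X u.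

(* B(d/du_i, d/du_j) *)
Definition sff i j u : 'rV[R]_N := nproj u (nablaphi X i (pd j X) u).

Definition mean_curv u : 'rV[R]_N :=
  m%:R^-1 *: mtrace g (fun i j => sff i j u) u.

Definition nabla_perp i (eta : 'rV[R]_m -> 'rV[R]_N) u : 'rV[R]_N :=
  nproj u (nablaphi X i eta u).

(* A_eta(d/du_i) = \sum_k weingarten eta i k u d/du_k, obtained by solving
   <A_eta(d/du_i), d/du_j> = <B(d/du_i, d/du_j), eta>. *)
Definition weingarten (eta : 'rV[R]_m -> 'rV[R]_N) i k u : R :=
  \sum_(j < m) dot (sff i j u) (eta u) * ginv g u j k.

(* (nabla_{d/du_i} A)(d/du_j) has d/du_k-component nabla_end A i j k, for an
   endomorphism field A(d/du_j) = \sum_k A j k u d/du_k. *)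
Definition nabla_end (A : 'I_m -> 'I_m -> 'rV[R]_m -> R) i j k u : R :=
  pd i (A j k) u
  + \sum_(l < m) A j l u * christoffel g k i l u
  - \sum_(l < m) christoffel g l i j u * A l k u.

End SubmanifoldGeometry.

Section SubmanifoldPredicates.
Variables (R : realType) (m N : nat) (M : set 'rV[R]_N).

Definition harmonic_inclusion : Prop :=
  on_charts (m := m) M (fun X u => tension (induced_metric X) X u = 0).

Definition biharmonic_inclusion : Prop :=
  on_charts (m := m) M (fun X u => bitension (induced_metric X) X u = 0).

Definition proper_biharmonic : Prop :=
  biharmonic_inclusion /\ ~ harmonic_inclusion.

Definition minimal : Prop :=
  on_charts (m := m) M (fun X u => mean_curv X u = 0).

Definition parallel_mean_curv : Prop :=
  on_charts (m := m) M (fun X u => forall i, nabla_perp X i (mean_curv X) u = 0).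

Definition parallel_weingarten_H : Prop :=
  on_charts (m := m) M (fun X u =>
    forall i j k, nabla_end X (weingarten X (mean_curv X)) i j k u = 0).

Definition mean_curv_norm_in (a b : R) : Prop :=
  on_charts (m := m) M (fun X u => a < enorm (mean_curv X u) < b).

End SubmanifoldPredicates.

(* Near p, M is M1 x M2 up to an isometry of the ambient sphere of R^n.+1.  The
   isometry is x + y |-> row_mx x y *m Q; since (n1.+1 + n2.+1 = n.+1)%N, the
   equation Q *m Q^T = 1%:M makes Q orthogonal. *)
Definition local_product_at (R : realType) (m n : nat) (M : set 'rV[R]_n.+1)
    (p : 'rV[R]_n.+1) : Prop :=
  exists (m1 m2 n1 n2 : nat)
         (M1 : set 'rV[R]_n1.+1) (M2 : set 'rV[R]_n2.+1)
         (Q : 'M[R]_(n1.+1 + n2.+1, n.+1)) (W : set 'rV[R]_n.+1),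
  [/\ [/\ (0 < m1)%N, (0 < m2)%N, (m1 + m2 = m)%N & (n1 + n2 + 1 = n)%N],
      sphere_submanifold m1 (Num.sqrt 2)^-1 M1 /\ minimal m1 M1,
      sphere_submanifold m2 (Num.sqrt 2)^-1 M2 /\ minimal m2 M2,
      Q *m Q^T = 1%:M &
      [/\ open W, W p &
          M `&` W = [set row_mx x y *m Q | x in M1 & y in M2]]].

(* Main.v *)
Require Import Defs.
From HB Require Import structures.
From mathcomp Require Import all_boot all_order all_algebra.
From mathcomp Require Import all_classical all_reals all_analysis.
From mathcomp Require Import ring lra zify.
Set Implicit Arguments.
Unset Strict Implicit.
Unset Printing Implicit Defensive.
Import Order.TTheory GRing.Theory Num.Theory.
Import numFieldNormedType.Exports.
Local Open Scope classical_set_scope.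
Local Open Scope ring_scope.

(** In a chart X, let H be the mean curvature vector, P the orthogonal projector of the
    ambient Euclidean space onto the tangent space, and A the shape operator of H extended by
    zero on normal vectors.  Subscripts denote partial derivatives and vectors are rows.

    The shape operator has at most two eigenvalues.  Since H is parallel, its derivatives are
    tangent: H_i = - X_i A.  Since A_H is parallel, A varies only because the tangent space
    does: A_i = P_i A + A P_i (pd_weingarten).  Equality of the second derivatives of A then
    says that A commutes with the brackets of P_k and P_l, which are the curvature operators
    of M (curvature_commutes).  This relation is contracted with the metric
    (contracted_integrability).  Two traces appear.  That of X_j P_i is m H - m X
    (second_form_trace); that of X_j A P_i is m H - tr(A) X (weingarten_trace), because the
    biharmonic equation says that the normal Laplacian of H is - m H.  The terms in H cancel
    and those in X leave m A A = tr(A) P, that is A A = |H|^2 P (weingarten_sqr).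

    Both eigenvalues occur.  |H| is locally a constant c > 0, and A has the eigenvalues c and
    -c on the tangent space, with trace m c^2.  If -c did not occur, c would be 1; if c did not
    occur, c would be -1.  Both are excluded by 0 < c < 1 (principal_splitting).

    The splitting.  f = (X - H / c) / 2 and h = (X + H / c) / 2 satisfy X = f + h, are
    orthogonal of squared length 1/2, and their differentials are the projections onto the two
    eigenspaces.  So f has constant rank m1 and h has constant rank m2.  Coordinates of f and h
    along the eigenspaces at one point form a chart of M by the inverse function theorem, and
    in this chart f depends on the first m1 variables only and h on the last m2
    (product_chart).  Orthogonality puts the values of f and h into two orthogonal subspaces
    (orthogonal_spans), which gives the product.

    Minimality.  In the product chart the metric is block diagonal, so the normal part of the
    Laplacian of X is m H = m c (h - f).  Its component in the subspace of f is a multiple of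
    f, hence has no part normal to the first factor in its sphere; the same holds for h
    (minimal_factor1, minimal_factor2).  A change of chart does not alter the mean curvature
    vector (mean_curv_reparam), so this holds in every chart of the factors.

    The analytic input is the differentiability of C^1 functions (C1_differential), the symmetry
    of second derivatives (schwarz) and the inverse function theorem (inverse_function). *)

Section Calculus.
Variable R : realType.

(** * Directional derivatives of matrix-valued maps *)

Lemma is_derive_fsum (V W : normedModType R) n (h : 'I_n -> V -> W) u v dh :
  (forall i, is_derive u v (h i) (dh i)) ->
  is_derive u v (fun w => \sum_(i < n) h i w) (\sum_(i < n) dh i).
Proof.
move=> hd; have -> : (fun w => \sum_(i < n) h i w) = \sum_(i < n) h i.
  by apply/funext => w; rewrite fct_sumE.
exact: is_derive_sum.
Qed.

Lemma is_derive_mxP (V : normedModType R) p q (F : V -> 'M[R]_(p, q)) u v (dF : 'M[R]_(p, q)) :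
  (forall i j, is_derive u v (fun w => F w i j) (dF i j)) -> is_derive u v F dF.
Proof.
move=> h; have dv : derivable F u v by apply/derivable_mxP => i j; case: (h i j).
apply: DeriveDef => //; rewrite derive_mx//; apply/matrixP => i j.
by rewrite mxE; case: (h i j).
Qed.

Lemma is_derive_entry (V : normedModType R) p q (F : V -> 'M[R]_(p, q)) u v (dF : 'M[R]_(p, q)) :
  is_derive u v F dF -> forall i j, is_derive u v (fun w => F w i j) (dF i j).
Proof.
move=> [dv <-] i j; have /derivable_mxP h := dv.
by apply: DeriveDef => //; rewrite derive_mx// mxE.
Qed.

Lemma is_derive_mulmx (V : normedModType R) p q r (F : V -> 'M[R]_(p, q))
    (G : V -> 'M[R]_(q, r)) u v (dF : 'M[R]_(p, q)) (dG : 'M[R]_(q, r)) :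
  is_derive u v F dF -> is_derive u v G dG ->
  is_derive u v (fun w => F w *m G w) (dF *m G u + F u *m dG).
Proof.
move=> /is_derive_entry hF /is_derive_entry hG.
apply: is_derive_mxP => i j.
rewrite (_ : (fun w => _) = (fun w => \sum_k F w i k * G w k j)); last first.
  by apply/funext => w; rewrite mxE.
rewrite !mxE -big_split /=; apply: is_derive_fsum => k.
apply: (is_derive_eq (is_deriveM (hF i k) (hG k j))).
by rewrite /= addrC [G u k j *: _]mulrC.
Qed.

Lemma is_derive_trmx (V : normedModType R) p q (F : V -> 'M[R]_(p, q)) u v (dF : 'M[R]_(p, q)) :
  is_derive u v F dF -> is_derive u v (fun w => (F w)^T) dF^T.
Proof.
move=> /is_derive_entry hF; apply: is_derive_mxP => i j.
rewrite mxE (_ : (fun w => _) = (fun w => F w j i))//.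
by apply/funext => w; rewrite mxE.
Qed.

Lemma is_derive_along (W : normedModType R) (V : normedModType R) (f : V -> W) (z v : V) (t : R) :
  derivable f (z + t *: v) v ->
  is_derive t 1 (fun s : R => f (z + s *: v)) ('D_v f (z + t *: v)).
Proof.
move=> df; have e : (fun h : R => h^-1 *: (((fun s : R => f (z + s *: v)) \o shift t) (h *: (1:R)) - f (z + t *: v)))
  = (fun h : R => h^-1 *: ((f \o shift (z + t *: v)) (h *: v) - f (z + t *: v))).
  apply/funext => h /=; congr (_ *: (f _ - _)).
  by rewrite [h *: 1]mulr1 scalerDl addrCA.
by apply: DeriveDef; rewrite /derivable/derive /= e.
Qed.

(** * The mean value inequality on boxes *)

Lemma norm_mean_value (phi dphi : R -> R) (a e : R) :
  (forall t : R, t \in `[0, 1]%R -> is_derive t 1 phi (dphi t) /\ `|dphi t - a| <= e) ->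
  `|phi 1 - phi 0 - a| <= e.
Proof.
move=> h; have [||c c01] := @MVT_segment R phi dphi 0 1 ler01.
- by move=> t /subset_itv_oo_cc /h[].
- by apply: derivable_within_continuous => t /h[[]].
- by rewrite subr0 mulr1 => ->; case: (h _ c01).
Qed.

Lemma rV_ball m (x y : 'rV[R]_m) (r : R) : 0 < r ->
  ball x r y <-> (forall i, `|x 0 i - y 0 i| < r).
Proof.
move=> r0; split=> [[_ h] i|h]; first exact: (h 0 i).
by split=> // i j; rewrite ord1; exact: h.
Qed.

Lemma norm_coord m (x : 'rV[R]_m) i : `|x 0 i| <= `|x|.
Proof.
rewrite [leRHS]/Num.Def.normr/= mx_normrE.
exact: (le_bigmax _ (fun ij : 'I_1 * 'I_m => `|x ij.1 ij.2|) (0, i)).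
Qed.

Lemma norm_rV_le m (x : 'rV[R]_m) (e : R) : 0 <= e ->
  (forall i, `|x 0 i| <= e) -> `|x| <= e.
Proof.
move=> e0 h; rewrite /Num.Def.normr/= mx_normrE (bigmax_le _ e0)//=.
by move=> -[i j] _; rewrite ord1; exact: h.
Qed.

Lemma norm_conv_lt (a b c r t : R) : `|c - a| < r -> `|c - b| < r ->
  t \in `[0, 1]%R -> `|c - (a + t * (b - a))| < r.
Proof.
rewrite in_itv /= => ua ub /andP[t0 t1].
have -> : c - (a + t * (b - a)) = (1 - t) * (c - a) + t * (c - b) by ring.
apply: le_lt_trans (ler_normD _ _) _; rewrite !normrM (ger0_norm t0).
rewrite ger0_norm ?subr_ge0//; have [->|tn0] := eqVneq t 0.
  by rewrite subr0 mul1r mul0r addr0.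
have -> : r = (1 - t) * r + t * r by ring.
apply: ler_ltD; first by rewrite ler_wpM2l ?subr_ge0// ltW.
by rewrite ltr_pM2l// lt_def tn0.
Qed.

Lemma is_derive_coord_along m (f : 'rV[R]_m -> R) (z : 'rV[R]_m) (i : 'I_m) (d t : R) :
  derivable f (z + (d * t) *: delta_mx 0 i) (delta_mx 0 i) ->
  is_derive t 1 (fun s : R => f (z + (d * s) *: delta_mx 0 i))
    (pd i f (z + (d * t) *: delta_mx 0 i) * d).
Proof.
move=> /is_derive_along h.
have hd : is_derive t 1 (fun s : R => d * s) d.
  apply: (is_derive_eq (is_deriveM (is_derive_cst d t 1) (is_derive_id t 1))).
  by rewrite scaler0 addr0 [_ *: _]mulr1.
exact: (@is_derive1_comp R (fun s => f (z + s *: delta_mx 0 i)) (fun s => d * s)).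
Qed.

(** The points x and y are joined by changing one coordinate at a time; the intermediate points
    stay in the ball, which for the sup norm is a box, and each step is a mean value
    inequality in one variable.  The comparison with constant slopes [a i] is what later gives
    differentiability, strict differentiability and constancy. *)
Lemma mean_value_box m (f : 'rV[R]_m -> R) (a : 'I_m -> R) (e r : R) x0 :
  0 <= e ->
  (forall w i, ball x0 r w ->
     derivable f w (delta_mx 0 i) /\ `|pd i f w - a i| <= e) ->
  forall x y, ball x0 r x -> ball x0 r y ->
  `|f y - f x - \sum_i a i * (y 0 i - x 0 i)| <= m%:R * e * `|y - x|.
Proof.
move=> e0 hf x y bx.
have r0 : 0 < r by case: bx.
move=> by_; pose z k : 'rV[R]_m := \row_i (if (i < k)%N then y 0 i else x 0 i).
have zball k : ball x0 r (z k).
  by apply/rV_ball => // i; rewrite mxE; case: ifP => _; [move: by_|move: bx];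
    move/rV_ball => ->.
have step k : (k <= m)%N ->
  `|f (z k) - f x - \sum_(i < m | (i < k)%N) a i * (y 0 i - x 0 i)|
     <= k%:R * e * `|y - x|.
  elim: k => [_|k IH km].
    rewrite big_pred0// subr0 !mul0r (_ : z 0%N = x) ?subrr ?normr0//.
    by apply/rowP => i; rewrite mxE.
  have {IH} := IH (ltnW km); set S := \sum_(_ < _ | _) _ => IH.
  pose i := Ordinal km; pose d := y 0 i - x 0 i.
  have -> : \sum_(i < m | (i < k.+1)%N) a i * (y 0 i - x 0 i) = a i * d + S.
    rewrite (bigD1 i)//=; congr (_ + _); apply: eq_bigl => j.
    by rewrite ltnS andbC -val_eqE/= ltn_neqAle.
  have zS : z k.+1 = z k + (d * 1) *: delta_mx 0 i.
    apply/rowP => j; rewrite !mxE ltnS leq_eqVlt eqxx /= mulr1.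
    have [->|nij] := eqVneq j i; first by rewrite /= eqxx ltnn mulr1 addrC subrK.
    by rewrite -[_ == k]/(j == i) (negPf nij) mulr0 addr0.
  have z0 : z k = z k + (d * 0) *: delta_mx 0 i by rewrite mulr0 scale0r addr0.
  have H : `|f (z k.+1) - f (z k) - a i * d| <= e * `|y - x|.
    rewrite zS [in f (z k)]z0.
    apply: (@norm_mean_value (fun s => f (z k + (d * s) *: delta_mx 0 i))
              (fun t => pd i f (z k + (d * t) *: delta_mx 0 i) * d)) => t t01.
    have bt : ball x0 r (z k + (d * t) *: delta_mx 0 i).
      apply/rV_ball => // j; rewrite !mxE eqxx /=.
      have [->|nij] := eqVneq j i.
        rewrite /= ltnn mulr1 [d * t]mulrC; apply: norm_conv_lt => //.
          by move/rV_ball: bx => ->.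
        by move/rV_ball: by_ => ->.
      by rewrite mulr0 addr0; have /rV_ball := zball k; move=> /(_ r0 j); rewrite mxE.
    have [h1 h2] := hf _ i bt; split; first exact: is_derive_coord_along.
    rewrite -mulrBl normrM ler_pM// .
    by have := norm_coord (y - x) i; rewrite !mxE.
  rewrite -[in leRHS]addn1 natrD !mulrDl mul1r.
  have -> : f (z k.+1) - f x - (a i * d + S) =
    (f (z k) - f x - S) + (f (z k.+1) - f (z k) - a i * d) by ring.
  by apply: (le_trans (ler_normD _ _)); apply: lerD.
have := step m (leqnn m).
rewrite (_ : z m = y); last by apply/rowP => i; rewrite mxE ltn_ord.
by under eq_bigl do rewrite ltn_ord.
Qed.

Lemma zero_partials_const m p q (F : 'rV[R]_m -> 'M[R]_(p, q)) x0 (r : R) :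
  (forall w i, ball x0 r w -> is_derive w (delta_mx 0 i) F 0) ->
  forall x y, ball x0 r x -> ball x0 r y -> F x = F y.
Proof.
move=> h x y bx by_; apply/matrixP => a b.
have := @mean_value_box m (fun w => F w a b) (fun=> 0) 0 r x0 (lexx 0) _ x y bx by_.
rewrite mulr0 mul0r big1 => [|i _]; last by rewrite mul0r.
rewrite subr0 => H; apply/esym/eqP; rewrite -subr_eq0 -normr_le0; apply: H => w i bw.
have [D E] := is_derive_entry (h w i bw) a b; split=> //.
by rewrite /pd E mxE subrr normr0.
Qed.

(** * Differentiability of functions with continuous partial derivatives *)

(** A separate name lets this sum carry the linear structure required of a differential. *)
Definition grad_lin m (a : 'I_m -> R) (v : 'rV[R]_m) : R := \sum_i a i * v 0 i.

Lemma grad_lin_is_linear m (a : 'I_m -> R) : linear (grad_lin a).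
Proof.
move=> k x y; rewrite /grad_lin scaler_sumr -big_split/=; apply: eq_bigr => i _.
by rewrite !mxE mulrDr [k *: _]mulrCA.
Qed.

HB.instance Definition _ m (a : 'I_m -> R) :=
  GRing.isLinear.Build R 'rV[R]_m R _ (grad_lin a) (grad_lin_is_linear a).

Lemma continuous_grad_lin m (a : 'I_m -> R) : continuous (grad_lin a).
Proof.
apply: continuous_big => [|i _ x]; first exact: add_continuous.
exact: (cvgMl_tmp (a:=a i) (@coord_continuous R 1 m 0 i x)).
Qed.

(** By continuity the partial derivatives are nearly constant on a small box, so the mean
    value inequality with their values at u as slopes bounds the remainder. *)
Lemma C1_differential m (f : 'rV[R]_m -> R) (U : set 'rV[R]_m) u :
  open U -> Ck 1 U f -> U u ->
  differentiable f u /\ 'd f u = grad_lin (fun i => pd i f u) :> ('rV[R]_m -> R).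
Proof.
move=> oU [fc f1] Uu; set a := fun i => pd i f u.
have E : f \o shift u = cst (f u) + grad_lin a +o_ (0 : 'rV[R]_m) id.
  apply/eqaddoP => e e0.
  suff : \forall h \near (0 : 'rV[R]_m), `|f (h + u) - (f u + grad_lin a h)| <= e * `|h|.
    by [].
  have : \forall w \near u, U w /\ forall i, `|a i - pd i f w| <= e / (m%:R + 1).
    near=> w; split; first by near: w; exact: open_nbhs_nbhs.
    near: w; apply: filter_forall => i.
    have [_ [pc _]] := f1 i.
    have /cvgrPdist_le := pc u Uu; apply.
    by rewrite divr_gt0// ltr_wpDl.
  move=> /nbhs_ballP[r /= r0 hr].
  have e1 : 0 <= e / (m%:R + 1) by rewrite divr_ge0 ?addr_ge0// ltW.
  apply/nbhs_ballP; exists r => //= h; rewrite -ball_normE /= sub0r normrN => hr'.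
  have bh : ball u r (h + u).
    by rewrite -ball_normE /= opprD addrCA subrr addr0 normrN.
  have := @mean_value_box m f a (e / (m%:R + 1)) r u e1 _ u (h + u) (ballxx _ r0) bh.
  rewrite addrK => /(_ _)/le_trans hh.
  rewrite opprD addrA.
  have -> : grad_lin a h = \sum_i a i * ((h + u) 0 i - u 0 i).
    by apply: eq_bigr => i _; rewrite mxE addrK.
  apply: hh.
    move=> w i /hr[Uw hw]; have [/(_ w Uw) d1 _] := f1 i; split => //.
    by rewrite distrC.
  have m1 : 0 < m%:R + 1 :> R by rewrite ltr_wpDl.
  by rewrite ler_wpM2r// mulrCA -[leRHS]mulr1 ler_pM2l// ler_pdivrMr// mul1r lerDl.
have D : 'd f u = grad_lin a :> ('rV[R]_m -> R).
  by apply: diff_unique E; exact: continuous_grad_lin.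
split=> //; apply/diff_locallyP; rewrite D; split => //.
exact: continuous_grad_lin.
Unshelve. all: by end_near. Qed.

(** * Stability of the classes Ck *)

Section CkTheory.
Variable (m : nat).
Implicit Types (U V : set 'rV[R]_m) (u : 'rV[R]_m).

Lemma pd_is_derive (W : normedModType R) (f : 'rV[R]_m -> W) i u df :
  is_derive u (delta_mx 0 i) f df -> pd i f u = df.
Proof. by case. Qed.

Lemma Ck_is_derive (W : normedModType R) k U (f : 'rV[R]_m -> W) i u :
  Ck k.+1 U f -> U u -> is_derive u (delta_mx 0 i) f (pd i f u).
Proof. by move=> [_ /(_ i)[h _]] /h d; apply: DeriveDef. Qed.

Lemma Ck_pd (W : normedModType R) k U (f : 'rV[R]_m -> W) i :
  Ck k.+1 U f -> Ck k U (pd i f).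
Proof. by move=> [_ /(_ i)[_]]. Qed.

Lemma Ck_cont (W : normedModType R) k U (f : 'rV[R]_m -> W) u :
  Ck k U f -> U u -> {for u, continuous f}.
Proof. by case: k => [|k] [h _]; exact: h. Qed.

Lemma CkS (W : normedModType R) k U (f : 'rV[R]_m -> W) :
  Ck k.+1 U f -> Ck k U f.
Proof.
elim: k f => [|k IH] f; first by case.
by move=> [fc h]; split=> // i; have [d {}h] := h i; split=> //; exact: IH.
Qed.

Lemma Ck_sub (W : normedModType R) k U V (f : 'rV[R]_m -> W) :
  V `<=` U -> Ck k U f -> Ck k V f.
Proof.
move=> VU; elim: k f => [|k IH] f.
  by move=> [h _]; split=> // u /VU; exact: h.
move=> [fc h]; split=> [u /VU|i]; first exact: fc.
by have [d {}h] := h i; split=> [u /VU|]; [exact: d|exact: IH].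
Qed.

Lemma open_near U u (P : 'rV[R]_m -> Prop) : open U -> U u ->
  (forall w, U w -> P w) -> \forall w \near u, P w.
Proof.
move=> oU Uu h; have : \forall w \near u, U w by exact: open_nbhs_nbhs.
by apply: filterS => w /h.
Qed.

Lemma pd_ext (W : normedModType R) U (f g : 'rV[R]_m -> W) i u :
  open U -> U u -> (forall w, U w -> f w = g w) -> pd i f u = pd i g u.
Proof. by move=> oU Uu fg; apply: near_eq_derive; exact: open_near fg. Qed.

Lemma continuous_open_ext (W : normedModType R) U (f g : 'rV[R]_m -> W) u :
  open U -> U u -> (forall w, U w -> f w = g w) ->
  {for u, continuous f} -> {for u, continuous g}.
Proof.
move=> oU Uu fg fc; rewrite /prop_for /continuous_at -(fg u Uu).
by move=> A /fc fA; apply: filterS2 (open_near oU Uu fg) fA => w /= ->.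
Qed.

Lemma Ck_ext (W : normedModType R) k U (f g : 'rV[R]_m -> W) :
  open U -> (forall w, U w -> f w = g w) -> Ck k U f -> Ck k U g.
Proof.
move=> oU; elim: k f g => [|k IH] f g fg.
  by move=> [fc _]; split=> // u Uu; exact: (continuous_open_ext oU Uu fg (fc u Uu)).
move=> [fc h]; split=> [u Uu|i].
  exact: (continuous_open_ext oU Uu fg (fc u Uu)).
have [d {}h] := h i; split=> [u Uu|].
  by apply: near_eq_derivable (d u Uu); exact: open_near fg.
by apply: IH h => w Uw; exact: pd_ext fg.
Qed.

(** The recursive clause of [Ck] speaks of [pd i f] itself; here any formula that agrees with
    it on the open set may be used. *)
Lemma CkI (W : normedModType R) k U (f : 'rV[R]_m -> W)
    (df : 'I_m -> 'rV[R]_m -> W) : open U ->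
  (forall u, U u -> {for u, continuous f}) ->
  (forall i u, U u -> is_derive u (delta_mx 0 i) f (df i u)) ->
  (forall i, Ck k U (df i)) -> Ck k.+1 U f.
Proof.
move=> oU fc fd h; split=> // i; split=> [u /(fd i)[]//|].
by apply: Ck_ext (h i) => // u /(fd i)[].
Qed.

Lemma Ck_cst (W : normedModType R) k U (a : W) : open U -> Ck k U (fun=> a).
Proof.
move=> oU; elim: k a => [|k IH] a; first by split=> // u _; exact: cst_continuous.
apply: (CkI (df := fun i u => 0)) => // u _; exact: cst_continuous.
Qed.

Lemma Ck_coord k U i : open U -> Ck k U (fun v => v 0 i).
Proof.
move=> oU; case: k => [|k]; first by split=> // u _; exact: coord_continuous.
apply: (CkI (df := fun j u => (delta_mx 0 j : 'rV[R]_m) 0 i)) => // [u _|j u _|j].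
- exact: coord_continuous.
- by apply: (@is_derive_entry _ 1 m id u (delta_mx 0 j)).
- exact: Ck_cst.
Qed.

Lemma Ck_add (W : normedModType R) k U (f g : 'rV[R]_m -> W) :
  open U -> Ck k U f -> Ck k U g -> Ck k U (fun u => f u + g u).
Proof.
move=> oU; elim: k f g => [|k IH] f g.
  by move=> [hf _] [hg _]; split=> // u Uu; apply: continuousD; [exact: hf|exact: hg].
move=> hf hg; apply: (CkI (df := fun i u => pd i f u + pd i g u)) => //.
- by move=> u Uu; apply: continuousD; [exact: (Ck_cont hf)|exact: (Ck_cont hg)].
- move=> i u Uu; exact: (is_deriveD (Ck_is_derive i hf Uu) (Ck_is_derive i hg Uu)).
- by move=> i; apply: IH; exact: Ck_pd.
Qed.

Lemma Ck_opp (W : normedModType R) k U (f : 'rV[R]_m -> W) :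
  open U -> Ck k U f -> Ck k U (fun u => - f u).
Proof.
move=> oU; elim: k f => [|k IH] f.
  by move=> [hf _]; split=> // u Uu; apply: continuousN; exact: hf.
move=> hf; apply: (CkI (df := fun i u => - pd i f u)) => //.
- by move=> u Uu; apply: continuousN; exact: (Ck_cont hf).
- move=> i u Uu; exact: (is_deriveN (Ck_is_derive i hf Uu)).
- by move=> i; apply: IH; exact: Ck_pd.
Qed.

Lemma Ck_mul k U (f g : 'rV[R]_m -> R) :
  open U -> Ck k U f -> Ck k U g -> Ck k U (fun u => f u * g u).
Proof.
move=> oU; elim: k f g => [|k IH] f g.
  move=> [hf _] [hg _]; split=> // u Uu.
  exact: (continuousM (hf u Uu) (hg u Uu)).
move=> hf hg; apply: (CkI (df := fun i u => f u * pd i g u + g u * pd i f u)) => //.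
- by move=> u Uu; exact: (continuousM (Ck_cont hf Uu) (Ck_cont hg Uu)).
- move=> i u Uu; exact: (is_deriveM (Ck_is_derive i hf Uu) (Ck_is_derive i hg Uu)).
- move=> i; apply: Ck_add => //; apply: IH; by [exact: CkS|exact: Ck_pd].
Qed.

Lemma Ck_inv k U (f : 'rV[R]_m -> R) :
  open U -> (forall u, U u -> f u != 0) -> Ck k U f -> Ck k U (fun u => (f u)^-1).
Proof.
move=> oU f0; elim: k => [|k IH].
  by move=> [hf _]; split=> // u Uu; exact: (cvgV (f0 u Uu) (hf u Uu)).
move=> hf.
apply: (CkI (df := fun i u => - ((f u)^-1 * (f u)^-1 * pd i f u))) => //.
- by move=> u Uu; exact: (cvgV (f0 u Uu) (Ck_cont hf Uu)).
- move=> i u Uu; have [d _] := Ck_is_derive i hf Uu.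
  apply: DeriveDef; first exact: derivableV (f0 u Uu) d.
  by rewrite deriveV// ?f0// -exprVn expr2 scaleNr.
- move=> i; apply: Ck_opp => //; apply: Ck_mul => //; last exact: Ck_pd.
  by apply: Ck_mul => //; exact: IH (CkS hf).
Qed.

Lemma Ck_sum (W : normedModType R) k U (I : finType) (f : I -> 'rV[R]_m -> W) (P : pred I) :
  open U -> (forall i, P i -> Ck k U (f i)) -> Ck k U (fun u => \sum_(i | P i) f i u).
Proof.
move=> oU h; have [s] := ubnP #|P|; elim: s P h => // s IH P h.
have [i Pi|P0 _] := pickP P; last first.
  apply: (Ck_ext oU (f := fun=> 0)) => [w _|]; first by rewrite big_pred0.
  exact: Ck_cst.
rewrite (cardD1 i) [i \in P]Pi add1n ltnS => lts.
apply: (Ck_ext oU (f := fun u => f i u + \sum_(j | P j && (j != i)) f j u)).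
  by move=> w _; rewrite [RHS](bigD1 i).
apply: Ck_add => //; first exact: h.
apply: IH => [j /andP[/h]//|]; apply: leq_trans lts; apply: eq_leq.
by congr _.+1; apply: eq_card => j; rewrite !inE andbC.
Qed.

Lemma Ck_prod k U n (f : 'I_n -> 'rV[R]_m -> R) :
  open U -> (forall i, Ck k U (f i)) -> Ck k U (fun u => \prod_i f i u).
Proof.
move=> oU; elim: n f => [|n IH] f h.
  apply: (Ck_ext oU (f := fun=> (1 : R))) => [w _|]; first by rewrite big_ord0.
  exact: Ck_cst.
apply: (Ck_ext oU (f := fun u => f ord0 u * \prod_(j < n) f (lift ord0 j) u)).
  by move=> w _; rewrite [RHS]big_ord_recl.
by apply: Ck_mul => //; exact: IH.
Qed.

Lemma continuous_mx (V : normedModType R) p q (F : V -> 'M[R]_(p, q)) (u : V) :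
  (forall i j, {for u, continuous (fun w => F w i j)}) -> {for u, continuous F}.
Proof.
move=> h; apply/cvgrPdist_le => e e0; near=> w.
rewrite /Num.Def.normr/= mx_normrE (bigmax_le _ (ltW e0))//= => i _.
rewrite !mxE; move: i; near: w; apply: filter_forall => -[i j] /=.
by have /cvgrPdist_le := h i j; apply.
Unshelve. all: by end_near. Qed.

Lemma Ck_mxP k U p q (F : 'rV[R]_m -> 'M[R]_(p, q)) : open U ->
  Ck k U F <-> forall i j, Ck k U (fun w => F w i j).
Proof.
move=> oU; elim: k F => [|k IH] F.
  split=> [[h _] i j|h].
    split=> // u Uu.
    exact: (@continuous_comp _ _ _ F (fun A : 'M[R]_(p, q) => A i j) u (h u Uu) (@coord_continuous _ _ _ i j _)).
  by split=> // u Uu; apply: continuous_mx => i j; have [/(_ u Uu)] := h i j.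
split=> [h i j|h].
  apply: (CkI (df := fun l u => pd l F u i j)) => // [u Uu|l u Uu|l].
  - exact: (@continuous_comp _ _ _ F (fun A : 'M[R]_(p, q) => A i j) u (Ck_cont h Uu) (@coord_continuous _ _ _ i j _)).
  - exact: (is_derive_entry (Ck_is_derive l h Uu) i j).
  - by have /IH := Ck_pd l h.
apply: (CkI (df := fun l u => \matrix_(i, j) pd l (fun w => F w i j) u)) => // [u Uu|l u Uu|l].
- by apply: continuous_mx => i j; exact: Ck_cont (h i j) Uu.
- by apply: is_derive_mxP => i j; rewrite mxE; exact: (Ck_is_derive l (h i j) Uu).
- apply/IH => i j; apply: Ck_ext (Ck_pd l (h i j)) => // w _.
  by rewrite mxE.
Qed.

Lemma Ck_near k U (f : 'rV[R]_m -> R) u (e : R) :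
  Ck k U f -> U u -> 0 < e -> \forall w \near u, `|f w - f u| <= e.
Proof.
move=> hf Uu e0; have /cvgrPdist_le /(_ _ e0) := Ck_cont hf Uu.
by apply: filterS => w; rewrite (distrC (f u) (f w)).
Qed.

Lemma pd_mx p q (F : 'rV[R]_m -> 'M[R]_(p, q)) l u i j :
  derivable F u (delta_mx 0 l) -> pd l F u i j = pd l (fun w => F w i j) u.
Proof. by move=> d; rewrite /pd derive_mx// mxE. Qed.

End CkTheory.

(** * The chain rule *)

Section Composition.

(** Reduces a directional derivative to a derivative in one real variable. *)
Lemma is_derive_lineP (V W : normedModType R) (f : V -> W) (z v : V) df :
  is_derive z v f df <-> is_derive (0 : R) (1 : R) (fun s : R => f (z + s *: v)) df.
Proof.
have e : (fun h : R => h^-1 *: (((fun s : R => f (z + s *: v)) \o shift 0) (h *: (1:R)) - f (z + (0:R) *: v)))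
  = (fun h : R => h^-1 *: ((f \o shift z) (h *: v) - f z)).
  apply/funext => h /=; rewrite scale0r !addr0; congr (_ *: (f _ - _)).
  by rewrite [h *: 1]mulr1 addrC.
split=> -[d dE]; apply: DeriveDef; move: d dE; rewrite /derivable/derive ?e//.
Qed.

Variables (m p : nat) (U : set 'rV[R]_p).
Hypothesis oU : open U.

(** Restricted to the line through v, th is a differentiable curve, and G is differentiable at
    th v because it is C^1; the rule is then that of differentials. *)
Lemma is_derive_chain (G : 'rV[R]_p -> R) (th : 'rV[R]_m -> 'rV[R]_p) v w dth :
  Ck 1 U G -> U (th v) -> is_derive v w th dth ->
  is_derive v w (fun x => G (th x)) (\sum_a dth 0 a * pd a G (th v)).
Proof.
move=> CG Uv /is_derive_lineP dg; apply/is_derive_lineP.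
have [dG dGE] := C1_differential oU CG Uv.
pose g (s : R) := th (v + s *: w).
have g0 : g 0 = th v by rewrite /g scale0r addr0.
have gd : differentiable g 0 by apply/derivable1_diffP; case: dg.
have Gd : differentiable G (g 0) by rewrite g0.
have D := differentiable_comp gd Gd.
apply: DeriveDef; first by apply/derivable1_diffP; exact: D.
rewrite (_ : (fun s : R => _) = G \o g)// deriveE//.
rewrite diff_comp//= g0 dGE.
rewrite -(deriveE _ gd); case: dg => _ ->.
by rewrite /grad_lin; apply: eq_bigr => a _; rewrite mulrC.
Qed.

Lemma Ck_comp_scalar k V (G : 'rV[R]_p -> R) (th : 'rV[R]_m -> 'rV[R]_p) :
  open V -> (forall v, V v -> U (th v)) -> Ck k V th -> Ck k U G ->
  Ck k V (fun v => G (th v)).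
Proof.
move=> oV VU; elim: k G => [|k IH] G hth hG.
  split=> // v Vv.
  exact: (@continuous_comp _ _ _ th G v (Ck_cont hth Vv) (Ck_cont hG (VU v Vv))).
have hG1 : Ck 1 U G by elim: (k) hG => // l IHl /CkS.
apply: (CkI (df := fun i v => \sum_a pd i th v 0 a * pd a G (th v))) => //.
- move=> v Vv.
  exact: (@continuous_comp _ _ _ th G v (Ck_cont hth Vv) (Ck_cont hG (VU v Vv))).
- move=> i v Vv; exact: (is_derive_chain hG1 (VU v Vv) (Ck_is_derive i hth Vv)).
- move=> i; apply: Ck_sum => // a _; apply: Ck_mul => //.
    by have /(Ck_mxP _ _ oV) := Ck_pd i hth; apply.
  by apply: IH (CkS hth) _; exact: Ck_pd.
Qed.

Lemma Ck_comp k V q r (G : 'rV[R]_p -> 'M[R]_(q, r)) (th : 'rV[R]_m -> 'rV[R]_p) :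
  open V -> (forall v, V v -> U (th v)) -> Ck k V th -> Ck k U G ->
  Ck k V (fun v => G (th v)).
Proof.
move=> oV VU hth /(Ck_mxP _ _ oU) hG; apply/(Ck_mxP _ _ oV) => i j.
exact: (Ck_comp_scalar oV VU hth (hG i j)).
Qed.

Lemma pd_comp q r (G : 'rV[R]_p -> 'M[R]_(q, r)) (th : 'rV[R]_m -> 'rV[R]_p) v w dth :
  Ck 1 U G -> U (th v) -> is_derive v w th dth ->
  is_derive v w (fun x => G (th x)) (\sum_a dth 0 a *: pd a G (th v)).
Proof.
move=> CG Uv hth; apply: is_derive_mxP => i j.
have /(Ck_mxP _ _ oU) CGij := CG.
apply: (is_derive_eq (is_derive_chain (CGij i j) Uv hth)).
rewrite summxE; apply: eq_bigr => a _; rewrite mxE pd_mx//.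
by case: (Ck_is_derive a CG Uv).
Qed.

End Composition.

(** * Smooth matrix-valued maps *)

Section SmoothMatrix.
Variables (m : nat) (U : set 'rV[R]_m).
Hypothesis oU : open U.

Lemma Ck_mulmx k p q r (F : 'rV[R]_m -> 'M[R]_(p, q)) (G : 'rV[R]_m -> 'M[R]_(q, r)) :
  Ck k U F -> Ck k U G -> Ck k U (fun u => F u *m G u).
Proof.
move=> /(Ck_mxP _ _ oU) hF /(Ck_mxP _ _ oU) hG; apply/(Ck_mxP _ _ oU) => i j.
apply: (Ck_ext oU (f := fun u => \sum_l F u i l * G u l j)).
  by move=> u _; rewrite mxE.
by apply: Ck_sum => // l _; exact: Ck_mul.
Qed.

Lemma Ck_trmx k p q (F : 'rV[R]_m -> 'M[R]_(p, q)) :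
  Ck k U F -> Ck k U (fun u => (F u)^T).
Proof.
move=> /(Ck_mxP _ _ oU) hF; apply/(Ck_mxP _ _ oU) => i j.
by apply: (Ck_ext oU _ (hF j i)) => u _; rewrite mxE.
Qed.

Lemma Ck_scale k p q (f : 'rV[R]_m -> R) (G : 'rV[R]_m -> 'M[R]_(p, q)) :
  Ck k U f -> Ck k U G -> Ck k U (fun u => f u *: G u).
Proof.
move=> hf /(Ck_mxP _ _ oU) hG; apply/(Ck_mxP _ _ oU) => i j.
apply: (Ck_ext oU (f := fun u => f u * G u i j)); first by move=> u _; rewrite mxE.
exact: Ck_mul.
Qed.

Lemma Ck_det k n (F : 'rV[R]_m -> 'M[R]_n) :
  Ck k U F -> Ck k U (fun u => \det (F u)).
Proof.
move=> /(Ck_mxP _ _ oU) hF; apply: Ck_sum => // s _.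
apply: Ck_mul => //; first exact: Ck_cst.
by apply: Ck_prod => // i; exact: hF.
Qed.

(** Cramer's rule expresses the inverse through determinants of minors. *)
Lemma Ck_invmx k n (F : 'rV[R]_m -> 'M[R]_n) :
  (forall u, U u -> F u \in unitmx) -> Ck k U F -> Ck k U (fun u => invmx (F u)).
Proof.
move=> Fu hF.
apply: (Ck_ext oU (f := fun u => (\det (F u))^-1 *: \adj (F u))).
  by move=> u Uu; rewrite /invmx Fu.
apply: Ck_scale.
  apply: Ck_inv => // [u /Fu|]; last exact: Ck_det.
  by rewrite unitmxE unitfE.
apply/(Ck_mxP _ _ oU) => i j.
apply: (Ck_ext oU (f := fun u => cofactor (F u) j i)); first by move=> u _; rewrite mxE.
apply: Ck_mul => //; first exact: Ck_cst.
apply: Ck_det; apply/(Ck_mxP _ _ oU) => a b.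
have /(Ck_mxP _ _ oU) h := hF.
by apply: (Ck_ext oU _ (h (lift j a) (lift i b))) => u _; rewrite !mxE.
Qed.

End SmoothMatrix.

(** * Strict differentiability *)

Section StrictDifferentiability.

Definition jacobian_mx m p (F : 'rV[R]_m -> 'rV[R]_p) u : 'M[R]_(m, p) :=
  \matrix_(i < m, a < p) pd i F u 0 a.

Lemma row_jacobian m p (F : 'rV[R]_m -> 'rV[R]_p) u i :
  row i (jacobian_mx F u) = pd i F u.
Proof. by apply/rowP => a; rewrite !mxE. Qed.

Lemma Ck_jacobian m p k (U : set 'rV[R]_m) (F : 'rV[R]_m -> 'rV[R]_p) : open U ->
  Ck k.+1 U F -> Ck k U (jacobian_mx F).
Proof.
move=> oU hF; apply/(Ck_mxP _ _ oU) => i a.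
have /(Ck_mxP _ _ oU) h := Ck_pd i hF.
by apply: (Ck_ext oU _ (h 0 a)) => u _; rewrite mxE.
Qed.

(** Any two points near u are compared, not only points with u: this is what makes Newton's
    map contracting on a whole ball. *)
Lemma strict_differential m p (U : set 'rV[R]_m) (F : 'rV[R]_m -> 'rV[R]_p) u (e : R) :
  open U -> Ck 1 U F -> U u -> 0 < e ->
  exists2 d, 0 < d & ball u d `<=` U /\
    forall x y, ball u d x -> ball u d y ->
      `|F y - F x - (y - x) *m jacobian_mx F u| <= e * `|y - x|.
Proof.
move=> oU CF Uu e0.
have m1 : 0 < m%:R + 1 :> R by rewrite ltr_wpDl.
have e1 : 0 < e / (m%:R + 1) by rewrite divr_gt0.
have : \forall w \near u, U w /\ forall a i, `|pd i F w 0 a - pd i F u 0 a| <= e / (m%:R + 1).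
  near=> w; split; first by near: w; exact: open_nbhs_nbhs.
  near: w; apply: filter_forall => a; apply: filter_forall => i.
  have /(Ck_mxP _ _ oU) /(_ 0 a) h := Ck_pd i CF.
  exact: (Ck_near h Uu e1).
move=> /nbhs_ballP[d /= d0 hd]; exists d => //; split=> [w /hd[]//|x y bx by_].
apply: norm_rV_le => [|a]; first by rewrite mulr_ge0// ltW.
have CFa : Ck 1 U (fun w => F w 0 a) by have /(Ck_mxP _ _ oU) := CF; apply.
have := @mean_value_box m (fun w => F w 0 a) (fun i => pd i F u 0 a) _ d u (ltW e1) _ x y bx by_.
move=> /(_ _)/le_trans h.
have -> : (F y - F x - (y - x) *m jacobian_mx F u) 0 a =
   F y 0 a - F x 0 a - \sum_i pd i F u 0 a * (y 0 i - x 0 i).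
  by rewrite !mxE; congr (_ - _); apply: eq_bigr => i _; rewrite !mxE mulrC.
apply: h => [w i /hd[Uw hw]|].
  have [D _] := Ck_is_derive i CFa Uw; split=> //.
  by rewrite -pd_mx//; case: (Ck_is_derive i CF Uw).
rewrite ler_wpM2r// mulrCA -[leRHS]mulr1 ler_pM2l// ler_pdivrMr// mul1r.
by rewrite lerDl.
Unshelve. all: by end_near. Qed.

End StrictDifferentiability.

Lemma norm_mulmx_le m p (A : 'M[R]_(m, p)) :
  exists2 K, 0 < K & forall v : 'rV[R]_m, `|v *m A| <= K * `|v|.
Proof.
exists (1 + \sum_i \sum_a `|A i a|).
  by rewrite ltr_pwDl// sumr_ge0// => i _; rewrite sumr_ge0.
move=> v; apply: norm_rV_le => [|a].
  by rewrite mulr_ge0// addr_ge0// sumr_ge0// => i _; rewrite sumr_ge0.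
rewrite mxE; apply: (le_trans (ler_norm_sum _ _ _)).
apply: (@le_trans _ _ (\sum_i `|A i a| * `|v|)).
  by apply: ler_sum => i _; rewrite normrM mulrC ler_wpM2l//; exact: norm_coord.
rewrite -mulr_suml ler_wpM2r//; apply: ler_wpDl => //.
by apply: ler_sum => i _; rewrite (bigD1 a)//= lerDl sumr_ge0.
Qed.

(** * Symmetry of second derivatives *)

(** Apply the mean value inequality first along the i-th side of the square, to the difference
    of the values on two opposite sides, then along the j-th side. *)
Lemma second_difference m (U : set 'rV[R]_m) (f : 'rV[R]_m -> R) u i j (r e t : R) b :
  open U -> Ck 2 U f -> 0 <= e -> ball u r `<=` U ->
  (forall w, ball u r w -> `|pd j (pd i f) w - b| <= e) ->
  0 < t -> t + t < r ->
  `|f (u + t *: delta_mx 0 i + t *: delta_mx 0 j) - f (u + t *: delta_mx 0 i)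
    - f (u + t *: delta_mx 0 j) + f u - t * t * b| <= e * (t * t).
Proof.
move=> oU C2 e0 bU hb t0 tr.
have bb s s' : s \in `[0, 1]%R -> s' \in `[0, 1]%R ->
  ball u r (u + (t * s') *: delta_mx 0 j + (t * s) *: delta_mx 0 i).
  rewrite !in_itv/= => /andP[s0 s1] /andP[s0' s1'].
  have r0 : 0 < r by apply: lt_trans tr; rewrite addr_gt0.
  apply/rV_ball => // k; rewrite !mxE/= -addrA opprD addrA subrr add0r normrN.
  apply: le_lt_trans tr; apply: le_trans (ler_normD _ _) _.
  have h (c : bool) x : 0 <= x -> x <= 1 -> `|t * x * c%:R| <= t.
    move=> x0 x1; rewrite ger0_norm; last by rewrite !mulr_ge0// ltW.
    by case: c; [rewrite mulr1 ler_piMr// ltW|rewrite mulr0 ltW].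
  by apply: lerD; apply: h.
have i01 : (1 : R) \in `[0, 1]%R by rewrite in_itv/= ler01 lexx.
have i00 : (0 : R) \in `[0, 1]%R by rewrite in_itv/= ler01 lexx.
have bb0 s : s \in `[0, 1]%R -> ball u r (u + (t * s) *: delta_mx 0 i).
  by move=> /bb /(_ i00); rewrite mulr0 scale0r addr0.
pose phi s := f (u + t *: delta_mx 0 j + (t * s) *: delta_mx 0 i)
              - f (u + (t * s) *: delta_mx 0 i).
pose dphi s := (pd i f (u + t *: delta_mx 0 j + (t * s) *: delta_mx 0 i)
              - pd i f (u + (t * s) *: delta_mx 0 i)) * t.
have C1 : Ck 1 U (pd i f) by exact: Ck_pd.
have D1 w k : ball u r w -> derivable f w (delta_mx 0 k).
  by move=> /bU Uw; case: (Ck_is_derive k C2 Uw).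
have H : `|phi 1 - phi 0 - t * t * b| <= e * (t * t).
  apply: (@norm_mean_value phi dphi) => s s01; split.
    rewrite /dphi mulrBl; apply: is_deriveB; apply: is_derive_coord_along.
      by apply: D1; have := bb s 1 s01 i01; rewrite mulr1.
    by apply: D1; exact: bb0.
  rewrite /dphi -mulrA mulrCA mulrC -mulrBr normrM (gtr0_norm t0).
  rewrite mulrCA ler_pM2l//.
  pose psi s' := pd i f (u + (t * s) *: delta_mx 0 i + (t * s') *: delta_mx 0 j).
  have := @norm_mean_value psi (fun s' => pd j (pd i f) (u + (t * s) *: delta_mx 0 i + (t * s') *: delta_mx 0 j) * t) (b * t) (e * t).
  rewrite /psi mulr1 mulr0 scale0r addr0 [t * b]mulrC.
  rewrite [u + t *: _ + _]addrAC; apply=> s' s01'.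
  have bw := bb s s' s01 s01'; rewrite addrAC in bw; split.
    apply: is_derive_coord_along.
    by case: (Ck_is_derive j C1 (bU _ bw)).
  by rewrite -mulrBl normrM (gtr0_norm t0) ler_pM2r// hb.
move: H; rewrite /phi !mulr1 !mulr0 !scale0r !addr0.
rewrite [u + _ + _]addrAC; set A := f _; set B := f _; set C := f _; set D := f u.
by have -> : A - B - (C - D) - t * t * b = A - B - C + D - t * t * b by ring.
Qed.

(** The second difference is symmetric in i and j, so both mixed derivatives at u are within
    arbitrarily small distance of the same number. *)
Lemma schwarz m (U : set 'rV[R]_m) (f : 'rV[R]_m -> R) u i j :
  open U -> Ck 2 U f -> U u -> pd i (pd j f) u = pd j (pd i f) u.
Proof.
move=> oU C2 Uu; apply/eqP; rewrite -subr_eq0 -normr_le0; apply/ler_addgt0Pr => e e0.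
rewrite add0r.
have e2 : 0 < e / 2 by rewrite divr_gt0.
have : \forall w \near u, U w /\ (`|pd j (pd i f) w - pd j (pd i f) u| <= e / 2
   /\ `|pd i (pd j f) w - pd i (pd j f) u| <= e / 2).
  apply: filterI; first exact: open_nbhs_nbhs.
  apply: filterI; first exact: (Ck_near (Ck_pd j (Ck_pd i C2)) Uu e2).
  exact: (Ck_near (Ck_pd i (Ck_pd j C2)) Uu e2).
move=> /nbhs_ballP[r /= r0 hr].
have bU : ball u r `<=` U by move=> w /hr[].
pose t := r / 4; have t0 : 0 < t by rewrite divr_gt0.
have tr : t + t < r by rewrite /t; lra.
have h1 := second_difference (i := i) (j := j) oU C2 (ltW e2) bU (fun w bw => (hr w bw).2.1) t0 tr.
have h2 := second_difference (i := j) (j := i) oU C2 (ltW e2) bU (fun w bw => (hr w bw).2.2) t0 tr.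
move: h1 h2; rewrite [u + t *: delta_mx 0 j + _]addrAC.
set A := f _; set B := f _; set C := f _; set D := f u.
move: (pd i (pd j f) u : R) (pd j (pd i f) u : R) => X Y h1 h2.
have tt : 0 < t * t by rewrite mulr_gt0.
rewrite -(ler_pM2l tt) -[in leLHS](gtr0_norm tt) -normrM.
have -> : t * t * (X - Y) = (A - B - C + D - t * t * Y) - (A - C - B + D - t * t * X).
  by ring.
apply: (le_trans (ler_normB _ _)); apply: (le_trans (lerD h1 h2)).
by rewrite -mulrDl -splitr mulrC.
Qed.

Lemma schwarz_mx m p q (U : set 'rV[R]_m) (F : 'rV[R]_m -> 'M[R]_(p, q)) u i j :
  open U -> Ck 2 U F -> U u -> pd i (pd j F) u = pd j (pd i F) u.
Proof.
move=> oU C2 Uu; apply/matrixP => a b.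
have D k l : pd k (pd l F) u a b = pd k (pd l (fun w => F w a b)) u.
  rewrite pd_mx; last by case: (Ck_is_derive k (Ck_pd l C2) Uu).
  apply: (@pd_ext _ _ U (fun w => pd l F w a b) (pd l (fun w => F w a b)) k u oU Uu) => w Uw.
  by rewrite pd_mx//; case: (Ck_is_derive l C2 Uw).
have /(Ck_mxP _ _ oU) /(_ a b) C2ab := C2.
exact: (etrans (D i j) (etrans (schwarz i j oU C2ab Uu) (esym (D j i)))).
Qed.

(** * The inverse function theorem *)

Lemma half_close_neq0 (x y : R) : 0 < `|x| / 2 -> `|y - x| <= `|x| / 2 -> y != 0.
Proof. by move=> x0 h; apply/eqP => y0; move: h; rewrite y0 sub0r normrN; lra. Qed.

Lemma half_contraction_le (a b e : R) : 0 <= a -> a < e / 2 -> b <= 2^-1 * a -> b + a <= e.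
Proof. by lra. Qed.

Lemma le_half_self_le0 (x : R) : 0 <= x -> x <= 2^-1 * x -> x <= 0.
Proof. by lra. Qed.

Lemma two_half_bound (a b c K : R) : b <= 2^-1 * a -> c <= K -> a <= b + c -> a <= 2 * K.
Proof. by lra. Qed.

Lemma lipschitz_at_continuous (V W : normedModType R) (f : V -> W) (y : V) (K r : R) :
  0 < K -> 0 < r -> (forall w, ball y r w -> `|f w - f y| <= K * `|w - y|) ->
  {for y, continuous f}.
Proof.
move=> K0 r0 hf; apply/cvgrPdist_le => e e0; apply/nbhs_ballP.
exists (Num.min r (e / K)); first by rewrite /= lt_min r0 divr_gt0.
move=> w bw; have bw1 : ball y r w by apply: le_ball bw; rewrite ge_min lexx.
have bw2 : ball y (e / K) w by apply: le_ball bw; rewrite ge_min lexx orbT.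
rewrite /= distrC; apply: (le_trans (hf _ bw1)).
rewrite mulrC -ler_pdivlMr//; apply: ltW.
by move: bw2; rewrite -ball_normE /= distrC.
Qed.

Lemma is_derive_of_bound (V W : normedModType R) (f : V -> W) (z v : V) df :
  (forall e : R, 0 < e -> exists2 d : R, 0 < d & forall h : R, `|h| < d ->
     `|f (z + h *: v) - f z - h *: df| <= e * `|h|) -> is_derive z v f df.
Proof.
move=> H; have C : (fun h : R => h^-1 *: ((f \o shift z) (h *: v) - f z)) @ 0^' --> df.
  apply/cvgrPdist_le => e e0; have [d d0 hd] := H e e0.
  rewrite near_withinE; apply/nbhs_ballP; exists d => //= h.
  rewrite -ball_normE /= sub0r normrN => hh h0.
  have -> : df - h^-1 *: (f (h *: v + z) - f z) =
    - (h^-1 *: (f (z + h *: v) - f z - h *: df)).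
    by rewrite [in RHS]scalerBr scalerA mulVf// scale1r opprB [_ + z]addrC.
  rewrite normrN normrZ normfV mulrC ler_pdivrMr ?normr_gt0//.
  exact: hd.
by apply: DeriveDef; [apply/cvg_ex; exists df|exact: cvg_lim C].
Qed.

Section InverseFunction.
Variables (m : nat) (U : set 'rV[R]_m) (Phi : 'rV[R]_m -> 'rV[R]_m) (u0 : 'rV[R]_m).
Hypotheses (oU : open U) (sPhi : smooth_on U Phi) (Uu0 : U u0).
Hypothesis J0 : jacobian_mx Phi u0 \in unitmx.

Lemma unit_jacobian_near : \forall w \near u0, U w /\ jacobian_mx Phi w \in unitmx.
Proof.
apply: filterI; first exact: open_nbhs_nbhs.
have CJ : Ck 0 U (fun w => \det (jacobian_mx Phi w)).
  by apply: Ck_det => //; apply: Ck_jacobian.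
have d0 : \det (jacobian_mx Phi u0) != 0 by rewrite -unitfE -unitmxE.
have e0 : 0 < `|\det (jacobian_mx Phi u0)| / 2 by rewrite divr_gt0// normr_gt0.
have := Ck_near CJ Uu0 e0; apply: filterS => w hw.
rewrite unitmxE unitfE; exact: half_close_neq0 e0 hw.
Qed.

Let A := invmx (jacobian_mx Phi u0).

(** The map w - Phi w A, where A is the inverse of the jacobian at u0, has derivative zero
    at u0. *)
Lemma newton_map_contracts : exists2 d, 0 < d &
  (forall w, ball u0 d w -> U w /\ jacobian_mx Phi w \in unitmx) /\
  forall x y, ball u0 d x -> ball u0 d y ->
    `|(y - Phi y *m A) - (x - Phi x *m A)| <= 2^-1 * `|y - x|.
Proof.
have [K K0 hK] := norm_mulmx_le A.
have [|d d0 [dU hd]] := strict_differential (e := 2^-1 / K) oU (sPhi 1) Uu0.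
  by rewrite divr_gt0.
have /nbhs_ballP[d' /= d0' hd'] := unit_jacobian_near.
exists (Num.min d d') => [|]; first by rewrite lt_min d0 d0'.
have bl w : ball u0 (Num.min d d') w -> ball u0 d w.
  by apply: le_ball; rewrite ge_min lexx.
have br w : ball u0 (Num.min d d') w -> ball u0 d' w.
  by apply: le_ball; rewrite ge_min lexx orbT.
split=> [w /br/hd'//|x y /bl bx /bl by_].
have -> : (y - Phi y *m A) - (x - Phi x *m A) =
    - ((Phi y - Phi x - (y - x) *m jacobian_mx Phi u0) *m A).
  rewrite mulmxBl mulmxK// mulmxBl; move: (Phi y *m A) (Phi x *m A) => a b.
  by apply/rowP => i; rewrite !mxE; ring.
rewrite normrN; apply: (le_trans (hK _)).
rewrite -ler_pdivlMl//; apply: (le_trans (hd _ _ bx by_)).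
by rewrite mulrA [K^-1 * _]mulrC.
Qed.

(** The displacement |T x - x| attains its minimum on the compact ball; at a minimizer u the
    displacement of T u is at most half of it, so it vanishes. *)
Lemma small_perturbation_fixpoint d (T : 'rV[R]_m -> 'rV[R]_m) : 0 < d ->
  (forall x y, `|u0 - x| <= d -> `|u0 - y| <= d -> `|T y - T x| <= 2^-1 * `|y - x|) ->
  `|u0 - T u0| <= d / 2 -> exists2 u, `|u0 - u| <= d & T u = u.
Proof.
move=> d0 hT hT0.
have stable x : `|u0 - x| <= d -> `|u0 - T x| <= d.
  move=> hx; rewrite -(subrKA (T u0)); apply: (le_trans (ler_normD _ _)).
  rewrite (splitr d); apply: lerD => //.
  apply: (le_trans (hT _ _ hx _)); first by rewrite subrr normr0 ltW.
  by rewrite mulrC ler_pM2r.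
pose D := [set x : 'rV[R]_m | `|u0 - x| <= d].
have Dcb : D = closed_ball u0 d by rewrite closed_ballE.
have cD : compact D.
  apply: bounded_closed_compact; last by rewrite Dcb; exact: closed_ball_closed.
  exists (d + `|u0|); split; first exact: num_real.
  move=> r hr x /= Dx; apply: ltW; apply: le_lt_trans hr.
  rewrite -[x](subrK u0); apply: (le_trans (ler_normD _ _)).
  by rewrite lerD2r distrC.
have fc : {within D, continuous (fun x => `|T x - x|)}.
  apply/subspace_continuousP => x Dx; apply/cvgrPdist_le => e e0.
  rewrite near_withinE; apply/nbhs_ballP; exists (e / 2); first by rewrite /= divr_gt0.
  move=> y; rewrite -ball_normE /= => xy Dy.
  apply: le_trans (ler_dist_dist _ _ : _ <= `|(T x - x) - (T y - y)|) _.
  have -> : T x - x - (T y - y) = (T x - T y) - (x - y) by apply/rowP => i; rewrite !mxE; ring.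
  apply: (le_trans (ler_normB _ _)).
  exact: half_contraction_le (normr_ge0 _) xy (hT _ _ Dy Dx).
have [|u] := EVT_min_rV _ cD fc; first by exists u0; rewrite /D/= subrr normr0 ltW.
rewrite inE => Du hu; exists u => //.
have := hu (T u); rewrite inE => /(_ (stable _ Du)).
move=> /le_trans /(_ (hT _ _ Du (stable _ Du))) h.
apply/eqP; rewrite -subr_eq0 -normr_le0; exact: le_half_self_le0 (normr_ge0 _) h.
Qed.

(** Newton's map being a contraction, Phi is injective on B with a Lipschitz inverse and
    reaches every point of a small ball.  Strict differentiability then gives the inverse the
    derivative [invmx (jacobian_mx Phi (Psi y))], and this formula, which involves no derivative
    of Psi, propagates smoothness from one order to the next. *)
Lemma inverse_function : exists (B : set 'rV[R]_m) (r : R) (Psi : 'rV[R]_m -> 'rV[R]_m),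
  [/\ [/\ open B, B u0, {in B &, injective Phi} & 0 < r],
      forall w, B w -> U w /\ jacobian_mx Phi w \in unitmx,
      forall y, ball (Phi u0) r y -> B (Psi y) /\ Phi (Psi y) = y &
      smooth_on (ball (Phi u0) r) Psi].
Proof.
have [d d0 [dU dT]] := newton_map_contracts.
have [K K0 hK] := norm_mulmx_le A.
pose B : set 'rV[R]_m := ball u0 d.
have e3 : 0 < (d / 2) / 2 / K by rewrite !divr_gt0.
(* For |y - Phi u0| < r the map below displaces u0 by at most a quarter of d,
   which the fixed point lemma on the closed ball of radius d / 2 requires. *)
pose r := (d / 2) / 2 / K.
have lower x y : B x -> B y -> `|y - x| <= 2 * K * `|Phi y - Phi x|.
  move=> Bx By; rewrite -mulrA; apply: two_half_bound (dT _ _ Bx By) (hK (Phi y - Phi x)) _.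
  apply: le_trans (ler_normD _ _); rewrite mulmxBl.
  move: (Phi y *m A) (Phi x *m A) => a b.
  by have -> : y - x = y - a - (x - b) + (a - b) by apply/rowP => i; rewrite !mxE; ring.
have injB : {in B &, injective Phi}.
  move=> x y; rewrite !inE => Bx By Pxy; apply/esym/eqP.
  by have := lower _ _ Bx By; rewrite Pxy subrr normr0 mulr0 normr_le0 subr_eq0.
have ex y : ball (Phi u0) r y -> exists u, B u /\ Phi u = y.
  move=> hy; have d2 : 0 < d / 2 by rewrite divr_gt0.
  have bB x : `|u0 - x| <= d / 2 -> B x.
    move=> hx; rewrite /B -ball_normE /=; apply: le_lt_trans hx _.
    by rewrite ltr_pdivrMr// ltr_pMr// ltr1n.
  have [||u hu Tu] := @small_perturbation_fixpoint (d / 2) (fun x => x - Phi x *m A + y *m A) d2.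
  - move=> x x' hx hx'; have := dT _ _ (bB _ hx) (bB _ hx').
    by rewrite [x - _ + y *m A]addrC addrKA.
  - rewrite -addrA opprD addrA subrr add0r opprD opprK -mulmxBl.
    apply: (le_trans (hK _)); rewrite mulrC -ler_pdivlMr//; apply: ltW.
    by move: hy; rewrite -ball_normE.
  exists u; split; first exact: bB.
  apply/eqP; rewrite eq_sym -subr_eq0; apply/eqP.
  have : (y - Phi u) *m A = 0.
    by rewrite mulmxBl; apply: (addrI u); rewrite addr0 -[RHS]Tu addrCA addrC.
  move=> /(congr1 (fun v => v *m jacobian_mx Phi u0)).
  by rewrite mul0mx mulmxKV.
pose Psi y := xget u0 [set u | B u /\ Phi u = y].
have hPsi y : ball (Phi u0) r y -> B (Psi y) /\ Phi (Psi y) = y.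
  by move=> /ex[u hu]; exact: (@xgetI _ u0 [set u | B u /\ Phi u = y] u hu).
have oV : open (ball (Phi u0) r) by exact: ball_open.
have lip y y' : ball (Phi u0) r y -> ball (Phi u0) r y' ->
    `|Psi y' - Psi y| <= 2 * K * `|y' - y|.
  by move=> /hPsi[h1 h2] /hPsi[h3 h4]; have := lower _ _ h1 h3; rewrite h2 h4.
have K2 : 0 < 2 * K by rewrite mulr_gt0.
have cPsi y : ball (Phi u0) r y -> {for y, continuous Psi}.
  move=> hy; have : \forall w \near y, ball (Phi u0) r w by exact: open_nbhs_nbhs.
  move=> /nbhs_ballP[r' /= r0' hr'].
  by apply: (lipschitz_at_continuous K2 r0') => w /hr' bw; exact: lip.
have dPsi i y : ball (Phi u0) r y ->
  is_derive y (delta_mx 0 i) Psi (row i (invmx (jacobian_mx Phi (Psi y)))).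
  move=> hy; have [By Py] := hPsi y hy; have [Uy Jy] := dU _ By.
  set C := invmx _.
  have [L L0 hL] := norm_mulmx_le C.
  apply: is_derive_of_bound => e e0.
  have [|r1 r10 [_ h1]] := @strict_differential m m U Phi (Psi y) (e / L / (2 * K)) oU (sPhi 1) Uy.
    by rewrite !divr_gt0.
  have : \forall w \near y, ball (Phi u0) r w by exact: open_nbhs_nbhs.
  move=> /nbhs_ballP[r' /= r0' hr'].
  (* The Lipschitz constant 2 K of Psi brings Psi w into the ball of radius r1 where the
     strict differential estimate holds. *)
  exists (Num.min r' (r1 / (2 * K))); first by rewrite lt_min r0' divr_gt0.
  move=> h; rewrite lt_min => /andP[hh1 hh2].
  have nh : `|h *: (delta_mx 0 i : 'rV[R]_m)| <= `|h|.
    rewrite normrZ ler_piMr//; apply: norm_rV_le => // j; rewrite mxE.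
    by case: (_ && _); rewrite ?normr1 ?normr0.
  have bw : ball (Phi u0) r (y + h *: delta_mx 0 i).
    apply: hr'; rewrite -ball_normE /= opprD addrA subrr add0r normrN.
    exact: le_lt_trans nh _.
  have [Bw Pw] := hPsi _ bw.
  have l1 := lip _ _ hy bw; rewrite [y + _]addrC addrK in l1.
  have l2 : `|Psi (h *: delta_mx 0 i + y) - Psi y| <= 2 * K * `|h|.
    by apply: le_trans l1 _; rewrite ler_pM2l.
  have {h1} := h1 (Psi y) (Psi (h *: delta_mx 0 i + y)) (ballxx _ r10) _.
  rewrite [y + _]addrC in Pw; rewrite Pw Py addrK => h1.
  have -> : Psi (y + h *: delta_mx 0 i) - Psi y - h *: row i C =
    - ((h *: delta_mx 0 i - (Psi (h *: delta_mx 0 i + y) - Psi y) *m jacobian_mx Phi (Psi y)) *m C).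
    by rewrite mulmxBl mulmxK// -scalemxAl -rowE opprB [y + _]addrC.
  rewrite normrN; apply: (le_trans (hL _)).
  rewrite -ler_pdivlMl//; apply: le_trans (h1 _) _.
    rewrite -ball_normE /= distrC; apply: le_lt_trans l2 _.
    by rewrite mulrC -ltr_pdivlMr.
  have -> : L^-1 * (e * `|h|) = e / L / (2 * K) * (2 * K * `|h|).
    by rewrite [RHS]mulrA divfK ?gt_eqF// mulrA [L^-1 * e]mulrC.
  by rewrite ler_wpM2l// ltW// !divr_gt0.
have oB : open B by exact: ball_open.
exists B, r, Psi; split=> //; first by split=> //; exact: ballxx.
elim=> [|k IH]; first by split.
apply: (CkI oV cPsi dPsi) => i.
have hC : Ck k B (fun w => row i (invmx (jacobian_mx Phi w))).
  have hJ : Ck k B (jacobian_mx Phi).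
    by apply: Ck_jacobian => //; apply: Ck_sub (sPhi k.+1) => w /dU[].
  have hI : Ck k B (fun w => invmx (jacobian_mx Phi w)).
    by apply: (Ck_invmx oB _ hJ) => w /dU[].
  have hi := @Ck_cst m _ k B (delta_mx 0 i : 'rV[R]_m) oB.
  by apply: (Ck_ext oB _ (Ck_mulmx oB hi hI)) => w _; rewrite [RHS]rowE.
by apply: (Ck_comp oB oV _ IH hC) => v /hPsi[].
Qed.

End InverseFunction.

(** * Euclidean algebra and the curvature of the unit sphere *)

Section EuclideanAlgebra.

Lemma dotE N (v w : 'rV[R]_N) : dot v w = (v *m w^T) 0 0.
Proof. by rewrite mxE; apply: eq_bigr => a _; rewrite mxE. Qed.

Lemma dotM N (v w : 'rV[R]_N) : v *m w^T = (dot v w)%:M.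
Proof. by rewrite [LHS]mx11_scalar dotE. Qed.

Lemma dotC N (v w : 'rV[R]_N) : dot v w = dot w v.
Proof. by apply: eq_bigr => a _; rewrite mulrC. Qed.

Lemma dot_ge0 N (v : 'rV[R]_N) : 0 <= dot v v.
Proof. by apply: sumr_ge0 => a _; rewrite -expr2 sqr_ge0. Qed.

Lemma dot_eq0 N (v : 'rV[R]_N) : dot v v = 0 -> v = 0.
Proof.
move=> /eqP; rewrite psumr_eq0 => [/allP h|a _]; last by rewrite -expr2 sqr_ge0.
apply/rowP => a; have /= := h a (mem_index_enum a).
by rewrite -expr2 sqrf_eq0 mxE => /eqP.
Qed.

Lemma enorm_sqr N (v : 'rV[R]_N) : enorm v ^+ 2 = dot v v.
Proof. by rewrite sqr_sqrtr// dot_ge0. Qed.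

(** If v A A^T = 0 then v A has length zero. *)
Lemma row_free_gram p q (A : 'M[R]_(p, q)) : row_free A -> A *m A^T \in unitmx.
Proof.
move=> fA; rewrite -row_free_unit -kermx_eq0; apply/eqP/row_matrixP => i.
rewrite row0; set v := row i _.
have v0 : v *m (A *m A^T) = 0 by rewrite /v -row_mul mulmx_ker row0.
have : v *m A = 0.
  apply: dot_eq0; rewrite dotE trmx_mul mulmxA -(mulmxA v) v0 mul0mx mxE//.
by move/eqP; rewrite mulmx_free_eq0// => /eqP.
Qed.

Definition line_proj N (p : 'rV[R]_N) : 'M[R]_N := (dot p p)^-1 *: (p^T *m p).

Lemma tprojE N (p w : 'rV[R]_N) : tproj p w = w *m (1%:M - line_proj p).
Proof.
rewrite /tproj mulmxBr mulmx1 -scalemxAr mulmxA dotM mul_scalar_mx scalerA.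
by rewrite mulrC.
Qed.

Lemma is_derive_scale (V : normedModType R) p q (k : V -> R) (F : V -> 'M[R]_(p, q)) u v
    (dk : R) (dF : 'M[R]_(p, q)) :
  is_derive u v k dk -> is_derive u v F dF ->
  is_derive u v (fun w => k w *: F w) (dk *: F u + k u *: dF).
Proof.
move=> hk /is_derive_entry hF; apply: is_derive_mxP => i j.
rewrite (_ : (fun w => _) = (fun w => k w * F w i j)); last first.
  by apply/funext => w; rewrite mxE.
apply: (is_derive_eq (is_deriveM hk (hF i j))).
by rewrite !mxE addrC [F u i j *: _]mulrC.
Qed.

Lemma is_derive_dotl N (c q v : 'rV[R]_N) : is_derive q v (dot c) (dot c v).
Proof.
rewrite (_ : dot c = (fun q : 'rV[R]_N => (c *m q^T) 0 0)); last first.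
  by apply/funext => x; rewrite dotE.
apply: (@is_derive_entry _ 1 1 (fun q : 'rV[R]_N => c *m q^T) q v (c *m v^T)).
apply: (is_derive_eq (is_derive_mulmx (is_derive_cst c q v) (is_derive_trmx (is_derive_id q v)))).
by rewrite mul0mx add0r.
Qed.

Lemma is_derive_dotdot N (q v : 'rV[R]_N) :
  is_derive q v (fun q => dot q q) (2 * dot q v).
Proof.
rewrite (_ : (fun _ => _) = (fun q : 'rV[R]_N => (q *m q^T) 0 0)); last first.
  by apply/funext => x; rewrite dotE.
have h := is_derive_entry (is_derive_mulmx (is_derive_id q v) (is_derive_trmx (is_derive_id q v))) 0 0.
by apply: (is_derive_eq h); rewrite mxE -!dotE mulr_natl mulr2n dotC.
Qed.

Lemma is_derive_dotV N (c q v : 'rV[R]_N) : dot q q != 0 ->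
  is_derive q v (fun q => dot c q / dot q q)
    (dot c v / dot q q - dot c q * (2 * dot q v) / (dot q q * dot q q)).
Proof.
move=> q0; have [d1 e1] := is_derive_dotdot q v.
have hV : is_derive q v (fun q => (dot q q)^-1) (- (dot q q) ^- 2 *: (2 * dot q v)).
  by apply: DeriveDef; [exact: derivableV|rewrite deriveV// e1].
apply: (is_derive_eq (is_deriveM (is_derive_dotl c q v) hV)).
rewrite /GRing.scale/= addrC; congr (_ + _); first by rewrite mulrC.
by rewrite expr2 mulNr mulrN; congr (- _); rewrite -mulrA [_^-1 * _]mulrC.
Qed.

Lemma is_derive_tproj N (c q v : 'rV[R]_N) : dot q q != 0 -> exists al,
  is_derive q v (fun x => tproj x c) (al *: q - (dot c q / dot q q) *: v).
Proof.
move=> q0; eexists.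
have h := is_derive_scale (is_derive_dotV c v q0) (is_derive_id q v).
apply: (is_derive_eq (is_deriveB (is_derive_cst c q v) h)).
by rewrite sub0r opprD -scaleNr.
Qed.

Lemma tproj_self N (q : 'rV[R]_N) : dot q q != 0 -> tproj q q = 0.
Proof. by move=> q0; rewrite /tproj divff// scale1r subrr. Qed.

Lemma tprojZ N (q v : 'rV[R]_N) k : tproj q (k *: v) = k *: tproj q v.
Proof. by rewrite !tprojE scalemxAl. Qed.

Lemma tprojB N (q v w : 'rV[R]_N) : tproj q (v - w) = tproj q v - tproj q w.
Proof. by rewrite !tprojE mulmxBl. Qed.

Lemma tproj_id N (q v : 'rV[R]_N) : dot v q = 0 -> tproj q v = v.
Proof. by move=> h; rewrite /tproj h mul0r scale0r subr0. Qed.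

Lemma dot_tproj N (q v : 'rV[R]_N) : dot q q != 0 -> dot (tproj q v) q = 0.
Proof.
move=> q0; rewrite dotE /tproj mulmxBl -scalemxAl !dotM.
by rewrite !mxE !mulr1n divfK// subrr.
Qed.

(** The field [tproj^~ c] is the gradient of the linear function [dot c] on the spheres, whose
    Hessian there is a multiple of the metric. *)
Lemma covS_tproj N (a c q : 'rV[R]_N) : dot q q != 0 ->
  covS (fun x => tproj x a) (fun x => tproj x c) q = - (dot c q / dot q q) *: tproj q a.
Proof.
move=> q0; have [al [_ h]] := is_derive_tproj c (tproj q a) q0.
rewrite /covS h tprojB !tprojZ tproj_self// scaler0 sub0r scaleNr.
by rewrite [tproj q (tproj q a)]tproj_id// dot_tproj.
Qed.

Lemma near_mono (T : normedModType R) (p : T) (P Q : T -> Prop) :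
  (forall q, P q -> Q q) -> (\forall q \near p, P q) -> \forall q \near p, Q q.
Proof. by move=> PQ; apply: filterS. Qed.

Lemma dot_neq0_near N (p : 'rV[R]_N) : dot p p != 0 -> \forall q \near p, dot q q != 0.
Proof.
move=> p0; have p1 : 0 < `|dot p p| / 2 by rewrite divr_gt0// normr_gt0.
have C : Ck 0 [set: 'rV[R]_N] (fun q => dot q q).
  apply: (Ck_sum openT) => a _; apply: (Ck_mul openT); exact: Ck_coord openT.
by apply: near_mono (Ck_near C I p1) => q; exact: half_close_neq0.
Qed.

Lemma covS_covS N (p a b c : 'rV[R]_N) : dot p p = 1 ->
  dot a p = 0 -> dot b p = 0 -> dot c p = 0 ->
  covS (fun x => tproj x a) (covS (fun x => tproj x b) (fun x => tproj x c)) p = - dot c a *: b.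
Proof.
move=> p1 ap bp cp; have p0 : dot p p != 0 by rewrite p1 oner_eq0.
rewrite {1}/covS.
rewrite (near_eq_derive (g := fun q => (- (dot c q / dot q q)) *: tproj q b)); last first.
  by apply: near_mono (dot_neq0_near p0) => q q0; rewrite covS_tproj.
rewrite [tproj p a]tproj_id//.
have [al h] := is_derive_tproj b a p0.
have [_ ->] := is_derive_scale (is_deriveN (is_derive_dotV c a p0)) h.
rewrite opprfctE p1 cp mulr1 divr1 !mul0r subr0 oppr0 scale0r addr0.
by rewrite [tproj p b]tproj_id// tprojZ tproj_id.
Qed.

(** The bracket term drops out: by [is_derive_tproj] the derivative of [tproj^~ c] at p in any
    direction v is a multiple of p minus [dot c p *: v], and [dot c p = 0]. *)
Lemma curvS_unit N (p a b c : 'rV[R]_N) : dot p p = 1 ->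
  dot a p = 0 -> dot b p = 0 -> dot c p = 0 ->
  curvS p a b c = dot c b *: a - dot c a *: b.
Proof.
move=> p1 ap bp cp; have p0 : dot p p != 0 by rewrite p1 oner_eq0.
rewrite /curvS/= !covS_covS//.
have -> : covS (bracket (fun x => tproj x a) (fun x => tproj x b)) (fun x => tproj x c) p = 0.
  have [al [_ h]] := is_derive_tproj c (bracket (fun x => tproj x a) (fun x => tproj x b) p) p0.
  by rewrite /covS h tprojB !tprojZ tproj_self// scaler0 cp mul0r scale0r subrr.
by rewrite subr0 !scaleNr opprK addrC.
Qed.

End EuclideanAlgebra.

(** * The geometry of a chart in matrix form *)

Lemma row_pd_jacobian m p (U : set 'rV[R]_m) (F : 'rV[R]_m -> 'rV[R]_p) u i j :
  open U -> smooth_on U F -> U u -> row j (pd i (jacobian_mx F) u) = pd i (pd j F) u.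
Proof.
move=> oU sF Uu; apply/rowP => a; rewrite mxE.
rewrite pd_mx; last by case: (Ck_is_derive i (Ck_jacobian oU (sF 2)) Uu).
rewrite pd_mx; last by case: (Ck_is_derive i (Ck_pd j (sF 2)) Uu).
apply: (@pd_ext _ _ U (fun w => jacobian_mx F w j a) (fun w => pd j F w 0 a) i u oU Uu).
by move=> w Uw; rewrite mxE.
Qed.

Lemma mulmx_tr_row0 p q r (v : 'M[R]_(p, q)) (B : 'M[R]_(r, q)) i :
  v *m B^T = 0 -> v *m (row i B)^T = 0.
Proof. by move=> h; rewrite tr_row colE mulmxA h mul0mx. Qed.

Lemma is_derive_dot (V : normedModType R) N (F F' : V -> 'rV[R]_N) u v dF dF' :
  is_derive u v F dF -> is_derive u v F' dF' ->
  is_derive u v (fun w => dot (F w) (F' w)) (dot dF (F' u) + dot (F u) dF').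
Proof.
move=> hF hF'; have h := is_derive_entry (is_derive_mulmx hF (is_derive_trmx hF')) 0 0.
rewrite (_ : (fun w => dot _ _) = (fun w => (F w *m (F' w)^T) 0 0)); last first.
  by apply/funext => w; rewrite dotE.
by apply: (is_derive_eq h); rewrite mxE -!dotE.
Qed.

Lemma pd_dot_const m N (U : set 'rV[R]_m) (F F' : 'rV[R]_m -> 'rV[R]_N) (c : R) u i :
  open U -> smooth_on U F -> smooth_on U F' -> (forall w, U w -> dot (F w) (F' w) = c) ->
  U u -> dot (pd i F u) (F' u) + dot (F u) (pd i F' u) = 0.
Proof.
move=> oU sF sF' FF' Uu.
have h := is_derive_dot (Ck_is_derive i (sF 1) Uu) (Ck_is_derive i (sF' 1) Uu).
rewrite -(pd_is_derive h) (@pd_ext _ _ U _ (fun _ => c) i u oU Uu)//.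
exact: pd_is_derive (is_derive_cst _ _ _).
Qed.

Lemma smooth_pd m (W : normedModType R) (U : set 'rV[R]_m) (F : 'rV[R]_m -> W) i :
  smooth_on U F -> smooth_on U (pd i F).
Proof. by move=> sF k; exact: Ck_pd (sF k.+1). Qed.

Lemma addr_eq_subr (V : zmodType) (x a b : V) : x = a + b -> b = x - a.
Proof. by move=> ->; rewrite addrAC subrr add0r. Qed.

Lemma trmx_oppK p (A B : 'M[R]_p) : A = - B -> B^T = B -> A^T = A.
Proof. by move=> -> h; rewrite linearN/= h. Qed.

Lemma pd_mulmx m (U : set 'rV[R]_m) p q r (F : 'rV[R]_m -> 'M[R]_(p, q))
    (K : 'rV[R]_m -> 'M[R]_(q, r)) u i : Ck 1 U F -> Ck 1 U K -> U u ->
  pd i (fun w => F w *m K w) u = pd i F u *m K u + F u *m pd i K u.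
Proof.
move=> hF hK Uu; apply: pd_is_derive.
exact: (is_derive_mulmx (Ck_is_derive i hF Uu) (Ck_is_derive i hK Uu)).
Qed.

Lemma pd_opp m (U : set 'rV[R]_m) (W : normedModType R) (F : 'rV[R]_m -> W) u i :
  Ck 1 U F -> U u -> pd i (fun w => - F w) u = - pd i F u.
Proof. by move=> hF Uu; apply: pd_is_derive; exact: (is_deriveN (Ck_is_derive i hF Uu)). Qed.

Lemma pd_scale m (U : set 'rV[R]_m) (W : normedModType R) (c : R) (F : 'rV[R]_m -> W) u i :
  Ck 1 U F -> U u -> pd i (fun w => c *: F w) u = c *: pd i F u.
Proof. by move=> hF Uu; apply: pd_is_derive; exact: (is_deriveZ c (Ck_is_derive i hF Uu)). Qed.

Lemma trmx_congr p q (B : 'M[R]_(p, q)) (K : 'M[R]_p) (hK : K^T = K) :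
  (B^T *m K *m B)^T = B^T *m K *m B.
Proof. by rewrite !trmx_mul trmxK hK mulmxA. Qed.

(** Tangent and normal projections are expressed as matrices acting on row vectors of the
    ambient space, so that the tensor identities of the chart become identities between
    matrices of fixed size which can be differentiated by the product rule. *)
Section ChartGeometry.
Variables (m N : nat) (U : set 'rV[R]_m) (X : 'rV[R]_m -> 'rV[R]_N).
Hypotheses (oU : open U) (sX : smooth_on U X).
Hypothesis immX : forall u, U u -> immersive X u.

Definition tangent_basis (u : 'rV[R]_m) : 'M[R]_(m, N) := jacobian_mx X u.
Notation D := tangent_basis.
Notation g := (induced_metric X).
Notation G := (ginv (induced_metric X)).
Definition tangent_proj u : 'M[R]_N := (D u)^T *m G u *m D u.
Notation P := tangent_proj.
(** Written as a product because [sff] projects first to the tangent space of the sphere and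
    then away from M; on a sphere the two factors commute, see [normal_projE]. *)
Definition normal_proj u : 'M[R]_N := (1%:M - line_proj (X u)) *m (1%:M - P u).
Notation Q := normal_proj.

Lemma row_tangent_basis u i : row i (D u) = pd i X u.
Proof. exact: row_jacobian. Qed.

Lemma induced_metricE u : g u = D u *m (D u)^T.
Proof.
apply/matrixP => i j; rewrite mxE dotE mxE [RHS]mxE.
by apply: eq_bigr => a _; rewrite !mxE.
Qed.

Lemma metric_unit u : U u -> g u \in unitmx.
Proof. by move=> /immX; rewrite induced_metricE; exact: row_free_gram. Qed.

Lemma metric_sym u : (g u)^T = g u.
Proof. by rewrite induced_metricE trmx_mul trmxK. Qed.

Lemma ginv_sym u : (G u)^T = G u.
Proof. by rewrite /ginv trmx_inv metric_sym. Qed.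

Lemma mul_metric_ginv u : U u -> D u *m (D u)^T *m G u = 1%:M.
Proof. by move=> Uu; rewrite -induced_metricE mulmxV// metric_unit. Qed.

Lemma tangent_proj_sym u : (P u)^T = P u.
Proof. by rewrite /P !trmx_mul trmxK ginv_sym mulmxA. Qed.

Lemma basis_tangent_proj u : U u -> D u *m P u = D u.
Proof. by move=> Uu; rewrite /P !mulmxA mul_metric_ginv// mul1mx. Qed.

Lemma tangent_proj_idem u : U u -> P u *m P u = P u.
Proof. by move=> Uu; rewrite {1}/P -mulmxA basis_tangent_proj. Qed.

Lemma pdX_tangent_proj u i : U u -> pd i X u *m P u = pd i X u.
Proof. by move=> Uu; rewrite -row_tangent_basis -row_mul basis_tangent_proj. Qed.

Lemma tangent_projE u (w : 'rV[R]_N) :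
  w *m P u = \sum_k \sum_l (G u k l * dot w (pd l X u)) *: pd k X u.
Proof.
rewrite /P !mulmxA [LHS]mulmx_sum_row; apply: eq_bigr => k _.
rewrite row_tangent_basis -scaler_suml; congr (_ *: _).
rewrite mxE; apply: eq_bigr => l _; rewrite mulrC -[in G u l k]ginv_sym mxE.
congr (_ * _); rewrite dotE -row_tangent_basis mxE [RHS]mxE.
by apply: eq_bigr => a _; rewrite !mxE.
Qed.

Lemma nprojE u (w : 'rV[R]_N) : nproj X u w = w *m (1%:M - P u).
Proof. by rewrite /nproj -tangent_projE mulmxBr mulmx1. Qed.

Lemma sffE i j u : sff X i j u = pd i (pd j X) u *m Q u.
Proof. by rewrite /sff nprojE /nablaphi tprojE mulmxA. Qed.

Lemma nabla_perpE i eta u : nabla_perp X i eta u = pd i eta u *m Q u.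
Proof. by rewrite /nabla_perp nprojE /nablaphi tprojE mulmxA. Qed.

Lemma mtraceM p q (T : 'I_m -> 'I_m -> 'rV[R]_p) u (A : 'M[R]_(p, q)) :
  mtrace g T u *m A = mtrace g (fun i j => T i j *m A) u.
Proof.
rewrite /mtrace mulmx_suml; apply: eq_bigr => i _.
by rewrite mulmx_suml; apply: eq_bigr => j _; rewrite scalemxAl.
Qed.

Lemma eq_mtrace p (T T' : 'I_m -> 'I_m -> 'rV[R]_p) u :
  (forall i j, T i j = T' i j) -> mtrace g T u = mtrace g T' u.
Proof. by move=> h; apply: eq_bigr => i _; apply: eq_bigr => j _; rewrite h. Qed.

(** This is the trace of the second derivatives without the Christoffel terms; those are
    tangent to M, so the difference is invisible to the normal projection. *)
Definition lap u : 'rV[R]_N := mtrace g (fun i j => pd i (pd j X) u) u.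

Lemma mean_curvE u : mean_curv X u = m%:R^-1 *: (lap u *m Q u).
Proof. by rewrite /mean_curv mtraceM; congr (_ *: _); apply: eq_mtrace => i j; exact: sffE. Qed.

Lemma Ck_tangent_basis k : Ck k U D.
Proof. by apply: Ck_jacobian. Qed.

Lemma Ck_metric k : Ck k U g.
Proof.
apply: (Ck_ext oU (f := fun u => D u *m (D u)^T)) => [w _|].
  by rewrite induced_metricE.
apply: (Ck_mulmx oU); first exact: Ck_tangent_basis.
exact: (Ck_trmx oU (Ck_tangent_basis k)).
Qed.

Lemma Ck_ginv k : Ck k U G.
Proof. exact: (Ck_invmx oU metric_unit (Ck_metric k)). Qed.

Lemma Ck_tangent_proj k : Ck k U P.
Proof.
apply: (Ck_mulmx oU) (Ck_tangent_basis k).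
exact: (Ck_mulmx oU (Ck_trmx oU (Ck_tangent_basis k)) (Ck_ginv k)).
Qed.

Lemma pd_tangent_basis u i j : U u -> row j (pd i D u) = pd i (pd j X) u.
Proof. exact: row_pd_jacobian oU sX. Qed.

Lemma pd_sym u i j : U u -> pd i (pd j X) u = pd j (pd i X) u.
Proof. exact: schwarz_mx (sX 2). Qed.

Section OnSphere.
Variable r : R.
Hypotheses (r0 : r != 0) (hr : forall u, U u -> dot (X u) (X u) = r).

Lemma pdX_orth u i : U u -> dot (pd i X u) (X u) = 0.
Proof.
move=> Uu; have /eqP := pd_dot_const i oU sX sX hr Uu.
by rewrite [dot (X u) _]dotC -mulr2n mulrn_eq0 => /eqP.
Qed.

Lemma basis_orth u : U u -> D u *m (X u)^T = 0.
Proof.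
move=> Uu; apply/row_matrixP => i; rewrite row_mul row_tangent_basis dotM pdX_orth// row0.
by apply/matrixP => a b; rewrite !mxE mul0rn.
Qed.

Lemma proj_orth u : U u -> P u *m (X u)^T = 0.
Proof. by move=> Uu; rewrite /P -mulmxA basis_orth// mulmx0. Qed.

Lemma proj_line u : U u -> P u *m line_proj (X u) = 0.
Proof. by move=> Uu; rewrite /line_proj -scalemxAr mulmxA proj_orth// mul0mx scaler0. Qed.

Lemma line_proj_sym (p : 'rV[R]_N) : (line_proj p)^T = line_proj p.
Proof. by rewrite /line_proj linearZ/= trmx_mul trmxK. Qed.

Lemma line_projK (p : 'rV[R]_N) : dot p p != 0 -> line_proj p *m p^T = p^T.
Proof.
move=> p0; rewrite /line_proj -scalemxAl -mulmxA dotM mul_mx_scalar scalerA mulVf//.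
by rewrite scale1r.
Qed.

Lemma line_proj_proj u : U u -> line_proj (X u) *m P u = 0.
Proof.
move=> Uu; apply: trmx_inj.
by rewrite trmx_mul tangent_proj_sym line_proj_sym proj_line// trmx0.
Qed.

Lemma normal_projE u : U u -> Q u = 1%:M - line_proj (X u) - P u.
Proof.
by move=> Uu; rewrite /Q mulmxBr mulmx1 mulmxBl mul1mx line_proj_proj// subr0.
Qed.

Lemma normal_proj_sym u : U u -> (Q u)^T = Q u.
Proof. by move=> Uu; rewrite normal_projE// !linearB/= trmx1 tangent_proj_sym line_proj_sym. Qed.

Lemma normal_proj_point u : U u -> Q u *m (X u)^T = 0.
Proof.
move=> Uu; rewrite normal_projE// !mulmxBl mul1mx line_projK ?hr//.
by rewrite proj_orth// subr0 subrr.
Qed.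

Lemma normal_proj_basis u : U u -> Q u *m (D u)^T = 0.
Proof.
move=> Uu; apply: trmx_inj; rewrite trmx_mul trmxK normal_proj_sym// trmx0 normal_projE//.
rewrite !mulmxBr mulmx1 basis_tangent_proj// /line_proj -scalemxAr mulmxA basis_orth//.
by rewrite mul0mx scaler0 subr0 subrr.
Qed.

Lemma normal_proj_proj u : U u -> Q u *m P u = 0.
Proof. by move=> Uu; rewrite /P !mulmxA normal_proj_basis// !mul0mx. Qed.

Lemma normal_proj_idem u : U u -> Q u *m Q u = Q u.
Proof.
move=> Uu; rewrite [X in _ *m X]normal_projE// !mulmxBr mulmx1 normal_proj_proj// subr0.
by rewrite /line_proj -scalemxAr mulmxA normal_proj_point// mul0mx scaler0 subr0.
Qed.

Lemma pdX_normal u i : U u -> pd i X u *m Q u = 0.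
Proof.
move=> Uu; rewrite -row_tangent_basis -row_mul.
have -> : D u *m Q u = 0; last by rewrite row0.
by apply: trmx_inj; rewrite trmx_mul normal_proj_sym// normal_proj_basis// trmx0.
Qed.

End OnSphere.

(** * The shape operator of a parallel mean curvature vector *)

Section ParallelMeanCurvature.
Hypothesis m_gt0 : (0 < m)%N.
Hypothesis hr : forall u, U u -> dot (X u) (X u) = 1.
Notation H := (mean_curv X).
Hypothesis H_parallel : forall u, U u -> forall i, nabla_perp X i H u = 0.
Hypothesis AH_parallel : forall u, U u ->
  forall i j k, nabla_end X (weingarten X H) i j k u = 0.
Hypothesis X_biharmonic : forall u, U u -> bitension g X u = 0.

Let r0 : (1 : R) != 0 := oner_neq0 R.
Let mR : m%:R != 0 :> R. Proof. by rewrite pnatr_eq0 -lt0n. Qed.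

Let QE := normal_projE hr.
Let Qsym := normal_proj_sym hr.
Let QX := normal_proj_point r0 hr.
Let QD := normal_proj_basis hr.
Let QP := normal_proj_proj hr.
Let QQ := normal_proj_idem r0 hr.
Let PX := proj_orth hr.
Let PP := tangent_proj_idem.
Let DP := basis_tangent_proj.

Lemma line_proj_unit u : U u -> line_proj (X u) = (X u)^T *m X u.
Proof. by move=> Uu; rewrite /line_proj hr// invr1 scale1r. Qed.

Lemma Ck_normal_proj k : Ck k U Q.
Proof.
apply: (Ck_ext oU (f := fun u => 1%:M - (X u)^T *m X u - P u)).
  by move=> w Uw; rewrite (QE Uw) line_proj_unit.
apply: (Ck_add oU); last exact: (Ck_opp oU (Ck_tangent_proj k)).
apply: (Ck_add oU); first exact: Ck_cst.
by apply: (Ck_opp oU); apply: (Ck_mulmx oU) (sX k); exact: (Ck_trmx oU (sX k)).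
Qed.

Lemma smooth_mean_curv : smooth_on U H.
Proof.
move=> k; apply: (Ck_ext oU (f := fun u => m%:R^-1 *: (lap u *m Q u))).
  by move=> w _; rewrite mean_curvE.
apply: (Ck_scale oU); first exact: Ck_cst.
apply: (Ck_mulmx oU) (Ck_normal_proj k).
apply: (Ck_sum oU) => i _; apply: (Ck_sum oU) => j _.
apply: (Ck_scale oU); last exact: Ck_pd (Ck_pd _ (sX k.+2)).
by have /(Ck_mxP _ _ oU) := Ck_ginv k; apply.
Qed.

Let sH := smooth_mean_curv.

Lemma lap_normal u : lap u *m Q u = m%:R *: H u.
Proof. by rewrite mean_curvE scalerA divff// scale1r. Qed.

Lemma mean_curv_normal u : U u -> H u *m Q u = H u.
Proof.
by move=> Uu; rewrite mean_curvE -scalemxAl -mulmxA (QQ Uu).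
Qed.

Lemma mean_curv_point u : U u -> H u *m (X u)^T = 0.
Proof.
by move=> Uu; rewrite -mean_curv_normal// -mulmxA (QX Uu) mulmx0.
Qed.

Lemma mean_curv_basis u : U u -> H u *m (D u)^T = 0.
Proof.
by move=> Uu; rewrite -mean_curv_normal// -mulmxA (QD Uu) mulmx0.
Qed.

Lemma dot_mean_curv_pdX u i : U u -> dot (H u) (pd i X u) = 0.
Proof.
move=> Uu; rewrite dotE -row_tangent_basis (mulmx_tr_row0 i (mean_curv_basis Uu)).
by rewrite mxE.
Qed.

Lemma pdH_point u i : U u -> pd i H u *m (X u)^T = 0.
Proof.
move=> Uu; have hX w : U w -> dot (H w) (X w) = 0.
  by move=> Uw; rewrite dotE mean_curv_point// mxE.
have := pd_dot_const i oU sH sX hX Uu.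
by rewrite dot_mean_curv_pdX// addr0 dotM => ->; exact: raddf0.
Qed.

Lemma pdH_tangent u i : U u -> pd i H u *m P u = pd i H u.
Proof.
move=> Uu; have := H_parallel Uu i; rewrite nabla_perpE QE// !mulmxBr mulmx1.
by rewrite line_proj_unit// mulmxA pdH_point// mul0mx subr0 => /subr0_eq.
Qed.

Notation DH := (jacobian_mx H).

Lemma jacH_tangent u : U u -> DH u *m P u = DH u.
Proof. by move=> Uu; apply/row_matrixP => i; rewrite row_mul row_jacobian pdH_tangent. Qed.

(** H is normal to M; differentiate [dot H X_j = 0]. *)
Lemma jacH_basis u i j : U u ->
  dot (pd i H u) (pd j X u) = - dot (H u) (pd i (pd j X) u).
Proof.
move=> Uu; have h w : U w -> dot (H w) (pd j X w) = 0 by exact: dot_mean_curv_pdX.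
by have /eqP := pd_dot_const i oU sH (smooth_pd j sX) h Uu; rewrite addr_eq0 => /eqP.
Qed.

Lemma mul_jacobian_tr p (F : 'rV[R]_m -> 'rV[R]_p) (F' : 'rV[R]_m -> 'rV[R]_p) u i j :
  (jacobian_mx F u *m (jacobian_mx F' u)^T) i j = dot (pd i F u) (pd j F' u).
Proof. by rewrite mxE; apply: eq_bigr => a _; rewrite !mxE. Qed.

Lemma jacH_basis_sym u : U u -> DH u *m (D u)^T = D u *m (DH u)^T.
Proof.
move=> Uu; apply/matrixP => i j.
apply: (etrans (mul_jacobian_tr H X u i j)).
apply: (etrans (jacH_basis i j Uu)).
apply: (etrans _ (esym (mul_jacobian_tr X H u i j))).
apply: (etrans _ (dotC _ _)).
apply: (etrans _ (esym (jacH_basis j i Uu))).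
exact: (congr1 (fun v => - dot (H u) v) (pd_sym i j Uu)).
Qed.

(** Defined through X_i A = - H_i, which characterizes the shape operator because the
    derivatives of the parallel section H are tangent to M. *)
Definition ambient_weingarten u : 'M[R]_N := - ((D u)^T *m G u *m DH u).
Notation A := ambient_weingarten.

Lemma basis_weingarten u : U u -> D u *m A u = - DH u.
Proof. by move=> Uu; rewrite /A mulmxN !mulmxA (mul_metric_ginv Uu) mul1mx. Qed.

Lemma pdX_weingarten u i : U u -> pd i X u *m A u = - pd i H u.
Proof.
by move=> Uu; rewrite -row_tangent_basis -row_mul basis_weingarten// linearN/= row_jacobian.
Qed.

Lemma weingarten_proj u : U u -> A u *m P u = A u.
Proof. by move=> Uu; rewrite /A mulNmx -!mulmxA jacH_tangent. Qed.

Lemma proj_basisT u : U u -> P u *m (D u)^T = (D u)^T.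
Proof. by move=> Uu; apply: trmx_inj; rewrite trmx_mul trmxK tangent_proj_sym DP. Qed.

Lemma proj_weingarten u : U u -> P u *m A u = A u.
Proof. by move=> Uu; rewrite /A mulmxN !mulmxA proj_basisT. Qed.

Lemma weingarten_sym u : U u -> (A u)^T = A u.
Proof.
move=> Uu; have AE : A u = - ((D u)^T *m (G u *m (DH u *m (D u)^T) *m G u) *m D u).
  by rewrite -weingarten_proj// /A mulNmx /P !mulmxA.
have S : (DH u *m (D u)^T)^T = DH u *m (D u)^T.
  by rewrite trmx_mul trmxK jacH_basis_sym.
have K := trmx_congr (G u) S; rewrite ginv_sym in K.
exact: (trmx_oppK AE (trmx_congr (D u) K)).
Qed.

Lemma smooth_weingarten k : Ck k U A.
Proof.
apply: (Ck_opp oU); apply: (Ck_mulmx oU); last exact: Ck_jacobian.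
exact: (Ck_mulmx oU (Ck_trmx oU (Ck_tangent_basis k)) (Ck_ginv k)).
Qed.

(** The Koszul computation: the metric derivatives z, written with the products y of first and
    second derivatives of X, leave a single y. *)
Lemma christoffel_symbol_algebra (z y : 'I_m -> 'I_m -> 'I_m -> R) i j l (q : R) :
  (forall p q s, z p q s = y s p q + y s q p) -> (forall s p q, y s p q = y p s q) ->
  2^-1 * (q * (z j l i + z i l j - z i j l)) = q * y i j l.
Proof. by move=> zE ysym; rewrite !zE (ysym i l) (ysym j l) (ysym j i); field. Qed.

Lemma christoffelE u k i j : U u ->
  christoffel g k i j u = \sum_l G u k l * dot (pd i (pd j X) u) (pd l X u).
Proof.
move=> Uu; rewrite /christoffel mulr_sumr; apply: eq_bigr => l _.
pose y s p q := dot (pd s (pd p X) u) (pd q X u).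
have dg p q s : pd s (fun v => g v p q) u = y s p q + y s q p.
  have h := is_derive_dot (Ck_is_derive s (Ck_pd p (sX 2)) Uu) (Ck_is_derive s (Ck_pd q (sX 2)) Uu).
  apply: etrans (etrans (pd_is_derive h) _); last by congr (_ + _); exact: dotC.
  by apply: (@pd_ext _ _ U _ _ s u oU Uu) => w Uw; rewrite mxE.
have ysym s p q : y s p q = y p s q by exact: (congr1 (fun v => dot v (pd q X u)) (pd_sym s p Uu)).
exact: (christoffel_symbol_algebra i j l (G u k l) dg ysym).
Qed.

(** The Levi-Civita connection of the induced metric is the tangential part of the flat
    derivative. *)
Lemma christoffel_proj u i j : U u ->
  \sum_k christoffel g k i j u *: pd k X u = pd i (pd j X) u *m P u.
Proof.
move=> Uu; rewrite tangent_projE; apply: eq_bigr => k _.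
by rewrite christoffelE// scaler_suml.
Qed.

(** * Parallel shape operator and integrability *)

(** The shape operator of H in the coordinate basis; the operator [ambient_weingarten] has it
    as matrix, by [jacH_weingarten]. *)
Definition weingarten_mx u : 'M[R]_m := \matrix_(i, k) weingarten X H i k u.

Lemma weingarten_mxE u : U u -> weingarten_mx u = - (DH u *m (D u)^T) *m G u.
Proof.
move=> Uu; apply/matrixP => i k; rewrite mxE [RHS]mxE; apply: eq_bigr => j _.
congr (_ * _); rewrite mxE (mul_jacobian_tr H X u i j) (jacH_basis i j Uu) opprK.
rewrite dotC sffE !dotE; congr (_ 0 0).
by rewrite trmx_mul (Qsym Uu) mulmxA (mean_curv_normal Uu).
Qed.

Lemma Ck_weingarten_mx k : Ck k U weingarten_mx.
Proof.
apply: (Ck_ext oU (f := fun u => - (DH u *m (D u)^T) *m G u)).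
  by move=> w Uw; rewrite weingarten_mxE.
apply: (Ck_mulmx oU) (Ck_ginv k); apply: (Ck_opp oU).
apply: (Ck_mulmx oU); first exact: (Ck_jacobian oU (sH k.+1)).
exact: (Ck_trmx oU (Ck_tangent_basis k)).
Qed.

Lemma jacH_weingarten u : U u -> DH u = - (weingarten_mx u *m D u).
Proof.
move=> Uu; rewrite weingarten_mxE// !mulNmx opprK -[LHS]jacH_tangent//.
by rewrite /P !mulmxA.
Qed.

Definition christoffel_mx l u : 'M[R]_m := \matrix_(q, k) christoffel g k l q u.

Lemma pd_basis_proj l u : U u -> pd l D u *m P u = christoffel_mx l u *m D u.
Proof.
move=> Uu; apply/row_matrixP => q; rewrite !row_mul pd_tangent_basis//.
rewrite -christoffel_proj// [RHS]mulmx_sum_row; apply: eq_bigr => k _.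
by rewrite row_tangent_basis !mxE.
Qed.

(** The vanishing of nabla A_H, solved for the partial derivatives. *)
Lemma pd_weingarten_mx l u : U u -> pd l weingarten_mx u =
  christoffel_mx l u *m weingarten_mx u - weingarten_mx u *m christoffel_mx l u.
Proof.
move=> Uu; apply/matrixP => i k; have := AH_parallel Uu l i k.
rewrite /nabla_end => /eqP; rewrite subr_eq0 eq_sym -subr_eq => /eqP h.
rewrite pd_mx; last by case: (Ck_is_derive l (Ck_weingarten_mx 1) Uu).
transitivity (pd l (weingarten X H i k) u).
  by apply: (@pd_ext _ _ U _ _ l u oU Uu) => w _; rewrite mxE.
rewrite -h !mxE; congr (_ - _); apply: eq_bigr => j _; by rewrite !mxE.
Qed.

(** Differentiate dh = - w d along a direction; by the two derivative formulas the
    connection matrix ga cancels and only the term with d' survives. *)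
Lemma jacH_tangent_algebra p q (d d' dh dh' : 'M[R]_(p, q)) (w w' ga : 'M[R]_p) (a pr : 'M[R]_q) :
  dh' = - (w' *m d + w *m d') -> d' *m pr = ga *m d -> w' = ga *m w - w *m ga ->
  dh = - (w *m d) -> d *m a = - dh -> d *m pr = d -> pr *m a = a ->
  dh' *m pr = - (d' *m a).
Proof.
move=> -> d'p w'E dhE da dp pa.
rewrite -[in RHS]pa [in RHS]mulmxA d'p -[in RHS]mulmxA da dhE opprK mulNmx.
rewrite mulmxDl -[w' *m d *m pr]mulmxA dp -[w *m d' *m pr]mulmxA d'p w'E mulmxBl.
by rewrite !mulmxA subrK.
Qed.

Lemma pd_jacH_tangent l u : U u -> pd l DH u *m P u = - (pd l D u *m A u).
Proof.
move=> Uu; apply: (jacH_tangent_algebra _ (pd_basis_proj l Uu) (pd_weingarten_mx l Uu)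
  (jacH_weingarten Uu) (basis_weingarten Uu) (DP Uu) (proj_weingarten Uu)).
rewrite -(pd_mulmx l (Ck_weingarten_mx 1) (Ck_tangent_basis 1) Uu).
rewrite -(pd_opp l _ Uu); last exact: (Ck_mulmx oU (Ck_weingarten_mx 1) (Ck_tangent_basis 1)).
by apply: (@pd_ext _ _ U _ _ l u oU Uu) => w Uw; exact: jacH_weingarten.
Qed.

Lemma Ck_jacH k : Ck k U DH.
Proof. exact: (Ck_jacobian oU (sH k.+1)). Qed.

Lemma basis_pd_proj l u : U u -> D u *m pd l P u = pd l D u - pd l D u *m P u.
Proof.
move=> Uu; have := pd_mulmx l (Ck_tangent_basis 1) (Ck_tangent_proj 1) Uu.
by rewrite (@pd_ext _ _ U _ D l u oU Uu) => [/addr_eq_subr|w Uw]; last exact: DP.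
Qed.

Lemma basis_pd_weingarten l u : U u -> D u *m pd l A u = - pd l DH u - pd l D u *m A u.
Proof.
move=> Uu; have := pd_mulmx l (Ck_tangent_basis 1) (smooth_weingarten 1) Uu.
rewrite (@pd_ext _ _ U _ (fun w => - DH w) l u oU Uu) => [|w Uw]; last exact: basis_weingarten.
by rewrite (pd_opp l (Ck_jacH 1) Uu) => /addr_eq_subr.
Qed.

Lemma cancel_tangent_part p q (b x d' : 'M[R]_(p, q)) (a pr : 'M[R]_q) :
  x = - b - d' *m a -> b *m pr = - (d' *m a) -> a *m pr = a -> x *m pr = 0.
Proof. by move=> -> e1 e2; rewrite mulmxBl mulNmx e1 opprK -mulmxA e2 subrr. Qed.

(** The tangent-tangent block of the derivative of A is its covariant derivative, which is
    zero. *)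
Lemma basis_pd_weingarten_proj l u : U u -> D u *m pd l A u *m P u = 0.
Proof.
move=> Uu.
exact: cancel_tangent_part (basis_pd_weingarten l Uu) (pd_jacH_tangent l Uu) (weingarten_proj Uu).
Qed.

(** Differentiating P A = A and A P = A determines every block of the derivative of A except
    the tangent-tangent one, which is assumed to vanish. *)
Lemma derive_two_sided p q (d : 'M[R]_(q, p)) (ga : 'M[R]_q) (a a' pr pr' : 'M[R]_p) :
  a' = pr' *m a + pr *m a' -> a' = a' *m pr + a *m pr' -> pr *m a = a ->
  pr = d^T *m ga *m d -> d *m a' *m pr = 0 -> a' = pr' *m a + a *m pr'.
Proof.
move=> h1 h2 pa prE da; rewrite {1}h1 {1}h2 mulmxDr !mulmxA pa.
rewrite (_ : pr *m a' *m pr = 0) ?add0r//.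
by rewrite {1}prE -(mulmxA _ d a') -(mulmxA _ (d *m a') pr) da mulmx0.
Qed.

(** A is parallel, so it changes only through the motion of the tangent space. *)
Lemma pd_weingarten l u : U u -> pd l A u = pd l P u *m A u + A u *m pd l P u.
Proof.
move=> Uu.
have h1 := pd_mulmx l (Ck_tangent_proj 1) (smooth_weingarten 1) Uu.
rewrite (@pd_ext _ _ U _ A l u oU Uu) in h1 => [|w Uw]; last exact: proj_weingarten.
have h2 := pd_mulmx l (smooth_weingarten 1) (Ck_tangent_proj 1) Uu.
rewrite (@pd_ext _ _ U _ A l u oU Uu) in h2 => [|w Uw]; last exact: weingarten_proj.
exact: (derive_two_sided h1 h2 (proj_weingarten Uu) erefl (basis_pd_weingarten_proj l Uu)).
Qed.

Lemma commutator_algebra p (a pk pl pkl plk : 'M[R]_p) :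
  pkl *m a + pl *m (pk *m a + a *m pk) + ((pk *m a + a *m pk) *m pl + a *m pkl) =
  plk *m a + pk *m (pl *m a + a *m pl) + ((pl *m a + a *m pl) *m pk + a *m plk) ->
  pkl = plk ->
  pl *m pk *m a + a *m pk *m pl = pk *m pl *m a + a *m pl *m pk.
Proof.
move=> h e; move: h; rewrite e !mulmxDr !mulmxDl !mulmxA.
move: (plk *m a) (a *m plk) (pl *m pk *m a) (a *m pk *m pl) (pk *m pl *m a) (a *m pl *m pk)
  (pl *m a *m pk) (pk *m a *m pl) => x y b c d f s t /matrixP h.
by apply/matrixP => i j; have := h i j; rewrite !mxE; lra.
Qed.

Lemma product_rule_twice p (x y a pj pij a' b : 'M[R]_p) :
  x = pij *m a + pj *m a' -> y = a' *m pj + a *m pij -> a' = b ->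
  x + y = pij *m a + pj *m b + (b *m pj + a *m pij).
Proof. by move=> -> -> ->. Qed.

(** Substitute [pd_weingarten] into the second derivatives of A and compare the two orders of
    differentiation.  What remains says that A commutes with the bracket of P_k and P_l, which
    is the curvature operator of M and of its normal bundle. *)
Lemma curvature_commutes k l u : U u ->
  pd l P u *m pd k P u *m A u + A u *m pd k P u *m pd l P u =
  pd k P u *m pd l P u *m A u + A u *m pd l P u *m pd k P u.
Proof.
move=> Uu; apply: commutator_algebra (schwarz_mx k l oU (Ck_tangent_proj 2) Uu).
have E i j : pd i (pd j A) u = pd i (pd j P) u *m A u + pd j P u *m (pd i P u *m A u + A u *m pd i P u)
   + ((pd i P u *m A u + A u *m pd i P u) *m pd j P u + A u *m pd i (pd j P) u).
  have C1 := Ck_mulmx oU (Ck_pd j (Ck_tangent_proj 2)) (smooth_weingarten 1).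
  have C2 := Ck_mulmx oU (smooth_weingarten 1) (Ck_pd j (Ck_tangent_proj 2)).
  have h := is_deriveD (Ck_is_derive i C1 Uu) (Ck_is_derive i C2 Uu).
  rewrite (@pd_ext _ _ U _ (fun w => pd j P w *m A w + A w *m pd j P w) i u oU Uu).
    apply: (etrans (pd_is_derive h)); apply: (product_rule_twice
      (pd_mulmx i (Ck_pd j (Ck_tangent_proj 2)) (smooth_weingarten 1) Uu)
      (pd_mulmx i (smooth_weingarten 1) (Ck_pd j (Ck_tangent_proj 2)) Uu)).
    exact: pd_weingarten.
  by move=> w Uw; exact: pd_weingarten.
exact: etrans (esym (E k l)) (etrans (schwarz_mx k l oU (smooth_weingarten 2) Uu) (E l k)).
Qed.

Lemma second_form_algebra p q (d d' x : 'M[R]_(p, q)) (a a' pr pr' : 'M[R]_q) :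
  d *m a' = x -> a' = pr' *m a + a *m pr' -> d *m pr' = d' - d' *m pr -> pr *m a = a ->
  d *m a *m pr' = x.
Proof.
move=> <- -> e pa; rewrite mulmxDr !mulmxA e mulmxBl -(mulmxA d') pa subrr add0r//.
Qed.

Lemma basis_weingarten_pd_proj l u : U u ->
  D u *m A u *m pd l P u = - pd l DH u - pd l D u *m A u.
Proof.
move=> Uu; exact: (second_form_algebra (basis_pd_weingarten l Uu) (pd_weingarten l Uu)
  (basis_pd_proj l Uu) (proj_weingarten Uu)).
Qed.

Lemma row_of_eq p q (d dh d' : 'M[R]_(p, q)) (a pr' : 'M[R]_q) b (x y z : 'rV[R]_q) :
  d *m a *m pr' = - dh - d' *m a -> row b d = x -> row b dh = y -> row b d' = z ->
  x *m a *m pr' = - y - z *m a.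
Proof. by move=> /(congr1 (row b)); rewrite !row_mul linearB/= linearN/= row_mul => h <- <- <-. Qed.

(** The left side is the second fundamental form of M in the ambient space, applied to
    A X_b and X_l. *)
Lemma weingarten_pd_proj b l u : U u ->
  pd b X u *m A u *m pd l P u = - pd l (pd b H) u - pd l (pd b X) u *m A u.
Proof.
move=> Uu; exact: (row_of_eq (basis_weingarten_pd_proj l Uu) (row_tangent_basis u b)
  (row_pd_jacobian l b oU sH Uu) (pd_tangent_basis l b Uu)).
Qed.

(** Both terms of [weingarten_pd_proj] are second derivatives, hence symmetric. *)
Lemma weingarten_pd_proj_sym b l u : U u ->
  pd b X u *m A u *m pd l P u = pd l X u *m A u *m pd b P u.
Proof.
move=> Uu; apply: (etrans (weingarten_pd_proj b l Uu)).
apply: (etrans _ (esym (weingarten_pd_proj l b Uu))).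
exact: (congr2 (fun x y => - x - y *m A u) (schwarz_mx l b oU (sH 2) Uu) (pd_sym l b Uu)).
Qed.

(** X_b P_l is the second fundamental form of M in the ambient Euclidean space. *)
Lemma pdX_pd_proj b l u : U u ->
  pd b X u *m pd l P u = pd l (pd b X) u *m (1%:M - P u).
Proof.
move=> Uu; have := congr1 (row b) (basis_pd_proj l Uu).
by rewrite linearB/= !row_mul pd_tangent_basis// row_tangent_basis mulmxBr mulmx1.
Qed.

Lemma pdX_pd_proj_sym b l u : U u -> pd b X u *m pd l P u = pd l X u *m pd b P u.
Proof.
move=> Uu; apply: (etrans (pdX_pd_proj b l Uu)); apply: (etrans _ (esym (pdX_pd_proj l b Uu))).
exact: (congr1 (fun x => x *m _) (pd_sym l b Uu)).
Qed.

Lemma X_proj w : U w -> X w *m P w = 0.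
Proof.
move=> Uw; apply: trmx_inj; rewrite trmx_mul tangent_proj_sym trmx0; exact: PX.
Qed.

Lemma H_proj w : U w -> H w *m P w = 0.
Proof. by move=> Uw; rewrite /P !mulmxA mean_curv_basis// !mul0mx. Qed.

(** Differentiate F P = 0. *)
Lemma pd_proj_of_normal_field i u (F : 'rV[R]_m -> 'rV[R]_N) : smooth_on U F -> U u ->
  (forall w, U w -> F w *m P w = 0) -> F u *m pd i P u = - (pd i F u *m P u).
Proof.
move=> sF Uu h; have := pd_mulmx i (sF 1) (Ck_tangent_proj 1) Uu.
rewrite (@pd_ext _ _ U _ (fun=> 0) i u oU Uu) => [|w Uw]; last exact: h.
rewrite (pd_is_derive (is_derive_cst _ _ _)) => /esym/eqP.
by rewrite addrC addr_eq0 => /eqP.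
Qed.

Lemma X_pd_proj i u : U u -> X u *m pd i P u = - pd i X u.
Proof. by move=> Uu; rewrite (pd_proj_of_normal_field i sX Uu X_proj) pdX_tangent_proj. Qed.

Lemma H_pd_proj i u : U u -> H u *m pd i P u = pd i X u *m A u.
Proof. by move=> Uu; rewrite (pd_proj_of_normal_field i sH Uu H_proj) pdH_tangent// pdX_weingarten. Qed.

Lemma pd_proj_sym i u : U u -> (pd i P u)^T = pd i P u.
Proof.
move=> Uu; have h := is_derive_trmx (Ck_is_derive i (Ck_tangent_proj 1) Uu).
rewrite -(pd_is_derive h); apply: (@pd_ext _ _ U _ P i u oU Uu) => w _.
exact: tangent_proj_sym.
Qed.

Lemma projection_deriv_algebra p q (d d' : 'M[R]_(p, q)) (ga : 'M[R]_p) (pr pr' : 'M[R]_q) :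
  pr = d^T *m ga *m d -> d *m pr' = d' - d' *m pr -> pr *m pr = pr -> pr *m pr' *m pr = 0.
Proof.
move=> prE e pp; rewrite {1}prE -(mulmxA _ d pr') e -mulmxA mulmxBl -(mulmxA d') pp.
by rewrite subrr mulmx0.
Qed.

Lemma proj_pd_proj i u : U u -> P u *m pd i P u *m P u = 0.
Proof.
move=> Uu; exact: (projection_deriv_algebra erefl (basis_pd_proj i Uu) (tangent_proj_idem Uu)).
Qed.

Lemma weingarten_normal u : U u -> A u *m Q u = 0.
Proof.
move=> Uu; rewrite -weingarten_proj// -mulmxA.
have -> : P u *m Q u = 0; last by rewrite mulmx0.
by apply: trmx_inj; rewrite trmx_mul Qsym// tangent_proj_sym QP// trmx0.
Qed.

Lemma vector_decomposition u (w : 'rV[R]_N) : U u ->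
  w = w *m Q u + w *m P u + (w *m (X u)^T) *m X u.
Proof.
move=> Uu; rewrite QE// line_proj_unit// !mulmxBr mulmx1 mulmxA.
by rewrite subrK subrK.
Qed.

Lemma pd_proj_point j u : U u -> pd j P u *m (X u)^T = - (pd j X u)^T.
Proof.
move=> Uu; apply: trmx_inj.
by rewrite trmx_mul trmxK (pd_proj_sym j Uu) (X_pd_proj j Uu) linearN/= trmxK.
Qed.

(** * Contraction with the metric and the biharmonic equation *)

Lemma mtraceD q (T T' : 'I_m -> 'I_m -> 'rV[R]_q) u :
  mtrace g (fun i j => T i j + T' i j) u = mtrace g T u + mtrace g T' u.
Proof.
rewrite /mtrace -big_split; apply: eq_bigr => i _.
by rewrite -big_split; apply: eq_bigr => j _; rewrite scalerDr.
Qed.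

Lemma mtraceZ q (T : 'I_m -> 'I_m -> 'rV[R]_q) (c : R) u :
  mtrace g (fun i j => c *: T i j) u = c *: mtrace g T u.
Proof.
rewrite /mtrace scaler_sumr; apply: eq_bigr => i _.
by rewrite scaler_sumr; apply: eq_bigr => j _; rewrite !scalerA mulrC.
Qed.

Lemma mtraceN q (T : 'I_m -> 'I_m -> 'rV[R]_q) u :
  mtrace g (fun i j => - T i j) u = - mtrace g T u.
Proof.
rewrite -scaleN1r -mtraceZ; apply: eq_bigr => i _; apply: eq_bigr => j _.
by rewrite scaleN1r.
Qed.

Lemma mtrace_swap q (T : 'I_m -> 'I_m -> 'rV[R]_q) u :
  mtrace g (fun i j => T j i) u = mtrace g T u.
Proof.
rewrite /mtrace exchange_big; apply: eq_bigr => i _; apply: eq_bigr => j _.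
by rewrite -[in LHS]ginv_sym mxE.
Qed.

Lemma row_mul_col p q r (M : 'M[R]_(p, q)) (K : 'M[R]_(q, r)) i j :
  row i M *m col j K = ((M *m K) i j)%:M.
Proof.
rewrite [LHS]mx11_scalar; congr (_%:M).
by rewrite !mxE; apply: eq_bigr => k _; rewrite !mxE.
Qed.

Lemma pdX_form u (B : 'M[R]_N) i j :
  pd i X u *m B *m (pd j X u)^T = ((D u *m B *m (D u)^T) i j)%:M.
Proof. by rewrite -!row_tangent_basis -row_mul tr_row row_mul_col. Qed.

Lemma pdX_gram u i j : pd i X u *m (pd j X u)^T = ((D u *m (D u)^T) i j)%:M.
Proof. by rewrite -!row_tangent_basis tr_row row_mul_col. Qed.

(** Contracting X_i^T X_j with the inverse metric gives P. *)
Lemma mtrace_form u (B : 'M[R]_N) :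
  mtrace g (fun i j => pd i X u *m B *m (pd j X u)^T) u = (\tr (B *m P u))%:M.
Proof.
have -> : \tr (B *m P u) = \tr (G u *m (D u *m B *m (D u)^T)).
  rewrite /P (_ : B *m _ = (B *m (D u)^T) *m (G u *m D u)); last by rewrite !mulmxA.
  by rewrite mxtrace_mulC !mulmxA.
rewrite /mtrace exchange_big /mxtrace raddf_sum; apply: eq_bigr => j _.
rewrite mxE raddf_sum; apply: eq_bigr => i _.
by rewrite -[in RHS]ginv_sym mxE pdX_form scale_scalar_mx.
Qed.

(** The trace of the Gram projector is that of the identity matrix of size m. *)
Lemma tr_tangent_proj u : U u -> \tr (P u) = m%:R.
Proof.
move=> Uu; rewrite /P -mulmxA mxtrace_mulC -mulmxA -induced_metricE.
by rewrite mulVmx ?metric_unit// mxtrace1.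
Qed.

Lemma tensionE u : U u -> tension g X u = m%:R *: H u.
Proof.
move=> Uu; rewrite -lap_normal mtraceM; apply: eq_mtrace => i j.
by rewrite /hessphi christoffel_proj// /nablaphi tprojE QE// -mulmxBr.
Qed.

Lemma nabla_tension j u : U u -> nablaphi X j (tension g X) u = m%:R *: pd j H u.
Proof.
move=> Uu; rewrite /nablaphi (@pd_ext _ _ U _ (fun w => m%:R *: H w) j u oU Uu) => [|w]; last exact: tensionE.
rewrite (pd_scale _ j (sH 1) Uu) tprojE line_proj_unit// mulmxBr mulmx1.
by rewrite -scalemxAl mulmxA pdH_point// mul0mx scaler0 subr0.
Qed.

Lemma hessian_tension_algebra p (h hp xa : 'rV[R]_p) (e pr : 'M[R]_p) (c : R) s :
  hp = c *: h *m (1%:M - e) -> s = - (c *: xa) -> h *m pr = - xa ->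
  hp - s = c *: (h *m (1%:M - e - pr)).
Proof.
by move=> -> -> e1; rewrite opprK [h *m (_ - _ - _)]mulmxBr e1 opprK scalerDr scalemxAl.
Qed.

Lemma row_mul_eq p q (dh d' : 'M[R]_(p, q)) (pr a : 'M[R]_q) j (y z : 'rV[R]_q) :
  dh *m pr = - (d' *m a) -> row j dh = y -> row j d' = z -> y *m pr = - (z *m a).
Proof. by move=> /(congr1 (row j)); rewrite row_mul linearN/= row_mul => h <- <-. Qed.

Lemma pdH_second_tangent i j u : U u ->
  pd i (pd j H) u *m P u = - (pd i (pd j X) u *m A u).
Proof.
move=> Uu; exact: (row_mul_eq (pd_jacH_tangent i Uu) (row_pd_jacobian i j oU sH Uu)
  (pd_tangent_basis i j Uu)).
Qed.

(** The tangential part of the second derivative of H is - X_ij A by [pdH_second_tangent], and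
    it is cancelled by the Christoffel term. *)
Lemma hessian_tension i j u : U u ->
  nablaphi X i (nablaphi X j (tension g X)) u
    - \sum_k christoffel g k i j u *: nablaphi X k (tension g X) u
  = m%:R *: (pd i (pd j H) u *m Q u).
Proof.
move=> Uu; rewrite QE//.
apply: hessian_tension_algebra (pdH_second_tangent i j Uu).
  rewrite {1}/nablaphi (@pd_ext _ _ U _ (fun w => m%:R *: pd j H w) i u oU Uu) => [|w]; last exact: nabla_tension.
  by rewrite (pd_scale _ i (Ck_pd j (sH 2)) Uu) tprojE.
rewrite -[X in _ *: X]/(pd i (pd j X) u *m A u).
rewrite -(proj_weingarten Uu) mulmxA -christoffel_proj// mulmx_suml scaler_sumr -sumrN.
apply: eq_bigr => k _; rewrite nabla_tension// -scalemxAl pdX_weingarten//.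
by rewrite !scalerN opprK !scalerA mulrC.
Qed.

(** The rough Laplacian of the tension field m H is - m times the trace on the left, by
    [hessian_tension]; in the unit sphere the curvature term contributes - m times the tension
    field. *)
Lemma biharmonic_trace u : U u ->
  mtrace g (fun i j => pd i (pd j H) u *m Q u) u = - (m%:R *: H u).
Proof.
move=> Uu; have := X_biharmonic Uu; rewrite /bitension /rough_laplacian opprK.
rewrite (eq_mtrace _ (fun i j => hessian_tension i j Uu)) mtraceZ.
have curvE i j : curvS (X u) (pd i X u) (tension g X u) (pd j X u) =
    (- (pd j X u *m 1%:M *m (pd i X u)^T)) *m tension g X u.
  have HX : dot (H u) (X u) = 0 by rewrite dotE mean_curv_point// mxE.
  have XH : dot (pd j X u) (H u) = 0 by rewrite dotC dot_mean_curv_pdX.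
  have tX : dot (tension g X u) (X u) = 0.
    by rewrite tensionE// dotE -scalemxAl mxE -dotE HX mulr0.
  rewrite (curvS_unit (hr Uu) (pdX_orth hr i Uu) tX (pdX_orth hr j Uu)).
  rewrite tensionE// [X in X *: _](_ : _ = 0).
    by rewrite scale0r sub0r mulNmx mulmx1 dotM mul_scalar_mx.
  by rewrite dotE linearZ/= -scalemxAr mxE -dotE XH mulr0.
have CE : mtrace g (fun i j => curvS (X u) (pd i X u) (tension g X u) (pd j X u)) u =
    - (m%:R *: tension g X u).
  rewrite (eq_mtrace _ curvE) -mtraceM mtraceN.
  rewrite (mtrace_swap (fun i j => pd i X u *m 1%:M *m (pd j X u)^T)) mtrace_form mul1mx.
  by rewrite tr_tangent_proj// mulNmx mul_scalar_mx.
rewrite CE opprK tensionE// -scalerDr => /eqP.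
by rewrite scaler_eq0 (negPf mR)/= addr_eq0 => /eqP.
Qed.

Lemma normal_part_algebra p (x y z : 'rV[R]_p) (a q : 'M[R]_p) :
  x = - y - z *m a -> a *m q = 0 -> x *m q = - (y *m q).
Proof. by move=> -> aq; rewrite mulmxBl -mulmxA aq mulmx0 subr0 mulNmx. Qed.

Lemma normal_part_second_form p (x z : 'rV[R]_p) (pr q : 'M[R]_p) :
  x = z *m (1%:M - pr) -> pr *m q = 0 -> x *m q = z *m q.
Proof. by move=> -> pq; rewrite -mulmxA mulmxBl mul1mx pq subr0. Qed.

(** The relation of [curvature_commutes] is evaluated on the vectors x and xq; the two
    hypotheses on x exchange the index of x with that of the derivative, which prepares each
    term for contraction over the remaining pair of indices. *)
Lemma contraction_algebra n (x xp xq : 'rV[R]_n) (a pp pi_ pa : 'M[R]_n) :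
  pi_ *m pp *m a + a *m pp *m pi_ = pp *m pi_ *m a + a *m pi_ *m pp ->
  a^T = a -> pp^T = pp -> x *m pp = xp *m pa -> x *m a *m pp = xp *m a *m pa ->
  xq *m a *m pp *m (x *m pi_)^T + xp *m (a *m pa *m pi_) *m xq^T =
  xp *m (pa *m pi_ *m a) *m xq^T + xq *m pp *m (x *m a *m pi_)^T.
Proof.
move=> h sa sp e1 e2.
have tr1 (k : 'M[R]_1) : k^T = k by apply/matrixP => i j; rewrite mxE !ord1.
rewrite -[xq *m a *m pp *m _]tr1 -[xq *m pp *m _]tr1 !trmx_mul !trmxK sa sp.
rewrite !mulmxA -e1 -e2.
have := congr1 (fun k => x *m k *m xq^T) h.
by rewrite /= !mulmxDr !mulmxDl !mulmxA => ->; rewrite addrC.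
Qed.

Lemma tangent_part_algebra n (y : 'rV[R]_n) (pr pr' : 'M[R]_n) :
  y *m pr = y -> pr *m pr' *m pr = 0 -> y *m pr' *m pr = 0.
Proof. by move=> yp e; rewrite -{1}yp -!mulmxA (mulmxA pr) e mulmx0. Qed.

(** Cyclicity of the trace: a absorbs the projector pr on either side. *)
Lemma trace_rotation n (a pr pa pi_ : 'M[R]_n) : pr *m a = a -> a *m pr = a ->
  \tr (a *m pa *m pi_ *m pr) = \tr (pa *m pi_ *m a *m pr).
Proof.
move=> pa' ap; rewrite -[in RHS]mulmxA ap [LHS]mxtrace_mulC !mulmxA pa'.
by rewrite -mulmxA mxtrace_mulC.
Qed.

(** The vector is found from its normal part, its tangential part and its component along X.
    The normal part is the trace of the biharmonic equation. *)
Lemma weingarten_trace u : U u ->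
  mtrace g (fun i j => pd j X u *m A u *m pd i P u) u = m%:R *: H u - \tr (A u) *: X u.
Proof.
move=> Uu; set T := mtrace _ _ _.
have TQ : T *m Q u = m%:R *: H u.
  rewrite mtraceM -[RHS]opprK -biharmonic_trace// -mtraceN; apply: eq_mtrace => i j.
  apply: (normal_part_algebra (weingarten_pd_proj j i Uu)); exact: weingarten_normal.
have TP : T *m P u = 0.
  rewrite mtraceM /mtrace big1// => i _; rewrite big1// => j _.
  rewrite (tangent_part_algebra _ (proj_pd_proj i Uu)) ?scaler0//.
  by rewrite -mulmxA weingarten_proj.
have TX : T *m (X u)^T = (- \tr (A u))%:M.
  rewrite mtraceM -{2}(weingarten_proj Uu) raddfN/= -mtrace_form -mtraceN -mtrace_swap.
  by apply: eq_mtrace => i j; rewrite -(mulmxA _ (pd j P u)) (pd_proj_point j Uu) mulmxN.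
by rewrite (vector_decomposition T Uu) TQ TP TX addr0 mul_scalar_mx scaleNr.
Qed.

(** The same H-component as in [weingarten_trace], but m instead of tr(A) along X: this
    discrepancy is what will determine the square of A. *)
Lemma second_form_trace u : U u ->
  mtrace g (fun i j => pd j X u *m pd i P u) u = m%:R *: H u - m%:R *: X u.
Proof.
move=> Uu; set T := mtrace _ _ _.
have PQ : P u *m Q u = 0.
  by apply: trmx_inj; rewrite trmx_mul Qsym// tangent_proj_sym QP// trmx0.
have TQ : T *m Q u = m%:R *: H u.
  rewrite mtraceM -lap_normal /lap mtraceM; apply: eq_mtrace => i j.
  by apply: (normal_part_second_form (pdX_pd_proj j i Uu)).
have TP : T *m P u = 0.
  rewrite mtraceM /mtrace big1// => i _; rewrite big1// => j _.
  rewrite (tangent_part_algebra _ (proj_pd_proj i Uu)) ?scaler0//.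
  exact: pdX_tangent_proj.
have TX : T *m (X u)^T = (- m%:R)%:M.
  rewrite mtraceM -(tr_tangent_proj Uu) -[P u in RHS]mul1mx raddfN/= -mtrace_form.
  rewrite -mtraceN -mtrace_swap.
  by apply: eq_mtrace => i j; rewrite -(mulmxA _ (pd j P u)) (pd_proj_point j Uu) mulmxN mulmx1.
by rewrite (vector_decomposition T Uu) TQ TP TX addr0 mul_scalar_mx scaleNr.
Qed.

(** Contract [curvature_commutes] over one tangent index.  Two of its four terms are traces
    which agree by cyclicity. *)
Lemma contracted_integrability a i u : U u ->
  mtrace g (fun p q => pd q X u *m A u *m pd p P u) u *m (pd a X u *m pd i P u)^T =
  mtrace g (fun p q => pd q X u *m pd p P u) u *m (pd a X u *m A u *m pd i P u)^T.
Proof.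
move=> Uu; rewrite !mtraceM.
(* S1 to S4 are the four terms of the commutation relation, with the free indices a, i. *)
pose S1 p q := pd q X u *m A u *m pd p P u *m (pd a X u *m pd i P u)^T.
pose S2 p q := pd p X u *m (A u *m pd a P u *m pd i P u) *m (pd q X u)^T.
pose S3 p q := pd p X u *m (pd a P u *m pd i P u *m A u) *m (pd q X u)^T.
pose S4 p q := pd q X u *m pd p P u *m (pd a X u *m A u *m pd i P u)^T.
have E p q : S1 p q + S2 p q = S3 p q + S4 p q.
  exact: (contraction_algebra (pd q X u) (curvature_commutes p i Uu) (weingarten_sym Uu)
    (pd_proj_sym p Uu) (pdX_pd_proj_sym a p Uu) (weingarten_pd_proj_sym a p Uu)).
have E23 : mtrace g S2 u = mtrace g S3 u.
  rewrite !mtrace_form.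
  exact: (congr1 (fun t => t%:M) (trace_rotation _ _ (proj_weingarten Uu) (weingarten_proj Uu))).
have := mtraceD S1 S2 u; rewrite (eq_mtrace _ E) mtraceD E23 addrC.
by move/addIr => <-.
Qed.

(** Here h and y stand for H and X, p' for P_i, z for X_i.  The terms with the factor c h
    agree on both sides and cancel. *)
Lemma contraction_solve n (h y x z : 'rV[R]_n) (a p' : 'M[R]_n) (c t : R) :
  (c *: h - t *: y) *m (x *m p')^T = (c *: h - c *: y) *m (x *m a *m p')^T ->
  h *m p' = z *m a -> y *m p' = - z -> a^T = a -> p'^T = p' ->
  t *: (z *m x^T) = c *: (z *m (a *m a) *m x^T).
Proof.
move=> e hp yp sa sp; move: e; rewrite !trmx_mul sa sp !mulmxBl -!scalemxAl !mulmxA hp yp.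
rewrite !mulNmx !scalerN !opprK [RHS]addrC.
by move=> /addrI.
Qed.

Lemma weingarten_sqr_basis u : U u ->
  \tr (A u) *: (D u *m (D u)^T) = m%:R *: (D u *m (A u *m A u) *m (D u)^T).
Proof.
move=> Uu; apply/matrixP => i a.
have h := contracted_integrability a i Uu.
rewrite weingarten_trace// second_form_trace// in h.
have := contraction_solve h (H_pd_proj i Uu) (X_pd_proj i Uu) (weingarten_sym Uu) (pd_proj_sym i Uu).
rewrite pdX_form pdX_gram.
by move/(congr1 (fun k : 'M[R]_1 => k 0 0)); rewrite !mxE !mulr1n.
Qed.

(** An operator supported on the tangent space is determined by its matrix in the coordinate
    basis. *)
Lemma sqr_algebra p q (d : 'M[R]_(p, q)) (ga : 'M[R]_p) (a pr : 'M[R]_q) (t c : R) :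
  c != 0 -> t *: (d *m d^T) = c *: (d *m (a *m a) *m d^T) ->
  pr = d^T *m ga *m d -> pr *m pr = pr -> pr *m a = a -> a *m pr = a ->
  a *m a = (t / c) *: pr.
Proof.
move=> c0 e prE pp pa ap.
have e1 : t *: pr = c *: (a *m a).
  have p2 : pr = (d^T *m ga) *m (d *m d^T) *m (ga *m d) by rewrite -{1}pp prE !mulmxA.
  have a2 : a *m a = (d^T *m ga) *m (d *m (a *m a) *m d^T) *m (ga *m d).
    have h : a *m a = pr *m (a *m a) *m pr by rewrite mulmxA pa -mulmxA ap.
    by rewrite {1}h prE !mulmxA.
  by rewrite p2 scalemxAl scalemxAr e -scalemxAr -scalemxAl -a2.
by rewrite mulrC -scalerA e1 scalerA mulVf// scale1r.
Qed.

(** The trace of A_H is the inner product of H with the trace m H of the second fundamental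
    form. *)
Lemma tr_weingarten u : U u -> \tr (A u) = m%:R * dot (H u) (H u).
Proof.
move=> Uu; have : lap u *m (H u)^T = (\tr (A u))%:M.
  rewrite -(weingarten_proj Uu) -mtrace_form /lap mtraceM.
  apply: eq_mtrace => i j; rewrite pdX_weingarten// mulNmx !dotM.
  by rewrite (jacH_basis i j Uu) raddfN/= opprK dotC.
rewrite -{1}(mean_curv_normal Uu) trmx_mul Qsym// mulmxA lap_normal -scalemxAl dotM.
by move/(congr1 (fun k : 'M[R]_1 => k 0 0)); rewrite !mxE !mulr1n.
Qed.

(** The factor tr(A) / m is |H|^2.  A being symmetric, its eigenvalues on the tangent space are
    therefore among |H| and - |H|. *)
Lemma weingarten_sqr u : U u -> A u *m A u = dot (H u) (H u) *: P u.
Proof.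
move=> Uu; have := sqr_algebra mR (weingarten_sqr_basis Uu) erefl (tangent_proj_idem Uu)
  (proj_weingarten Uu) (weingarten_proj Uu).
by rewrite tr_weingarten// [m%:R * _]mulrC mulfK.
Qed.

Lemma pdH_normal_part i u : U u -> dot (pd i H u) (H u) = 0.
Proof.
move=> Uu; rewrite dotE -(pdH_tangent i Uu) -mulmxA.
have -> : P u *m (H u)^T = 0.
  by apply: trmx_inj; rewrite trmx_mul trmxK tangent_proj_sym H_proj// trmx0.
by rewrite mulmx0 mxE.
Qed.

End ParallelMeanCurvature.

End ChartGeometry.

(** * Invariance of the mean curvature under change of chart *)

Section ChangeOfChart.

Lemma pd_reparam m p N (U : set 'rV[R]_p) (V : set 'rV[R]_m) (X : 'rV[R]_p -> 'rV[R]_N)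
    (Z : 'rV[R]_m -> 'rV[R]_N) (th : 'rV[R]_m -> 'rV[R]_p) j w :
  open U -> open V -> smooth_on U X -> smooth_on V th -> (forall v, V v -> U (th v)) ->
  (forall v, V v -> Z v = X (th v)) -> V w ->
  pd j Z w = \sum_a pd j th w 0 a *: pd a X (th w).
Proof.
move=> oU oV sX sth VU ZX Vw.
rewrite (@pd_ext _ _ V _ (fun v => X (th v)) j w oV Vw ZX).
exact: pd_is_derive (pd_comp oU (sX 1) (VU w Vw) (Ck_is_derive j (sth 1) Vw)).
Qed.

Lemma jacobian_reparam m p N (U : set 'rV[R]_p) (V : set 'rV[R]_m) (X : 'rV[R]_p -> 'rV[R]_N)
    (Z : 'rV[R]_m -> 'rV[R]_N) (th : 'rV[R]_m -> 'rV[R]_p) w :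
  open U -> open V -> smooth_on U X -> smooth_on V th -> (forall v, V v -> U (th v)) ->
  (forall v, V v -> Z v = X (th v)) -> V w ->
  jacobian_mx Z w = jacobian_mx th w *m jacobian_mx X (th w).
Proof.
move=> oU oV sX sth VU ZX Vw; apply/row_matrixP => j.
rewrite row_jacobian (pd_reparam j oU oV sX sth VU ZX Vw) row_mul mulmx_sum_row.
by apply: eq_bigr => a _; rewrite !row_jacobian.
Qed.

(** The coefficients c are second derivatives of the coordinate change.  They multiply tangent
    vectors, so the normal projection will remove them. *)
Lemma pd_pd_reparam m p N (U : set 'rV[R]_p) (V : set 'rV[R]_m) (X : 'rV[R]_p -> 'rV[R]_N)
    (Z : 'rV[R]_m -> 'rV[R]_N) (th : 'rV[R]_m -> 'rV[R]_p) i j w :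
  open U -> open V -> smooth_on U X -> smooth_on V th -> (forall v, V v -> U (th v)) ->
  (forall v, V v -> Z v = X (th v)) -> V w ->
  exists c : 'I_p -> R, pd i (pd j Z) w = \sum_a (c a *: pd a X (th w) +
     pd j th w 0 a *: \sum_b pd i th w 0 b *: pd b (pd a X) (th w)).
Proof.
move=> oU oV sX sth VU ZX Vw.
exists (fun a => pd i (fun v => pd j th v 0 a) w).
rewrite (@pd_ext _ _ V _ (fun v => \sum_a pd j th v 0 a *: pd a X (th v)) i w oV Vw); last first.
  by move=> v Vv; exact: (pd_reparam j oU oV sX sth VU ZX Vv).
apply: pd_is_derive; apply: is_derive_fsum => a.
apply: is_derive_scale.
  by have /(Ck_mxP _ _ oV)/(_ 0 a) h := Ck_pd j (sth 2); exact: Ck_is_derive h Vw.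
exact: (pd_comp oU (Ck_pd a (sX 2)) (VU w Vw) (Ck_is_derive i (sth 1) Vw)).
Qed.

Lemma gram_change p q (j : 'M[R]_p) (d : 'M[R]_(p, q)) :
  j \in unitmx -> d *m d^T \in unitmx ->
  invmx (j *m d *m (j *m d)^T) = (invmx j)^T *m invmx (d *m d^T) *m invmx j.
Proof.
move=> uj ud; have ujt : j^T \in unitmx by rewrite unitmx_tr.
have -> : j *m d *m (j *m d)^T = j *m (d *m d^T) *m j^T by rewrite trmx_mul !mulmxA.
move: (d *m d^T) ud => K uK.
have uJ : j *m K *m j^T \in unitmx by rewrite !unitmx_mul uj uK.
apply: (can_inj (mulKmx uJ)); rewrite mulmxV// trmx_inv !mulmxA.
by rewrite (mulmxK ujt) (mulmxK uK) mulmxV.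
Qed.

Lemma mtrace_change m N (g g' : 'rV[R]_m -> 'M[R]_m) u u' (J : 'M[R]_m)
    (T T' : 'I_m -> 'I_m -> 'rV[R]_N) :
  J^T *m ginv g' u' *m J = ginv g u ->
  (forall i j, T' i j = \sum_a J j a *: \sum_b J i b *: T b a) ->
  mtrace g' T' u' = mtrace g T u.
Proof.
move=> JG TT'; rewrite /mtrace -JG.
transitivity (\sum_i \sum_j \sum_a \sum_b (J i b * ginv g' u' i j * J j a) *: T b a).
  apply: eq_bigr => i _; apply: eq_bigr => j _; rewrite TT' scaler_sumr.
  apply: eq_bigr => a _; rewrite !scaler_sumr; apply: eq_bigr => b _.
  by rewrite !scalerA; congr (_ *: _); rewrite mulrC mulrA mulrC mulrA.
transitivity (\sum_b \sum_a \sum_j \sum_i (J i b * ginv g' u' i j * J j a) *: T b a).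
  under eq_bigr do rewrite exchange_big; rewrite exchange_big.
  rewrite [RHS]exchange_big; apply: eq_bigr => a _.
  under eq_bigr do rewrite exchange_big; rewrite exchange_big.
  by apply: eq_bigr => b _; rewrite exchange_big.
apply: eq_bigr => b _; apply: eq_bigr => a _.
rewrite mxE scaler_suml; apply: eq_bigr => j _; rewrite mxE mulr_suml scaler_suml.
by apply: eq_bigr => i _; rewrite mxE.
Qed.

(** Both charts have the same tangent and normal projectors.  Second derivatives transform by
    the jacobian of th up to tangent terms, which the normal projection removes, and the
    inverse metric transforms by the inverse jacobian. *)
Lemma mean_curv_reparam m N (U V : set 'rV[R]_m) (X Z : 'rV[R]_m -> 'rV[R]_N)
    (th : 'rV[R]_m -> 'rV[R]_m) (r : R) :
  open U -> open V -> smooth_on U X -> smooth_on V th -> (forall v, V v -> U (th v)) ->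
  (forall v, V v -> Z v = X (th v)) ->
  (forall u, U u -> immersive X u) -> (forall v, V v -> immersive Z v) ->
  (forall u, U u -> dot (X u) (X u) = r) ->
  forall w, V w -> mean_curv Z w = mean_curv X (th w).
Proof.
move=> oU oV sX sth VU ZX iX iZ hr w Vw.
set u := th w; have Uu : U u := VU w Vw.
set J := jacobian_mx th w.
have DZ : tangent_basis Z w = J *m tangent_basis X u.
  exact: (jacobian_reparam oU oV sX sth VU ZX Vw).
have uJ : J \in unitmx.
  rewrite -row_free_unit -row_leq_rank; have := iZ w Vw.
  rewrite /immersive -/(jacobian_mx Z w) -/(tangent_basis Z w) DZ -row_leq_rank.
  by move/leq_trans; apply; exact: mxrankM_maxl.
have gX := row_free_gram (iX u Uu).
have GZ : ginv (induced_metric Z) w = (invmx J)^T *m ginv (induced_metric X) u *m invmx J.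
  by rewrite /ginv !induced_metricE DZ gram_change.
have JG : J^T *m ginv (induced_metric Z) w *m J = ginv (induced_metric X) u.
  by rewrite GZ !mulmxA -trmx_mul mulVmx// trmx1 mul1mx mulmxKV.
have PZ : tangent_proj Z w = tangent_proj X u.
  rewrite /tangent_proj DZ -JG; move: (tangent_basis X u) (ginv _ w) => d ga.
  by rewrite trmx_mul !mulmxA.
have QZ : normal_proj Z w = normal_proj X u by rewrite /normal_proj PZ (ZX w Vw).
apply: (etrans (mean_curvE Z w)); apply: (etrans _ (esym (mean_curvE X u))); rewrite QZ.
apply: (congr1 (fun v => m%:R^-1 *: v)).
apply: (etrans (mtraceM _ _ _ _)); apply: (etrans _ (esym (mtraceM _ _ _ _))).
apply: (mtrace_change JG) => i j.
have [c ->] := pd_pd_reparam i j oU oV sX sth VU ZX Vw.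
rewrite mulmx_suml; apply: eq_bigr => a _.
rewrite mulmxDl -!scalemxAl (pdX_normal oU sX iX hr a Uu) scaler0 add0r mxE.
congr (_ *: _); rewrite mulmx_suml; apply: eq_bigr => b _.
by rewrite -scalemxAl mxE.
Qed.

End ChangeOfChart.

(** * Orthonormal bases and spans *)

Section OrthonormalBases.

Lemma col_mx_orthonormal a b N (Q1 : 'M[R]_(a, N)) (Q2 : 'M[R]_(b, N)) :
  Q1 *m Q1^T = 1%:M -> Q2 *m Q2^T = 1%:M -> Q1 *m Q2^T = 0 ->
  col_mx Q1 Q2 *m (col_mx Q1 Q2)^T = 1%:M.
Proof.
move=> h1 h2 h12; have h21 : Q2 *m Q1^T = 0 by apply: trmx_inj; rewrite trmx_mul trmxK h12 trmx0.
by rewrite tr_col_mx mul_col_row h1 h2 h12 h21 -scalar_mx_block.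
Qed.

(** Gram-Schmidt: split off one unit vector of the row space and project the rows of A onto
    its orthogonal complement, which lowers the rank by one. *)
Lemma orthonormal_basis N k p (A : 'M[R]_(p, N)) : \rank A = k ->
  exists B : 'M[R]_(k, N), B *m B^T = 1%:M /\ (B == A)%MS.
Proof.
elim: k p A => [|k IH] p A rA.
  exists 0; split; first by apply/matrixP => -[].
  by move/eqP: rA; rewrite mxrank_eq0 => /eqP ->; rewrite !sub0mx.
have /rowV0Pn[v vA v0] : A != 0 by rewrite -mxrank_eq0 rA.
have nv : dot v v != 0 by apply: contra_neq v0; exact: dot_eq0.
have ev : enorm v != 0 by apply: contra_neq nv => h; rewrite -enorm_sqr h expr0n.
pose q := (enorm v)^-1 *: v.
have qq : q *m q^T = 1%:M.
  rewrite /q linearZ/= -scalemxAl -scalemxAr scalerA dotM -enorm_sqr scale_scalar_mx.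
  by rewrite -expr2 exprVn mulVf// expf_neq0.
have qA : (q <= A)%MS by rewrite scalemx_sub.
pose A' := A - A *m q^T *m q.
have A'q : A' *m q^T = 0 by rewrite mulmxBl -[_ *m q *m _]mulmxA qq mulmx1 subrr.
have A'A : (A' <= A)%MS.
  by rewrite addmx_sub// eqmx_opp (submx_trans _ qA)// submxMl.
have Asum : (A :=: q + A')%MS.
  apply/eqmxP; apply/andP; split; last by rewrite addsmx_sub qA.
  rewrite -[A in (A <= _)%MS](subrK (A *m q^T *m q)) addrC.
  by rewrite addmx_sub_adds// submxMl.
have cap : (q :&: A')%MS = 0.
  apply/eqP; rewrite -submx0; apply/rV_subP => w; rewrite sub_capmx => /andP[/submxP[a wa] /submxP[b wb]].
  have : w *m q^T = 0 by rewrite wb -mulmxA A'q mulmx0.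
  by rewrite wa -mulmxA qq mulmx1 => ->; rewrite mul0mx sub0mx.
have rA' : \rank A' = k.
  have q0 : q != 0 by rewrite scaler_eq0 negb_or invr_eq0 ev.
  have := mxrank_disjoint_sum cap; rewrite -Asum rA rank_rV q0.
  by move=> [].
have [B [BB BA']] := IH _ A' rA'.
exists (col_mx q B : 'M[R]_(1 + k, N)); split.
  have [B'A' _] := andP BA'.
  have Bq : B *m q^T = 0.
    by have /submxP[C ->] := B'A'; rewrite -mulmxA A'q mulmx0.
  have qB : q *m B^T = 0 by apply: trmx_inj; rewrite trmx_mul trmxK Bq trmx0.
  exact: (col_mx_orthonormal qq BB qB).
apply/eqmxP/(eqmx_trans _ (eqmx_sym Asum)).
apply/(eqmx_trans (eqmx_sym (addsmxE q B)))/adds_eqmx => //.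
exact/eqmxP.
Qed.

(** As long as some vector of S is not spanned by the rows chosen so far, adding it raises the
    rank, which is at most N. *)
Lemma spanning_rows N (S : set 'rV[R]_N) : exists p (A : 'M[R]_(p, N)),
  (forall v, S v -> (v <= A)%MS) /\ forall i, S (row i A).
Proof.
suff H d : forall p (A : 'M[R]_(p, N)), (N - \rank A <= d)%N -> (forall i, S (row i A)) ->
  exists p (A : 'M[R]_(p, N)), (forall v, S v -> (v <= A)%MS) /\ forall i, S (row i A).
  by apply: (H _ 0%N 0 (leqnn _)) => -[].
elim: d => [|d IH] p A hd hS.
  exists p, A; split=> // v _; apply: submx_full.
  by rewrite -col_leq_rank -subn_eq0 -leqn0.
have [h|/existsNP[v /not_implyP[Sv vA]]] := pselect (forall v, S v -> (v <= A)%MS).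
  by exists p, A.
apply: (IH _ (col_mx A v)); last first.
  move=> i; case: (split_ordP i) => j ->; rewrite ?rowKu ?rowKd//.
  by rewrite (_ : row j v = v)//; apply/rowP => a; rewrite mxE ord1.
have lt : (\rank A < \rank (col_mx A v))%N.
  apply: rank_ltmx; rewrite ltmxE; apply/andP; split.
    by rewrite -addsmxE addsmxSl.
  by rewrite -addsmxE addsmx_sub submx_refl/=; exact/negP.
have := rank_leq_col (col_mx A v); lia.
Qed.

End OrthonormalBases.

(** * The product chart *)

(** Two maps f and h on a chart X of an immersed manifold have as differentials the
    complementary projections S and T of the tangent spaces.  The matrices E1 and E2 are
    coordinates on the images of S and T at u0. *)
Section ProductChart.

Lemma is_derive_row_mxr m1 m2 (W : normedModType R) (F : 'rV[R]_(m1 + m2) -> W)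
    (s : 'rV[R]_m1) (t : 'rV[R]_m2) j dF :
  is_derive (row_mx s t) (delta_mx 0 (rshift m1 j)) F dF ->
  is_derive t (delta_mx 0 j) (fun t => F (row_mx s t)) dF.
Proof.
move=> /is_derive_lineP h; apply/is_derive_lineP.
rewrite (_ : (fun x : R => _) = (fun x : R => F (row_mx s t + x *: delta_mx 0 (rshift m1 j))))//.
by apply/funext => x; rewrite delta_mx_rshift scale_row_mx add_row_mx scaler0 addr0.
Qed.

Lemma is_derive_row_mxl m1 m2 (W : normedModType R) (F : 'rV[R]_(m1 + m2) -> W)
    (s : 'rV[R]_m1) (t : 'rV[R]_m2) i dF :
  is_derive (row_mx s t) (delta_mx 0 (lshift m2 i)) F dF ->
  is_derive s (delta_mx 0 i) (fun s => F (row_mx s t)) dF.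
Proof.
move=> /is_derive_lineP h; apply/is_derive_lineP.
rewrite (_ : (fun x : R => _) = (fun x : R => F (row_mx s t + x *: delta_mx 0 (lshift m2 i))))//.
by apply/funext => x; rewrite delta_mx_lshift scale_row_mx add_row_mx scaler0 addr0.
Qed.

Lemma ball_row_mx m1 m2 (s0 s : 'rV[R]_m1) (t0 t : 'rV[R]_m2) (r : R) : 0 < r ->
  ball (row_mx s0 t0) r (row_mx s t) <-> ball s0 r s /\ ball t0 r t.
Proof.
move=> r0; rewrite !rV_ball//; split=> [h|[h1 h2] k].
  by split=> k; [have := h (lshift m2 k); rewrite !row_mxEl|have := h (rshift m1 k); rewrite !row_mxEr].
by case: (split_ordP k) => l ->; rewrite ?row_mxEl ?row_mxEr.
Qed.

Lemma smooth_row_mxl m1 m2 (t0 : 'rV[R]_m2) (V : set 'rV[R]_m1) : open V ->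
  smooth_on V (fun s : 'rV[R]_m1 => row_mx s t0).
Proof.
move=> oV k; apply/(Ck_mxP _ _ oV) => i j.
case: (split_ordP j) => l ->.
  apply: (Ck_ext oV (f := fun s => s 0 l)); last exact: Ck_coord.
  by move=> s _; rewrite ord1 row_mxEl.
apply: (Ck_ext oV (f := fun s => t0 0 l)); last exact: Ck_cst.
by move=> s _; rewrite ord1 row_mxEr.
Qed.

Lemma smooth_row_mxr m1 m2 (s0 : 'rV[R]_m1) (V : set 'rV[R]_m2) : open V ->
  smooth_on V (fun t : 'rV[R]_m2 => row_mx s0 t).
Proof.
move=> oV k; apply/(Ck_mxP _ _ oV) => i j.
case: (split_ordP j) => l ->.
  apply: (Ck_ext oV (f := fun s => s0 0 l)); last exact: Ck_cst.
  by move=> s _; rewrite ord1 row_mxEl.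
apply: (Ck_ext oV (f := fun s => s 0 l)); last exact: Ck_coord.
by move=> s _; rewrite ord1 row_mxEr.
Qed.

Lemma Ck_row_mx m p q k (V : set 'rV[R]_m) (F : 'rV[R]_m -> 'rV[R]_p) (K : 'rV[R]_m -> 'rV[R]_q) :
  open V -> Ck k V F -> Ck k V K -> Ck k V (fun u => row_mx (F u) (K u)).
Proof.
move=> oV /(Ck_mxP _ _ oV) hF /(Ck_mxP _ _ oV) hK; apply/(Ck_mxP _ _ oV) => i j.
case: (split_ordP j) => l ->.
  by apply: (Ck_ext oV _ (hF i l)) => u _; rewrite row_mxEl.
by apply: (Ck_ext oV _ (hK i l)) => u _; rewrite row_mxEr.
Qed.

Lemma pd_row_mx m p q (V : set 'rV[R]_m) (F : 'rV[R]_m -> 'rV[R]_p) (K : 'rV[R]_m -> 'rV[R]_q) u i :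
  open V -> Ck 1 V F -> Ck 1 V K -> V u ->
  pd i (fun u => row_mx (F u) (K u)) u = row_mx (pd i F u) (pd i K u).
Proof.
move=> oV hF hK Vu; apply: pd_is_derive; apply: is_derive_mxP => a j; rewrite ord1.
have dF := is_derive_entry (Ck_is_derive i hF Vu) 0.
have dK := is_derive_entry (Ck_is_derive i hK Vu) 0.
case: (split_ordP j) => l ->.
  rewrite row_mxEl (_ : (fun w => _) = (fun w => F w 0 l)); first exact: dF.
  by apply/funext => w; rewrite row_mxEl.
rewrite row_mxEr (_ : (fun w => _) = (fun w => K w 0 l)); first exact: dK.
by apply/funext => w; rewrite row_mxEr.
Qed.

Lemma smooth_mulr m p q (U : set 'rV[R]_m) (F : 'rV[R]_m -> 'rV[R]_p) (A : 'M[R]_(p, q)) :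
  open U -> smooth_on U F -> smooth_on U (fun u => F u *m A).
Proof. by move=> oU sF k; apply: (Ck_mulmx oU (sF k)); exact: Ck_cst. Qed.

Lemma pd_mulr m p q (U : set 'rV[R]_m) (F : 'rV[R]_m -> 'rV[R]_p) (A : 'M[R]_(p, q)) u i :
  open U -> smooth_on U F -> U u -> pd i (fun u => F u *m A) u = pd i F u *m A.
Proof.
move=> oU sF Uu; rewrite (pd_mulmx i (sF 1) (Ck_cst 1 A oU) Uu).
by rewrite (pd_is_derive (is_derive_cst A u _)) mulmx0 addr0.
Qed.

Variables (m1 m2 N : nat) (U : set 'rV[R]_(m1 + m2)) (X f h : 'rV[R]_(m1 + m2) -> 'rV[R]_N).
Variables (S T : 'rV[R]_(m1 + m2) -> 'M[R]_N) (E1 : 'M[R]_(m1, N)) (E2 : 'M[R]_(m2, N)).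
Variable u0 : 'rV[R]_(m1 + m2).
Hypotheses (oU : open U) (immX : forall u, U u -> immersive X u).
Hypotheses (sf : smooth_on U f) (sh : smooth_on U h) (Uu0 : U u0).
Hypothesis df : forall u i, U u -> pd i f u = pd i X u *m S u.
Hypothesis dh : forall u i, U u -> pd i h u = pd i X u *m T u.
Hypothesis ST : forall u, U u -> S u + T u = tangent_proj X u.
Hypothesis SS : forall u, U u -> S u *m S u = S u.
Hypothesis TT : forall u, U u -> T u *m T u = T u.
Hypothesis S_T : forall u, U u -> S u *m T u = 0.
Hypothesis T_S : forall u, U u -> T u *m S u = 0.
Hypothesis E1_inj : forall v : 'rV[R]_N, v *m S u0 *m E1^T = 0 -> v *m S u0 = 0.
Hypothesis E2_inj : forall v : 'rV[R]_N, v *m T u0 *m E2^T = 0 -> v *m T u0 = 0.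

Let Phi u : 'rV[R]_(m1 + m2) := row_mx (f u *m E1^T) (h u *m E2^T).

Lemma smooth_split_coordinates : smooth_on U Phi.
Proof. by move=> k; apply: (Ck_row_mx oU); apply: smooth_mulr. Qed.

Lemma jacobian_split u : U u -> jacobian_mx Phi u =
  row_mx (jacobian_mx X u *m S u *m E1^T) (jacobian_mx X u *m T u *m E2^T).
Proof.
move=> Uu; apply/row_matrixP => i; rewrite row_jacobian.
rewrite (pd_row_mx i oU (smooth_mulr E1^T oU sf 1) (smooth_mulr E2^T oU sh 1) Uu).
rewrite !(pd_mulr _ _ oU)// df// dh//; apply/rowP => k; rewrite [RHS]mxE.
by case: (split_ordP k) => l ->; rewrite ?row_mxEl ?row_mxEr -row_jacobian -!row_mul mxE.
Qed.

Lemma jacobian_split_unit : jacobian_mx Phi u0 \in unitmx.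
Proof.
rewrite -row_free_unit -kermx_eq0; apply/eqP/row_matrixP => i; rewrite row0.
set v := row i _.
have : v *m jacobian_mx Phi u0 = 0 by rewrite /v -row_mul mulmx_ker row0.
rewrite jacobian_split// mul_mx_row !mulmxA => e.
have /eq_row_mx[h1 h2] := etrans e (esym (row_mx0 _ _ _ _)).
have {}h1 := E1_inj h1; have {}h2 := E2_inj h2.
have : v *m jacobian_mx X u0 = 0.
  have DP : jacobian_mx X u0 *m tangent_proj X u0 = jacobian_mx X u0.
    exact: basis_tangent_proj immX _ Uu0.
  rewrite -DP mulmxA -ST// mulmxDr.
  by rewrite [X in X + _]h1 [X in _ + X]h2 addr0.
by move/eqP; rewrite mulmx_free_eq0 ?immX// => /eqP.
Qed.

(** The vector v is tangent, and moving in its direction changes neither the first block of Phi,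
    as v E1^T = 0, nor the second, as v T = v S T = 0; but the jacobian of Phi is invertible. *)
Lemma split_kernel_left u (v : 'rV[R]_N) : U u -> jacobian_mx Phi u \in unitmx ->
  v *m tangent_proj X u = v -> v *m S u = v -> v *m E1^T = 0 -> v = 0.
Proof.
move=> Uu uJ vP vS vE; pose w := v *m (jacobian_mx X u)^T *m ginv (induced_metric X) u.
have wD : w *m jacobian_mx X u = v by rewrite -[RHS]vP /tangent_proj !mulmxA.
have : w *m jacobian_mx Phi u = 0.
  rewrite jacobian_split// mul_mx_row !mulmxA wD vS vE -vS -!mulmxA (mulmxA (S u)) S_T//.
  by rewrite mul0mx mulmx0 row_mx0.
move=> /(congr1 (fun x => x *m invmx (jacobian_mx Phi u))); rewrite mulmxK// mul0mx => w0.
by rewrite -wD w0 mul0mx.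
Qed.

Lemma split_kernel_right u (v : 'rV[R]_N) : U u -> jacobian_mx Phi u \in unitmx ->
  v *m tangent_proj X u = v -> v *m T u = v -> v *m E2^T = 0 -> v = 0.
Proof.
move=> Uu uJ vP vT vE; pose w := v *m (jacobian_mx X u)^T *m ginv (induced_metric X) u.
have wD : w *m jacobian_mx X u = v by rewrite -[RHS]vP /tangent_proj !mulmxA.
have : w *m jacobian_mx Phi u = 0.
  rewrite jacobian_split// mul_mx_row !mulmxA wD vT vE -vT -!mulmxA (mulmxA (T u)) T_S//.
  by rewrite mul0mx mulmx0 row_mx0.
move=> /(congr1 (fun x => x *m invmx (jacobian_mx Phi u))); rewrite mulmxK// mul0mx => w0.
by rewrite -wD w0 mul0mx.
Qed.

Lemma jacobian_section (V : set 'rV[R]_(m1 + m2)) (Psi : 'rV[R]_(m1 + m2) -> 'rV[R]_(m1 + m2)) y :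
  open V -> smooth_on V Psi -> (forall y, V y -> U (Psi y)) ->
  (forall y, V y -> Phi (Psi y) = y) -> V y -> jacobian_mx Psi y \in unitmx.
Proof.
move=> oV sPsi VU PhiPsi Vy.
have e := jacobian_reparam oU oV smooth_split_coordinates sPsi VU (fun v Vv => esym (PhiPsi v Vv)) Vy.
have j1 : jacobian_mx (fun v : 'rV[R]_(m1 + m2) => v) y = 1%:M.
  apply/row_matrixP => i; rewrite row_jacobian row1.
  exact: pd_is_derive (is_derive_id y _).
rewrite j1 in e.
exact: (mulmx1_unit (esym e)).1.
Qed.

Let s0 := f u0 *m E1^T.
Let t0 := h u0 *m E2^T.

(** Phi is a local diffeomorphism at u0; Psi is its inverse.  When only the second block t of
    the coordinates varies, the derivative of f o Psi lies in the image of S, and its E1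
    coordinates vanish because f o Psi has E1 coordinates s.  By [split_kernel_left] it is zero,
    so f o Psi depends on s alone; likewise h o Psi depends on t alone. *)
Lemma product_chart : exists (r : R) (Psi : 'rV[R]_(m1 + m2) -> 'rV[R]_(m1 + m2))
    (Y1 : 'rV[R]_m1 -> 'rV[R]_N) (Y2 : 'rV[R]_m2 -> 'rV[R]_N),
  [/\ [/\ 0 < r, Psi (row_mx s0 t0) = u0,
       smooth_on (ball (row_mx s0 t0) r) Psi,
       forall y, ball (row_mx s0 t0) r y -> U (Psi y) /\ jacobian_mx Psi y \in unitmx &
       open (Psi @` ball (row_mx s0 t0) r)],
     forall s t, ball s0 r s -> ball t0 r t ->
       f (Psi (row_mx s t)) = Y1 s /\ h (Psi (row_mx s t)) = Y2 t,
     smooth_on (ball s0 r) Y1 /\ (forall s, ball s0 r s -> Y1 s *m E1^T = s) &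
     smooth_on (ball t0 r) Y2 /\ (forall t, ball t0 r t -> Y2 t *m E2^T = t)].
Proof.
have [B [r [Psi [[oB Bu0 injB r0] BU hPsi sPsi]]]] :=
  inverse_function oU smooth_split_coordinates Uu0 jacobian_split_unit.
have P0 : Phi u0 = row_mx s0 t0 by [].
rewrite P0 in hPsi sPsi; set y0 := row_mx s0 t0 in hPsi sPsi *.
have oV : open (ball y0 r) by exact: ball_open.
have VU y : ball y0 r y -> U (Psi y) by move=> /hPsi[/BU[]].
have PhiPsi y : ball y0 r y -> Phi (Psi y) = y by move=> /hPsi[].
have PsiPhi u : B u -> ball y0 r (Phi u) -> Psi (Phi u) = u.
  by move=> Bu bu; apply: injB; rewrite ?inE; have [] := hPsi _ bu.
have by0 : ball y0 r y0 by exact: ballxx.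
have bst s t : ball s0 r s -> ball t0 r t -> ball y0 r (row_mx s t).
  by move=> bs bt; apply/ball_row_mx.
have bs0 : ball s0 r s0 by exact: ballxx.
have bt0 : ball t0 r t0 by exact: ballxx.
have fE y : ball y0 r y -> f (Psi y) *m E1^T = lsubmx y.
  by move=> /PhiPsi/(congr1 lsubmx); rewrite row_mxKl.
have hE y : ball y0 r y -> h (Psi y) *m E2^T = rsubmx y.
  by move=> /PhiPsi/(congr1 rsubmx); rewrite row_mxKr.
have part (F : 'rV[R]_(m1 + m2) -> 'rV[R]_N) (A : 'rV[R]_(m1 + m2) -> 'M[R]_N) k y :
    smooth_on U F -> (forall u i, U u -> pd i F u = pd i X u *m A u) -> ball y0 r y ->
    is_derive y (delta_mx 0 k) (fun y => F (Psi y)) (pd k Psi y *m jacobian_mx X (Psi y) *m A (Psi y)).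
  move=> sF dF by_; apply: (is_derive_eq (pd_comp oU (sF 1) (VU y by_) (Ck_is_derive k (sPsi 1) by_))).
  rewrite -mulmxA [RHS]mulmx_sum_row; apply: eq_bigr => a _.
  by rewrite row_mul row_jacobian dF//; exact: VU.
have proj_jac u w : U u -> w *m jacobian_mx X u *m tangent_proj X u = w *m jacobian_mx X u.
  by move=> Uu; rewrite -mulmxA; congr (_ *m _); exact: (basis_tangent_proj immX Uu).
have f_indep y j : ball y0 r y ->
    is_derive y (delta_mx 0 (rshift m1 j)) (fun y => f (Psi y)) 0.
  move=> by_; have D := part f S (rshift m1 j) y sf df by_.
  have [Uy uJ] := BU _ (hPsi y by_).1.
  apply: (is_derive_eq D); apply: (split_kernel_left Uy uJ).
  - by rewrite -ST// mulmxDr -!mulmxA SS// S_T// !mulmx0 addr0.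
  - by rewrite -!mulmxA SS.
  have D1 := is_derive_mulmx D (is_derive_cst E1^T y (delta_mx 0 (rshift m1 j))).
  rewrite mulmx0 addr0 in D1; rewrite -(pd_is_derive D1).
  rewrite (@pd_ext _ _ (ball y0 r) _ (fun y => lsubmx y) _ y oV by_) => [|w bw]; last exact: fE.
  have Dl : is_derive y (delta_mx 0 (rshift m1 j)) (fun y : 'rV[R]_(m1 + m2) => lsubmx y)
      (lsubmx (delta_mx 0 (rshift m1 j) : 'rV[R]_(m1 + m2))).
    apply: is_derive_mxP => a b; rewrite ord1 mxE.
    rewrite (_ : (fun w => _) = (fun w : 'rV[R]_(m1 + m2) => w 0 (lshift m2 b))).
      exact: (is_derive_entry (is_derive_id y (delta_mx 0 (rshift m1 j) : 'rV[R]_(m1+m2))) 0).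
    by apply/funext => w; rewrite mxE.
  by rewrite (pd_is_derive Dl) delta_mx_rshift row_mxKl.
have h_indep y i : ball y0 r y ->
    is_derive y (delta_mx 0 (lshift m2 i)) (fun y => h (Psi y)) 0.
  move=> by_; have D := part h T (lshift m2 i) y sh dh by_.
  have [Uy uJ] := BU _ (hPsi y by_).1.
  apply: (is_derive_eq D); apply: (split_kernel_right Uy uJ).
  - by rewrite -ST// mulmxDr -!mulmxA TT// T_S// !mulmx0 add0r.
  - by rewrite -!mulmxA TT.
  have D1 := is_derive_mulmx D (is_derive_cst E2^T y (delta_mx 0 (lshift m2 i))).
  rewrite mulmx0 addr0 in D1; rewrite -(pd_is_derive D1).
  rewrite (@pd_ext _ _ (ball y0 r) _ (fun y => rsubmx y) _ y oV by_) => [|w bw]; last exact: hE.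
  have Dl : is_derive y (delta_mx 0 (lshift m2 i)) (fun y : 'rV[R]_(m1 + m2) => rsubmx y)
      (rsubmx (delta_mx 0 (lshift m2 i) : 'rV[R]_(m1 + m2))).
    apply: is_derive_mxP => a b; rewrite ord1 mxE.
    rewrite (_ : (fun w => _) = (fun w : 'rV[R]_(m1 + m2) => w 0 (rshift m1 b))).
      exact: (is_derive_entry (is_derive_id y (delta_mx 0 (lshift m2 i) : 'rV[R]_(m1+m2))) 0).
    by apply/funext => w; rewrite mxE.
  by rewrite (pd_is_derive Dl) delta_mx_lshift row_mxKr.
have os : open (ball s0 r) by exact: ball_open.
have ot : open (ball t0 r) by exact: ball_open.
exists r, Psi, (fun s => f (Psi (row_mx s t0))), (fun t => h (Psi (row_mx s0 t))); split.
- split=> //.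
  + by rewrite /y0 -P0; apply: PsiPhi => //; rewrite P0.
  + move=> y by_; split; first exact: VU.
    exact: (jacobian_section oV sPsi VU PhiPsi by_).
  + have -> : Psi @` ball y0 r = B `&` [set u | ball y0 r (Phi u)].
      apply/seteqP; split=> [_ [y by_ <-]|u [Bu bu]].
        by have [BP PE] := hPsi _ by_; split=> //=; rewrite PE.
      by exists (Phi u) => //; exact: PsiPhi.
    rewrite openE => u [Bu bu]; rewrite /interior; apply: filterI.
      exact: open_nbhs_nbhs.
    have [Uu _] := BU u Bu.
    have cPhi := Ck_cont (smooth_split_coordinates 0) Uu.
    by apply: cPhi; exact: open_nbhs_nbhs.
- move=> s t bs bt; split.
    apply: (@zero_partials_const m2 1 N (fun t => f (Psi (row_mx s t))) t0 r) => // w j bw.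
    by apply: is_derive_row_mxr (fun y => f (Psi y)) _ _ _ _ _; exact: f_indep (bst _ _ bs bw).
  apply: (@zero_partials_const m1 1 N (fun s => h (Psi (row_mx s t))) s0 r) => // w j bw.
  by apply: is_derive_row_mxl (fun y => h (Psi y)) _ _ _ _ _; exact: h_indep (bst _ _ bw bt).
- split=> [k|s bs]; last by rewrite fE ?row_mxKl//; exact: bst.
  apply: (Ck_comp oU os _ _ (sf k)) => [s bs|]; first exact: VU (bst _ _ bs bt0).
  apply: (Ck_comp oV os _ _ (sPsi k)) => [s bs|]; first exact: bst.
  exact: smooth_row_mxl.
- split=> [k|t bt]; last by rewrite hE ?row_mxKr//; exact: bst.
  apply: (Ck_comp oU ot _ _ (sh k)) => [t bt|]; first exact: VU (bst _ _ bs0 bt).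
  apply: (Ck_comp oV ot _ _ (sPsi k)) => [t bt|]; first exact: bst.
  exact: smooth_row_mxr.
Qed.

End ProductChart.

(** * Minimality of the factors of a product *)

Section RiemannianProduct.

Lemma is_derive_lsubmx m1 m2 (W : normedModType R) (F : 'rV[R]_m1 -> W)
    (y : 'rV[R]_(m1 + m2)) i dF :
  is_derive (lsubmx y) (delta_mx 0 i) F dF ->
  is_derive y (delta_mx 0 (lshift m2 i)) (fun y => F (lsubmx y)) dF.
Proof.
move=> /is_derive_lineP h; apply/is_derive_lineP.
rewrite (_ : (fun x : R => _) = (fun x : R => F (lsubmx y + x *: delta_mx 0 i)))//.
by apply/funext => x; rewrite linearD linearZ/= delta_mx_lshift row_mxKl.
Qed.

Lemma is_derive_rsubmx m1 m2 (W : normedModType R) (F : 'rV[R]_m2 -> W)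
    (y : 'rV[R]_(m1 + m2)) j dF :
  is_derive (rsubmx y) (delta_mx 0 j) F dF ->
  is_derive y (delta_mx 0 (rshift m1 j)) (fun y => F (rsubmx y)) dF.
Proof.
move=> /is_derive_lineP h; apply/is_derive_lineP.
rewrite (_ : (fun x : R => _) = (fun x : R => F (rsubmx y + x *: delta_mx 0 j)))//.
by apply/funext => x; rewrite linearD linearZ/= delta_mx_rshift row_mxKr.
Qed.

Lemma is_derive_lsubmx_rshift m1 m2 (W : normedModType R) (F : 'rV[R]_m1 -> W)
    (y : 'rV[R]_(m1 + m2)) j :
  is_derive y (delta_mx 0 (rshift m1 j)) (fun y => F (lsubmx y)) 0.
Proof.
apply/is_derive_lineP; rewrite (_ : (fun x : R => _) = (fun=> F (lsubmx y))).
  exact: is_derive_cst.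
by apply/funext => x; rewrite linearD linearZ/= delta_mx_rshift row_mxKl scaler0 addr0.
Qed.

Lemma is_derive_rsubmx_lshift m1 m2 (W : normedModType R) (F : 'rV[R]_m2 -> W)
    (y : 'rV[R]_(m1 + m2)) i :
  is_derive y (delta_mx 0 (lshift m2 i)) (fun y => F (rsubmx y)) 0.
Proof.
apply/is_derive_lineP; rewrite (_ : (fun x : R => _) = (fun=> F (rsubmx y))).
  exact: is_derive_cst.
by apply/funext => x; rewrite linearD linearZ/= delta_mx_lshift row_mxKr scaler0 addr0.
Qed.

Lemma pd_mulmx_agree m N (U : set 'rV[R]_m) (Y : 'rV[R]_m -> 'rV[R]_N) (K L : 'M[R]_N) u i :
  open U -> smooth_on U Y -> (forall u, U u -> Y u *m K = Y u *m L) -> U u ->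
  pd i Y u *m K = pd i Y u *m L.
Proof.
move=> oU sY YK Uu.
have D (A : 'M[R]_N) : is_derive u (delta_mx 0 i) (fun u => Y u *m A) (pd i Y u *m A).
  have h := is_derive_mulmx (Ck_is_derive i (sY 1) Uu) (is_derive_cst A u _).
  by apply: (is_derive_eq h); rewrite mulmx0 addr0.
rewrite -(pd_is_derive (D K)) -(pd_is_derive (D L)).
exact: (@pd_ext _ _ U _ (fun u => Y u *m L) i u oU Uu).
Qed.

Lemma invmx_block_diag p q (A : 'M[R]_p) (B : 'M[R]_q) : A \in unitmx -> B \in unitmx ->
  invmx (block_mx A 0 0 B) = block_mx (invmx A) 0 0 (invmx B).
Proof.
move=> uA uB; have e : block_mx A 0 0 B *m block_mx (invmx A) 0 0 (invmx B) = 1%:M.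
  by rewrite mulmx_block !mulmx0 !mul0mx !addr0 !add0r !mulmxV// -scalar_mx_block.
by rewrite -[RHS](mulKmx (mulmx1_unit e).1) e mulmx1.
Qed.

(** The normal projection kills the position vector Y u and the tangential part. *)
Lemma minimal_of_lap m N (U : set 'rV[R]_m) (Y : 'rV[R]_m -> 'rV[R]_N) (r mu : R) u :
  open U -> smooth_on U Y -> (forall u, U u -> immersive Y u) ->
  (forall u, U u -> dot (Y u) (Y u) = r) -> r != 0 -> U u ->
  lap Y u *m (1%:M - tangent_proj Y u) = mu *: Y u -> mean_curv Y u = 0.
Proof.
move=> oU sY iY hr r0 Uu e; rewrite mean_curvE.
have Qsym := normal_proj_sym oU sY hr Uu.
have PQ : tangent_proj Y u *m normal_proj Y u = 0.
  apply: trmx_inj; rewrite trmx_mul tangent_proj_sym Qsym trmx0.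
  exact: (normal_proj_proj oU sY iY hr Uu).
have YQ : Y u *m normal_proj Y u = 0.
  apply: trmx_inj; rewrite trmx_mul Qsym trmx0.
  exact: (normal_proj_point oU sY r0 hr Uu).
have := congr1 (fun v => v *m normal_proj Y u) e.
rewrite -mulmxA mulmxBl mul1mx PQ subr0 -scalemxAl YQ scaler0 => ->.
by rewrite scaler0.
Qed.

(** K is the projection onto the subspace that contains the first factor.  It removes the
    second factor everywhere except in the component along the position vector x, which
    remains with some coefficient mu. *)
Lemma project_normal_part N (L1 L2 x : 'rV[R]_N) (P1 P2 K : 'M[R]_N) :
  L1 *m K = L1 -> L2 *m K = 0 -> P1 *m K = P1 -> P2 *m K = 0 -> P1^T = P1 -> K^T = K ->
  exists mu, (L1 + L2) *m (1%:M - line_proj x - (P1 + P2)) *m K =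
             L1 *m (1%:M - P1) - mu *: (x *m K).
Proof.
move=> L1K L2K P1K P2K P1s Ks; exists ((dot x x)^-1 * dot (L1 + L2) x).
have L2P1 : L2 *m P1 = 0.
  by rewrite -P1s -P1K trmx_mul Ks mulmxA L2K mul0mx.
rewrite -mulmxA !mulmxBl mul1mx (mulmxDl P1) P1K P2K addr0 !mulmxBr mulmx1.
rewrite [(L1 + L2) *m K]mulmxDl L1K L2K addr0 [_ *m P1]mulmxDl L2P1 addr0 addrAC; congr (_ - _).
by rewrite /line_proj -scalemxAl -scalemxAr -[x^T *m x *m K]mulmxA (mulmxA (L1 + L2)) dotM mul_scalar_mx scalerA.
Qed.

Variables (m1 m2 N : nat) (V1 : set 'rV[R]_m1) (V2 : set 'rV[R]_m2) (V : set 'rV[R]_(m1 + m2)).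
Variables (Y1 : 'rV[R]_m1 -> 'rV[R]_N) (Y2 : 'rV[R]_m2 -> 'rV[R]_N).
Variables (X : 'rV[R]_(m1 + m2) -> 'rV[R]_N) (K : 'M[R]_N).
Hypotheses (oV1 : open V1) (oV2 : open V2) (oV : open V).
Hypothesis VV : forall y, V y -> V1 (lsubmx y) /\ V2 (rsubmx y).
Hypotheses (sY1 : smooth_on V1 Y1) (sY2 : smooth_on V2 Y2).
Hypothesis immY1 : forall s, V1 s -> immersive Y1 s.
Hypothesis immY2 : forall t, V2 t -> immersive Y2 t.
Hypothesis XE : forall y, V y -> X y = Y1 (lsubmx y) + Y2 (rsubmx y).
Hypotheses (K_sym : K^T = K) (Y1K : forall s, V1 s -> Y1 s *m K = Y1 s)
  (Y2K : forall t, V2 t -> Y2 t *m K = 0).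

Lemma pd_lshift_product y i : V y -> pd (lshift m2 i) X y = pd i Y1 (lsubmx y).
Proof.
move=> Vy; rewrite (@pd_ext _ _ V _ _ _ y oV Vy XE); apply: pd_is_derive.
have h := is_derive_lsubmx (Ck_is_derive i (sY1 1) (VV Vy).1).
by apply: (is_derive_eq (is_deriveD h (is_derive_rsubmx_lshift Y2 y i))); rewrite addr0.
Qed.

Lemma pd_rshift_product y j : V y -> pd (rshift m1 j) X y = pd j Y2 (rsubmx y).
Proof.
move=> Vy; rewrite (@pd_ext _ _ V _ _ _ y oV Vy XE); apply: pd_is_derive.
have h := is_derive_rsubmx (Ck_is_derive j (sY2 1) (VV Vy).2).
by apply: (is_derive_eq (is_deriveD (is_derive_lsubmx_rshift Y1 y j) h)); rewrite add0r.
Qed.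

Lemma pd_pd_lshift y i i' : V y ->
  pd (lshift m2 i) (pd (lshift m2 i') X) y = pd i (pd i' Y1) (lsubmx y).
Proof.
move=> Vy.
rewrite (@pd_ext _ _ V _ (fun y => pd i' Y1 (lsubmx y)) _ y oV Vy); last first.
  by move=> w Vw; exact: pd_lshift_product.
exact: pd_is_derive (is_derive_lsubmx (Ck_is_derive i (Ck_pd i' (sY1 2)) (VV Vy).1)).
Qed.

Lemma pd_pd_rshift y j j' : V y ->
  pd (rshift m1 j) (pd (rshift m1 j') X) y = pd j (pd j' Y2) (rsubmx y).
Proof.
move=> Vy.
rewrite (@pd_ext _ _ V _ (fun y => pd j' Y2 (rsubmx y)) _ y oV Vy); last first.
  by move=> w Vw; exact: pd_rshift_product.
exact: pd_is_derive (is_derive_rsubmx (Ck_is_derive j (Ck_pd j' (sY2 2)) (VV Vy).2)).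
Qed.

Lemma jacobian_product y : V y ->
  jacobian_mx X y = col_mx (jacobian_mx Y1 (lsubmx y)) (jacobian_mx Y2 (rsubmx y)).
Proof.
move=> Vy; apply/row_matrixP => k; rewrite row_jacobian.
case: (split_ordP k) => l ->; rewrite ?rowKu ?rowKd row_jacobian.
  exact: pd_lshift_product.
exact: pd_rshift_product.
Qed.

Lemma jacobian_factor1 s : V1 s -> jacobian_mx Y1 s *m K = jacobian_mx Y1 s.
Proof.
move=> V1s; apply/row_matrixP => i; rewrite row_mul row_jacobian -[RHS]mulmx1.
by apply: (pd_mulmx_agree i oV1 sY1 _ V1s) => u Vu; rewrite mulmx1 Y1K.
Qed.

Lemma jacobian_factor2 t : V2 t -> jacobian_mx Y2 t *m K = 0.
Proof.
move=> V2t; apply/row_matrixP => i; rewrite row_mul row_jacobian row0 -(mulmx0 _ (pd i Y2 t)).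
by apply: (pd_mulmx_agree i oV2 sY2 _ V2t) => u Vu; rewrite mulmx0 Y2K.
Qed.

Lemma jacobian_orth y : V y -> jacobian_mx Y1 (lsubmx y) *m (jacobian_mx Y2 (rsubmx y))^T = 0.
Proof.
move=> /VV[V1s V2t]; rewrite -jacobian_factor1// -mulmxA -{1}K_sym -trmx_mul.
by rewrite jacobian_factor2// trmx0 mulmx0.
Qed.

Lemma ginv_product y : V y -> ginv (induced_metric X) y =
  block_mx (ginv (induced_metric Y1) (lsubmx y)) 0 0 (ginv (induced_metric Y2) (rsubmx y)).
Proof.
move=> Vy; have [V1s V2t] := VV Vy.
rewrite /ginv !induced_metricE /tangent_basis jacobian_product// tr_col_mx mul_col_row.
rewrite jacobian_orth// -[jacobian_mx Y2 _ *m (jacobian_mx Y1 _)^T]trmxK.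
rewrite trmx_mul trmxK jacobian_orth// trmx0.
by rewrite invmx_block_diag//; apply: row_free_gram; [exact: immY1|exact: immY2].
Qed.

Lemma tangent_proj_product y : V y ->
  tangent_proj X y = tangent_proj Y1 (lsubmx y) + tangent_proj Y2 (rsubmx y).
Proof.
move=> Vy; rewrite /tangent_proj ginv_product// /tangent_basis jacobian_product// tr_col_mx.
by rewrite mul_row_block !mulmx0 addr0 add0r mul_row_col.
Qed.

Lemma lap_product y : V y -> lap X y = lap Y1 (lsubmx y) + lap Y2 (rsubmx y).
Proof.
move=> Vy; rewrite /lap /mtrace ginv_product// big_split_ord/=; congr (_ + _).
  apply: eq_bigr => i _; rewrite big_split_ord/= [X in _ + X]big1 ?addr0 => [|j _]; last first.
    by rewrite block_mxEur mxE scale0r.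
  by apply: eq_bigr => j _; rewrite block_mxEul pd_pd_lshift.
apply: eq_bigr => i _; rewrite big_split_ord/= [X in X + _]big1 ?add0r => [|j _]; last first.
  by rewrite block_mxEdl mxE scale0r.
by apply: eq_bigr => j _; rewrite block_mxEdr pd_pd_rshift.
Qed.

Lemma lap_factor1 s : V1 s -> lap Y1 s *m K = lap Y1 s.
Proof.
move=> V1s; rewrite /lap mtraceM; apply: eq_mtrace => i j.
rewrite -[RHS]mulmx1; apply: (pd_mulmx_agree i oV1 (smooth_pd j sY1) _ V1s) => u Vu.
by apply: (pd_mulmx_agree j oV1 sY1 _ Vu) => w Vw; rewrite mulmx1 Y1K.
Qed.

Lemma lap_factor2 t : V2 t -> lap Y2 t *m K = 0.
Proof.
move=> V2t; rewrite /lap mtraceM -[RHS](mulmx0 _ (mtrace (induced_metric Y2) (fun i j => pd i (pd j Y2) t) t)).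
rewrite mtraceM; apply: eq_mtrace => i j.
apply: (pd_mulmx_agree i oV2 (smooth_pd j sY2) _ V2t) => u Vu.
by apply: (pd_mulmx_agree j oV2 sY2 _ Vu) => w Vw; rewrite mulmx0 Y2K.
Qed.

Lemma tangent_proj_factor1 s : V1 s -> tangent_proj Y1 s *m K = tangent_proj Y1 s.
Proof. by move=> V1s; rewrite /tangent_proj -[LHS]mulmxA [_ *m K]jacobian_factor1. Qed.

Lemma tangent_proj_factor2 t : V2 t -> tangent_proj Y2 t *m K = 0.
Proof. by move=> V2t; rewrite /tangent_proj -[LHS]mulmxA [_ *m K]jacobian_factor2// mulmx0. Qed.

Variables (r r1 r2 c : R).
Hypotheses (m_gt0 : (0 < m1 + m2)%N) (r1_0 : r1 != 0) (r2_0 : r2 != 0).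
Hypothesis sX : smooth_on V X.
Hypothesis hr : forall y, V y -> dot (X y) (X y) = r.
Hypothesis hr1 : forall s, V1 s -> dot (Y1 s) (Y1 s) = r1.
Hypothesis hr2 : forall t, V2 t -> dot (Y2 t) (Y2 t) = r2.
Hypothesis HX : forall y, V y -> mean_curv X y = c *: (Y2 (rsubmx y) - Y1 (lsubmx y)).

Let mR : (m1 + m2)%:R != 0 :> R. Proof. by rewrite pnatr_eq0 -lt0n. Qed.

Lemma lap_normal_product y : V y ->
  (lap Y1 (lsubmx y) + lap Y2 (rsubmx y)) *m
    (1%:M - line_proj (X y) - (tangent_proj Y1 (lsubmx y) + tangent_proj Y2 (rsubmx y))) =
  ((m1 + m2)%:R * c) *: (Y2 (rsubmx y) - Y1 (lsubmx y)).
Proof.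
move=> Vy; have := HX Vy; rewrite mean_curvE lap_product// (normal_projE oV sX hr Vy).
rewrite tangent_proj_product// => e.
by rewrite -scalerA -e scalerA mulfV// scale1r.
Qed.

(** Project m H = m c (Y2 - Y1) with K: up to multiples of Y1, this says that the part of
    [lap Y1] orthogonal to the tangent space of the first factor is zero. *)
Lemma minimal_factor1 y : V y -> mean_curv Y1 (lsubmx y) = 0.
Proof.
move=> Vy; have [V1s V2t] := VV Vy.
have [mu e] := project_normal_part (X y) (lap_factor1 V1s) (lap_factor2 V2t)
  (tangent_proj_factor1 V1s) (tangent_proj_factor2 V2t) (tangent_proj_sym _ _) K_sym.
rewrite lap_normal_product// XE// mulmxDl Y1K// Y2K// addr0 in e.
rewrite -scalemxAl mulmxBl Y1K// Y2K// sub0r scalerN in e.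
apply: (minimal_of_lap (mu := mu - (m1 + m2)%:R * c) oV1 sY1 immY1 hr1 r1_0 V1s).
by move/eqP: e; rewrite eq_sym subr_eq => /eqP ->; rewrite scalerBl addrC.
Qed.

(** The argument of [minimal_factor1] with the complementary projection 1 - K. *)
Lemma minimal_factor2 y : V y -> mean_curv Y2 (rsubmx y) = 0.
Proof.
move=> Vy; have [V1s V2t] := VV Vy.
have K_compl p (A : 'M[R]_(p, N)) : A *m K = 0 -> A *m (1%:M - K) = A.
  by move=> AK; rewrite mulmxBr mulmx1 AK subr0.
have K_compl0 p (A : 'M[R]_(p, N)) : A *m K = A -> A *m (1%:M - K) = 0.
  by move=> AK; rewrite mulmxBr mulmx1 AK subrr.
have K'_sym : (1%:M - K)^T = 1%:M - K by rewrite linearB/= trmx1 K_sym.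
have [mu e] := project_normal_part (X y) (K_compl _ _ (lap_factor2 V2t))
  (K_compl0 _ _ (lap_factor1 V1s)) (K_compl _ _ (tangent_proj_factor2 V2t))
  (K_compl0 _ _ (tangent_proj_factor1 V1s)) (tangent_proj_sym _ _) K'_sym.
have Y2K' := K_compl _ _ (Y2K V2t); have Y1K' := K_compl0 _ _ (Y1K V1s).
rewrite [lap Y2 _ + _]addrC [tangent_proj Y2 _ + _]addrC lap_normal_product// XE// in e.
rewrite mulmxDl Y1K' Y2K' add0r -scalemxAl mulmxBl Y1K' Y2K' subr0 in e.
apply: (minimal_of_lap (mu := mu + (m1 + m2)%:R * c) oV2 sY2 immY2 hr2 r2_0 V2t).
by move/eqP: e; rewrite eq_sym subr_eq => /eqP ->; rewrite scalerDl addrC.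
Qed.

End RiemannianProduct.

(** * The factors as submanifolds *)

Section FactorSubmanifold.

Lemma smooth_id m (U : set 'rV[R]_m) : open U -> smooth_on U id.
Proof. by move=> oU k; apply/(Ck_mxP _ _ oU) => i j; rewrite ord1; exact: Ck_coord. Qed.

Lemma continuous_mulmxr p q (A : 'M[R]_(p, q)) : continuous (fun v : 'rV[R]_p => v *m A).
Proof.
move=> v; have h := smooth_mulr A openT (smooth_id openT).
exact: (Ck_cont (h 0) I).
Qed.

Lemma open_preimage (T W : topologicalType) (F : T -> W) (O : set W) :
  continuous F -> open O -> open (F @^-1` O).
Proof. by move=> cF oO; apply: open_comp => // x _; exact: cF. Qed.

(** A ball is the union of the segments from its centre. *)
Lemma ball_connected m (s0 : 'rV[R]_m) (r : R) : 0 < r -> connected (ball s0 r).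
Proof.
move=> r0.
have -> : ball s0 r = \bigcup_(s in ball s0 r) ((fun x : R => s0 + x *: (s - s0)) @` `[0, 1]%classic).
  apply/seteqP; split=> [s bs|w [s bs [x x01 <-]]].
    exists s => //; exists 1; first by rewrite /= in_itv/= lexx ler01.
    by rewrite scale1r addrC subrK.
  apply/rV_ball => // i; rewrite !mxE; apply: norm_conv_lt.
  - by rewrite subrr normr0.
  - by move/rV_ball : bs => ->.
  - by [].
apply: bigcup_connected.
  exists s0 => s bs; exists 0; first by rewrite /= in_itv/= lexx ler01.
  by rewrite scale0r addr0.
move=> s bs; apply: connected_continuous_connected; first exact: segment_connected.
apply: continuous_subspaceT => x; apply: cvgD; first exact: cvg_cst.
by apply: cvgZr_tmp; exact: cvg_id.
Qed.

Lemma jacobian_left_inverse m k (U : set 'rV[R]_m) (y : 'rV[R]_m -> 'rV[R]_k) (L : 'M[R]_(k, m)) s :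
  open U -> smooth_on U y -> (forall s, U s -> y s *m L = s) -> U s ->
  jacobian_mx y s *m L = 1%:M.
Proof.
move=> oU sy yL Us; apply/row_matrixP => i; rewrite row_mul row_jacobian row1.
rewrite -(pd_mulr L i oU sy Us) (@pd_ext _ _ U _ id i s oU Us yL).
exact: pd_is_derive (is_derive_id s _).
Qed.

Lemma immersive_left_inverse m k (U : set 'rV[R]_m) (y : 'rV[R]_m -> 'rV[R]_k) (L : 'M[R]_(k, m)) s :
  open U -> smooth_on U y -> (forall s, U s -> y s *m L = s) -> U s -> immersive y s.
Proof.
by move=> oU sy yL Us; apply/row_freeP; exists L; exact: jacobian_left_inverse oU sy yL Us.
Qed.

(** The linear left inverse L makes y an immersion, injective and open onto its image at
    once. *)
Lemma local_param_left_inverse m k (U : set 'rV[R]_m) (y : 'rV[R]_m -> 'rV[R]_k)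
    (L : 'M[R]_(k, m)) :
  open U -> smooth_on U y -> (forall s, U s -> y s *m L = s) ->
  local_param (y @` U) U y.
Proof.
move=> oU sy yL; split=> // [s Us|s s' /[!inE] Us Us' e|O oO OU].
- exact: immersive_left_inverse oU sy yL Us.
- by rewrite -(yL s)// -(yL s')// e.
- exists ((fun q : 'rV[R]_k => q *m L) @^-1` O).
    by apply: open_preimage oO; exact: continuous_mulmxr.
  apply/seteqP; split=> [_ [s Os <-]|_ [[s Us <-] /=]]; last by rewrite yL// => Os; exists s.
  by split; [exists s => //; exact: OU|rewrite /= yL//; exact: OU].
Qed.

Lemma sphere_submanifold_left_inverse m k (s0 : 'rV[R]_m) (r rho : R)
    (y : 'rV[R]_m -> 'rV[R]_k) (L : 'M[R]_(k, m)) :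
  0 < r -> smooth_on (ball s0 r) y -> (forall s, ball s0 r s -> y s *m L = s) ->
  (forall s, ball s0 r s -> enorm (y s) = rho) ->
  sphere_submanifold m rho (y @` ball s0 r).
Proof.
move=> r0 sy yL yr; split=> [_ [s bs <-]|||p yp].
- exact: yr.
- by exists (y s0), s0 => //; exact: ballxx.
- apply: connected_continuous_connected; first exact: ball_connected.
  by apply: continuous_in_subspaceT => s /[!inE] bs; exact: (Ck_cont (sy 0) bs).
- exists (ball s0 r), y; split=> //.
  by apply: local_param_left_inverse yL => //; exact: ball_open.
Qed.

(** A linear isometric embedding preserves the metric, and intertwines derivatives and normal
    projections. *)
Lemma mean_curv_isometry m k N (U : set 'rV[R]_m) (Z : 'rV[R]_m -> 'rV[R]_k) (Q : 'M[R]_(k, N)) w :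
  open U -> smooth_on U Z -> Q *m Q^T = 1%:M -> U w ->
  mean_curv (fun w => Z w *m Q) w = mean_curv Z w *m Q.
Proof.
move=> oU sZ QQ Uw; set Z' := fun w => Z w *m Q.
have DZ : tangent_basis Z' w = tangent_basis Z w *m Q.
  apply/row_matrixP => i; rewrite row_mul !row_tangent_basis.
  exact: (pd_mulr Q i oU sZ Uw).
have gZ : ginv (induced_metric Z') w = ginv (induced_metric Z) w.
  by rewrite /ginv !induced_metricE DZ trmx_mul mulmxA -(mulmxA _ Q) QQ mulmx1.
have PZ : tangent_proj Z' w = Q^T *m tangent_proj Z w *m Q.
  by rewrite /tangent_proj gZ DZ trmx_mul !mulmxA.
have dZ : dot (Z' w) (Z' w) = dot (Z w) (Z w).
  by rewrite !dotE trmx_mul mulmxA -(mulmxA _ Q) QQ mulmx1.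
have lZ : line_proj (Z' w) = Q^T *m line_proj (Z w) *m Q.
  by rewrite /line_proj dZ trmx_mul !mulmxA -scalemxAr -scalemxAl !mulmxA.
have NZ : Q *m normal_proj Z' w = normal_proj Z w *m Q.
  have step (B : 'M[R]_k) : Q *m (1%:M - Q^T *m B *m Q) = (1%:M - B) *m Q.
    by rewrite mulmxBr mulmx1 mulmxBl mul1mx !mulmxA QQ mul1mx.
  by rewrite /normal_proj PZ lZ mulmxA step -mulmxA step mulmxA.
have LZ : lap Z' w = lap Z w *m Q.
  rewrite /lap mtraceM /mtrace gZ.
  apply: eq_bigr => i _; apply: eq_bigr => j _; congr (_ *: _).
  apply: (etrans _ (pd_mulr Q i oU (smooth_pd j sZ) Uw)).
  apply: (@pd_ext _ _ U _ (fun w => pd j Z w *m Q) i w oU Uw) => v Uv.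
  exact: (pd_mulr Q j oU sZ Uv).
by rewrite !mean_curvE LZ -mulmxA NZ mulmxA scalemxAl.
Qed.

(** Y is a graph over the coordinates given by E, so its image is covered by one chart with
    a linear inverse.  Any other chart Z is Y composed with the smooth map Z Q E^T, and
    minimality in the chart Y passes to it by [mean_curv_reparam] and [mean_curv_isometry]. *)
Lemma factor_submanifold m k N (s0 : 'rV[R]_m) (r rho : R) (Y : 'rV[R]_m -> 'rV[R]_N)
    (E : 'M[R]_(m, N)) (Q : 'M[R]_(k, N)) :
  0 < r -> smooth_on (ball s0 r) Y -> (forall s, ball s0 r s -> Y s *m E^T = s) ->
  Q *m Q^T = 1%:M -> (forall s, ball s0 r s -> Y s *m Q^T *m Q = Y s) ->
  (forall s, ball s0 r s -> enorm (Y s) = rho) ->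
  (forall s, ball s0 r s -> mean_curv Y s = 0) ->
  let M := (fun s => Y s *m Q^T) @` ball s0 r in
  sphere_submanifold m rho M /\ minimal m M.
Proof.
move=> r0 sY YE QQ YQ Yr Ymin M.
have oB : open (ball s0 r) by exact: ball_open.
have yL s : ball s0 r s -> Y s *m Q^T *m (Q *m E^T) = s.
  by move=> bs; rewrite mulmxA YQ// YE.
split.
  apply: (sphere_submanifold_left_inverse r0 _ yL) => [|s bs].
    exact: (smooth_mulr Q^T oB sY).
  rewrite -(Yr s bs) /enorm; congr Num.sqrt.
  by rewrite !dotE trmx_mul trmxK mulmxA YQ.
move=> U Z [oU sZ iZ injZ opZ] w Uw.
have ZM v : U v -> M (Z v).
  move=> Uv; have [W _ e] := opZ U oU (fun _ => id).
  by have : (Z @` U) (Z v) by [exists v]; rewrite e => -[].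
pose th v := Z v *m (Q *m E^T).
have bth v : U v -> ball s0 r (th v) /\ Z v *m Q = Y (th v).
  by move=> Uv; rewrite /th; have [s bs <-] := ZM v Uv; rewrite yL// YQ.
have h := mean_curv_isometry oU sZ QQ Uw.
have iZQ v : U v -> immersive (fun v => Z v *m Q) v.
  move=> Uv; rewrite /immersive -/(jacobian_mx (fun v => Z v *m Q) v).
  have /row_freeP[B JB] := iZ v Uv; apply/row_freeP; exists (Q^T *m B).
  have -> : jacobian_mx (fun v => Z v *m Q) v = jacobian_mx Z v *m Q.
    apply/row_matrixP => i; rewrite row_mul !row_jacobian.
    exact: (pd_mulr Q i oU sZ Uv).
  by rewrite -mulmxA (mulmxA Q) QQ mul1mx.
have e : mean_curv (fun v => Z v *m Q) w = mean_curv Y (th w).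
  apply: (mean_curv_reparam (r := rho ^+ 2) oB oU sY (smooth_mulr _ oU sZ) _ _ _ iZQ _ Uw).
  - by move=> v /bth[].
  - by move=> v /bth[].
  - by move=> s bs; exact: immersive_left_inverse oB sY YE bs.
  - by move=> s bs; rewrite -(Yr s bs) enorm_sqr.
rewrite Ymin ?h in e; last by have [] := bth w Uw.
by have := congr1 (fun v => v *m Q^T) e; rewrite mul0mx -mulmxA QQ mulmx1.
Qed.

(** Q1 is an orthonormal basis of the span of S1, and Q2 one of its whole orthogonal
    complement, so that the two together fill the space; the nonzero vectors v1 and v2 make
    both nonempty. *)
Lemma orthogonal_spans N (S1 S2 : set 'rV[R]_N) (v1 v2 : 'rV[R]_N) :
  (forall v w, S1 v -> S2 w -> dot v w = 0) -> S1 v1 -> v1 != 0 -> S2 v2 -> v2 != 0 ->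
  exists n1 n2 (Q1 : 'M[R]_(n1.+1, N)) (Q2 : 'M[R]_(n2.+1, N)),
  [/\ (n1.+1 + n2.+1 = N)%N, [/\ Q1 *m Q1^T = 1%:M, Q2 *m Q2^T = 1%:M & Q1 *m Q2^T = 0],
      forall v, S1 v -> v *m Q1^T *m Q1 = v & forall v, S2 v -> v *m Q2^T *m Q2 = v].
Proof.
move=> S12 S1v v1_0 S2v v2_0; have [p [A [S1A AS1]]] := spanning_rows S1.
have A2 w : S2 w -> (w <= kermx A^T)%MS.
  move=> S2w; apply/sub_kermxP; apply: trmx_inj; rewrite trmx_mul trmxK trmx0.
  apply/row_matrixP => i; rewrite row_mul row0 dotM S12//.
  by apply/matrixP => a b; rewrite !mxE mul0rn.
have rpos q (B : 'M[R]_(q, N)) (v : 'rV[R]_N) : (v <= B)%MS -> v != 0 -> (0 < \rank B)%N.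
  move=> vB; rewrite lt0n mxrank_eq0; apply: contra_neq => B0.
  by move: vB; rewrite B0; exact: submx0null.
have r1 := rpos _ _ _ (S1A _ S1v) v1_0; have r2 := rpos _ _ _ (A2 _ S2v) v2_0.
have [Q1 [QQ1 /andP[Q1A AQ1]]] := orthonormal_basis (esym (prednK r1)).
have [Q2 [QQ2 /andP[Q2A AQ2]]] := orthonormal_basis (esym (prednK r2)).
have basis q (Q : 'M[R]_(q, N)) v : Q *m Q^T = 1%:M -> (v <= Q)%MS -> v *m Q^T *m Q = v.
  by move=> QQ /submxP[w ->]; rewrite -(mulmxA w) QQ mulmx1.
exists (\rank A).-1, (\rank (kermx A^T)).-1, Q1, Q2; split.
- by rewrite !prednK// mxrank_ker mxrank_tr subnKC// rank_leq_col.
- split=> //; have /submxP[B ->] := Q1A.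
  have /sub_kermxP/(congr1 trmx) := Q2A; rewrite trmx_mul trmxK trmx0 => e.
  by rewrite -mulmxA e mulmx0.
- by move=> v Sv; apply: basis => //; exact: submx_trans (S1A _ Sv) AQ1.
- by move=> v Sv; apply: basis => //; exact: submx_trans (A2 _ Sv) AQ2.
Qed.

End FactorSubmanifold.

(** * The splitting into eigenspaces *)

Section PrincipalSplitting.

Lemma halves_idempotent N (P A : 'M[R]_N) (c : R) : c != 0 ->
  P *m P = P -> A *m P = A -> P *m A = A -> A *m A = c ^+ 2 *: P ->
  let S := 2^-1 *: (P + c^-1 *: A) in let T := 2^-1 *: (P - c^-1 *: A) in
  [/\ S + T = P, S *m S = S, T *m T = T, S *m T = 0 & T *m S = 0].
Proof.
move=> c0 PP AP PA AA S T; set B := c^-1 *: A.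
have BP : B *m P = B by rewrite -scalemxAl AP.
have PB : P *m B = B by rewrite -scalemxAr PA.
have BB : B *m B = P.
  by rewrite -scalemxAl -scalemxAr AA !scalerA -expr2 exprVn mulVf ?scale1r ?expf_neq0.
rewrite /S /T -/B; move: B BP PB BB => B BP PB BB.
have entries := (mulmxDl, mulmxDr, mulmxN, mulNmx, PP, PB, BP, BB).
split; first by apply/matrixP => i j; rewrite !mxE; field.
all: by rewrite -scalemxAl -scalemxAr !entries; apply/matrixP => i j; rewrite !mxE; field.
Qed.

Lemma complementary_ranks N (S T : 'M[R]_N) :
  S *m S = S -> T *m T = T -> S *m T = 0 -> T *m S = 0 ->
  (\rank S + \rank T)%N = \rank (S + T)%R.
Proof.
move=> SS TT ST TS.
have cap : (S :&: T)%MS = 0.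
  apply/eqP; rewrite -submx0; apply/rV_subP => w.
  rewrite sub_capmx => /andP[/submxP[a wa] /submxP[b wb]].
  by rewrite wa -SS mulmxA -wa wb -mulmxA TS mulmx0 sub0mx.
rewrite -(mxrank_disjoint_sum cap); apply: eqmx_rank; apply/andP; split; last first.
  by rewrite addmx_sub_adds.
rewrite addsmx_sub; apply/andP; split.
  by rewrite -{1}SS -[S *m S]addr0 -ST -mulmxDr submxMl.
by rewrite -{1}TT -[T *m T]add0r -TS -mulmxDr submxMl.
Qed.

Lemma row_base_inj N (S : 'M[R]_N) (v : 'rV[R]_N) :
  v *m S *m (row_base S)^T = 0 -> v *m S = 0.
Proof.
move=> h; have /submxP[w e] : (v *m S <= row_base S)%MS by rewrite eq_row_base submxMl.
apply: dot_eq0; rewrite dotE {2}e trmx_mul mulmxA h mul0mx mxE.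
by [].
Qed.

Lemma dot_bilinear N (x y : 'rV[R]_N) a b : dot (2^-1 *: (x - a *: y)) (2^-1 *: (x - b *: y)) =
  4^-1 * (dot x x - (a + b) * dot x y + a * b * dot y y).
Proof.
rewrite /dot !mulr_sumr -sumrN -!big_split /= mulr_sumr; apply: eq_bigr => i _; rewrite !mxE; by field.
Qed.

End PrincipalSplitting.

Section SplittingChart.
Variables (m N : nat) (U : set 'rV[R]_m) (X : 'rV[R]_m -> 'rV[R]_N).
Notation H := (mean_curv X).
Notation A := (ambient_weingarten X).
Notation P := (tangent_proj X).
Hypotheses (oU : open U) (sX : smooth_on U X) (immX : forall u, U u -> immersive X u).
Hypotheses (m_gt0 : (0 < m)%N) (hr : forall u, U u -> dot (X u) (X u) = 1).
Hypothesis H_parallel : forall u, U u -> forall i, nabla_perp X i H u = 0.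
Hypothesis AH_parallel : forall u, U u ->
  forall i j k, nabla_end X (weingarten X H) i j k u = 0.
Hypothesis X_biharmonic : forall u, U u -> bitension (induced_metric X) X u = 0.

Let sH : smooth_on U H := smooth_mean_curv oU sX immX hr.

(** The derivatives of H are tangent, hence orthogonal to H. *)
Lemma mean_curv_norm_const u0 (rr : R) : 0 < rr -> ball u0 rr `<=` U ->
  forall u, ball u0 rr u -> dot (H u) (H u) = dot (H u0) (H u0).
Proof.
move=> rr0 bU u bu.
have := @zero_partials_const m 1 1 (fun u => H u *m (H u)^T) u0 rr _ u u0 bu (ballxx _ rr0).
move=> h; apply: (etrans (dotE _ _)); apply: (etrans _ (esym (dotE _ _))).
apply: (congr1 (fun M : 'M[R]_1 => M 0 0)); apply: h => w i /bU Uw.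
have dH := Ck_is_derive i (sH 1) Uw.
apply: (is_derive_eq (is_derive_mulmx dH (is_derive_trmx dH))).
have hn := pdH_normal_part oU sX immX hr H_parallel i Uw.
by rewrite !dotM [dot (H w) _]dotC hn raddf0 addr0.
Qed.

Variable (c : R).
Hypotheses (c0 : 0 < c) (cH : forall u, U u -> dot (H u) (H u) = c ^+ 2).

(** Half of a focal point of M: the shape operator of the unit normal H / c has the eigenvalues
    1 and - 1, and for e = c or e = - c the eigenvectors of the sign opposite to e focus at
    X - H / e. *)
Definition focal_map (e : R) u : 'rV[R]_N := 2^-1 *: (X u - e^-1 *: H u).

(** When A A = e^2 P, this is the orthogonal projection onto the eigenspace of A for e. *)
Definition principal_proj (e : R) u : 'M[R]_N := 2^-1 *: (P u + e^-1 *: A u).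

Lemma smooth_focal_map e : smooth_on U (focal_map e).
Proof.
move=> k; apply: (Ck_scale oU); first exact: Ck_cst.
apply: (Ck_add oU (sX k)); apply: (Ck_opp oU); apply: (Ck_scale oU) (sH k).
exact: Ck_cst.
Qed.

Lemma pd_focal_map e u i : U u -> pd i (focal_map e) u = pd i X u *m principal_proj e u.
Proof.
move=> Uu.
have dX := Ck_is_derive i (sX 1) Uu; have dH := Ck_is_derive i (sH 1) Uu.
have d := is_deriveZ 2^-1 (is_deriveD dX (is_deriveN (is_deriveZ e^-1 dH))).
rewrite (pd_is_derive d) /principal_proj -scalemxAr mulmxDr (pdX_tangent_proj immX i Uu).
by rewrite -scalemxAr (pdX_weingarten immX i Uu) scalerN.
Qed.

Lemma focal_map_sum u : focal_map c u + focal_map (- c) u = X u.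
Proof.
by rewrite /focal_map invrN; move: (X u) (H u) c^-1 => x y k; apply/rowP => a; rewrite !mxE; field.
Qed.

Lemma focal_map_diff u : focal_map (- c) u - focal_map c u = c^-1 *: H u.
Proof.
by rewrite /focal_map invrN; move: (X u) (H u) c^-1 => x y k; apply/rowP => a; rewrite !mxE; field.
Qed.

Let XH u : U u -> dot (X u) (H u) = 0.
Proof.
by move=> Uu; rewrite dotC dotE (mean_curv_point oU sX immX hr Uu) mxE.
Qed.

Lemma focal_map_orth u : U u -> dot (focal_map c u) (focal_map (- c) u) = 0.
Proof.
move=> Uu; rewrite /focal_map dot_bilinear hr// XH// cH// invrN.
by field; exact: lt0r_neq0.
Qed.

Lemma focal_map_norm e u : e ^+ 2 = c ^+ 2 -> U u -> dot (focal_map e u) (focal_map e u) = 2^-1.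
Proof.
move=> ec Uu; rewrite /focal_map dot_bilinear hr// XH// cH// -ec.
have e0 : e != 0 by rewrite -sqrf_eq0 ec sqrf_eq0 lt0r_neq0.
by field.
Qed.

Lemma principal_projP u : U u ->
  let S := principal_proj c u in let T := principal_proj (- c) u in
  [/\ S + T = P u, S *m S = S, T *m T = T, S *m T = 0 & T *m S = 0].
Proof.
move=> Uu; have AA := weingarten_sqr oU sX immX m_gt0 hr H_parallel AH_parallel X_biharmonic Uu.
rewrite cH// in AA.
have := halves_idempotent (lt0r_neq0 c0) (tangent_proj_idem immX Uu)
  (weingarten_proj oU sX immX hr H_parallel Uu) (proj_weingarten immX Uu) AA.
by rewrite /principal_proj invrN scaleNr.
Qed.

Lemma rank_tangent_proj u : U u -> \rank (P u) = m.
Proof.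
move=> Uu; have DP := basis_tangent_proj immX Uu.
have /eqP rD : row_free (tangent_basis X u) by exact: immX.
apply: (etrans _ rD); apply: eqmx_rank; apply/andP; split; first exact: submxMl.
by rewrite -{1}DP submxMl.
Qed.

(** The projections for c and - c sum to P, so their ranks add up to m.  If the one for e
    vanishes, then A = - e P; its trace m e^2 equals - m e, so e = -1, which is excluded for
    e = c and for e = - c. *)
Lemma principal_splitting u : c < 1 -> U u ->
  exists m1 m2 (E1 : 'M[R]_(m1, N)) (E2 : 'M[R]_(m2, N)),
  [/\ (0 < m1)%N, (0 < m2)%N, (m1 + m2 = m)%N,
      forall v : 'rV[R]_N, v *m principal_proj c u *m E1^T = 0 -> v *m principal_proj c u = 0 &
      forall v : 'rV[R]_N, v *m principal_proj (- c) u *m E2^T = 0 -> v *m principal_proj (- c) u = 0].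
Proof.
move=> c1 Uu; have [ST SS TT S_T T_S] := principal_projP Uu.
have trP := tr_tangent_proj immX Uu.
have trA := tr_weingarten oU sX immX m_gt0 hr H_parallel Uu.
rewrite cH// in trA.
have mR : 0 < m%:R :> R by rewrite ltr0n.
(* The trace of the projection for e is m (1 + e) / 2. *)
have nonzero e : e ^+ 2 = c ^+ 2 -> e != -1 -> principal_proj e u != 0.
  move=> ec e1; have e0 : e != 0 by rewrite -sqrf_eq0 ec sqrf_eq0 lt0r_neq0.
  apply/eqP => /(congr1 mxtrace); rewrite linearZ/= mxtraceD linearZ/= trP trA mxtrace0 -ec.
  have -> : 2^-1 * (m%:R + e^-1 * (m%:R * e ^+ 2)) = 2^-1 * m%:R * (1 + e) by field.
  apply/eqP; apply: mulf_neq0; last by rewrite addrC -(opprK 1) subr_eq0.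
  by rewrite mulf_neq0 ?lt0r_neq0// invr_gt0.
exists (\rank (principal_proj c u)), (\rank (principal_proj (- c) u)),
  (row_base (principal_proj c u)), (row_base (principal_proj (- c) u)); split.
- by rewrite lt0n mxrank_eq0 nonzero//; apply/eqP => h; move: c0; rewrite h; lra.
- by rewrite lt0n mxrank_eq0 nonzero ?sqrrN// eqr_opp lt_eqF.
- by rewrite complementary_ranks// ST rank_tangent_proj.
- by move=> v; exact: row_base_inj.
- by move=> v; exact: row_base_inj.
Qed.

End SplittingChart.

(** * The local product decomposition *)

Section LocalProduct.
Variables (m1 m2 n : nat) (M : set 'rV[R]_n.+1).
Variables (U : set 'rV[R]_(m1 + m2)) (X : 'rV[R]_(m1 + m2) -> 'rV[R]_n.+1).
Variables (u0 : 'rV[R]_(m1 + m2)) (c : R) (E1 : 'M[R]_(m1, n.+1)) (E2 : 'M[R]_(m2, n.+1)).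
Notation H := (mean_curv X).
Hypotheses (oU : open U) (sX : smooth_on U X) (immX : forall u, U u -> immersive X u).
Hypothesis openX : forall O, open O -> O `<=` U -> exists2 W, open W & X @` O = M `&` W.
Hypotheses (m1_gt0 : (0 < m1)%N) (m2_gt0 : (0 < m2)%N).
Hypothesis hr : forall u, U u -> dot (X u) (X u) = 1.
Hypothesis H_parallel : forall u, U u -> forall i, nabla_perp X i H u = 0.
Hypothesis AH_parallel : forall u, U u ->
  forall i j k, nabla_end X (weingarten X H) i j k u = 0.
Hypothesis X_biharmonic : forall u, U u -> bitension (induced_metric X) X u = 0.
Hypotheses (c0 : 0 < c) (cH : forall u, U u -> dot (H u) (H u) = c ^+ 2) (Uu0 : U u0).
Hypothesis E1_inj : forall v : 'rV[R]_n.+1,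
  v *m principal_proj X c u0 *m E1^T = 0 -> v *m principal_proj X c u0 = 0.
Hypothesis E2_inj : forall v : 'rV[R]_n.+1,
  v *m principal_proj X (- c) u0 *m E2^T = 0 -> v *m principal_proj X (- c) u0 = 0.

(** [product_chart] is applied to the two focal maps, whose sum is X.  In the resulting chart
    X is Y1 + Y2 with orthogonal terms, and H is c (Y2 - Y1). *)
Lemma local_product_chart : local_product_at (m1 + m2) M (X u0).
Proof.
have m_gt0 : (0 < m1 + m2)%N by rewrite addn_gt0 m1_gt0.
have sH := smooth_mean_curv oU sX immX hr.
have splitP := principal_projP oU sX immX m_gt0 hr H_parallel AH_parallel X_biharmonic c0 cH.
have [r [Psi [Y1 [Y2 [[r0 Psi0 sPsi PsiU oPsi] YE [sY1 Y1E] [sY2 Y2E]]]]]] :=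
  product_chart oU immX (smooth_focal_map oU sX immX hr c) (smooth_focal_map oU sX immX hr (- c)) Uu0
    (fun u i => @pd_focal_map _ _ _ _ oU sX immX hr c u i)
    (fun u i => @pd_focal_map _ _ _ _ oU sX immX hr (- c) u i)
    (fun u Uu => let: And5 h _ _ _ _ := splitP u Uu in h)
    (fun u Uu => let: And5 _ h _ _ _ := splitP u Uu in h)
    (fun u Uu => let: And5 _ _ h _ _ := splitP u Uu in h)
    (fun u Uu => let: And5 _ _ _ h _ := splitP u Uu in h)
    (fun u Uu => let: And5 _ _ _ _ h := splitP u Uu in h) E1_inj E2_inj.
move: Psi0 sPsi PsiU oPsi YE sY1 Y1E sY2 Y2E.
set s0 := focal_map X c u0 *m E1^T; set t0 := focal_map X (- c) u0 *m E2^T.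
move=> Psi0 sPsi PsiU oPsi YE sY1 Y1E sY2 Y2E.
have bs0 : ball s0 r s0 by exact: ballxx.
have bt0 : ball t0 r t0 by exact: ballxx.
have os : open (ball s0 r) by exact: ball_open.
have ot : open (ball t0 r) by exact: ball_open.
have oV : open (ball (row_mx s0 t0) r) by exact: ball_open.
have bst s t : ball s0 r s -> ball t0 r t -> ball (row_mx s0 t0) r (row_mx s t).
  by move=> bs bt; apply/ball_row_mx.
have VV y : ball (row_mx s0 t0) r y -> ball s0 r (lsubmx y) /\ ball t0 r (rsubmx y).
  by rewrite -{1}[y]hsubmxK => /(ball_row_mx _ _ _ _ r0).
have VU y : ball (row_mx s0 t0) r y -> U (Psi y) by move=> /PsiU[].
have fY y : ball (row_mx s0 t0) r y ->
    focal_map X c (Psi y) = Y1 (lsubmx y) /\ focal_map X (- c) (Psi y) = Y2 (rsubmx y).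
  by move=> /VV[bs bt]; have := YE _ _ bs bt; rewrite hsubmxK.
have Ust s t : ball s0 r s -> ball t0 r t -> U (Psi (row_mx s t)).
  by move=> bs bt; exact: VU (bst _ _ bs bt).
have Y12 s t : ball s0 r s -> ball t0 r t -> dot (Y1 s) (Y2 t) = 0.
  move=> bs bt; have [<- <-] := YE _ _ bs bt.
  exact: (focal_map_orth oU sX immX hr c0 cH (Ust _ _ bs bt)).
have Y1r s : ball s0 r s -> dot (Y1 s) (Y1 s) = 2^-1.
  move=> bs; have [<- _] := YE _ _ bs bt0.
  exact: (focal_map_norm oU sX immX hr c0 cH erefl (Ust _ _ bs bt0)).
have Y2r t : ball t0 r t -> dot (Y2 t) (Y2 t) = 2^-1.
  move=> bt; have [_ <-] := YE _ _ bs0 bt.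
  exact: (focal_map_norm oU sX immX hr c0 cH (sqrrN c) (Ust _ _ bs0 bt)).
have half0 : (2^-1 : R) != 0 by rewrite invr_eq0 pnatr_eq0.
have nz (v : 'rV[R]_n.+1) : dot v v = 2^-1 -> v != 0.
  move=> h; apply: contra_neq half0 => v0; rewrite -h v0.
  by apply: big1 => i _; rewrite mxE mul0r.
have [n1 [n2 [Q1 [Q2 [n12 [QQ1 QQ2 Q12] Y1Q Y2Q]]]]] :=
  @orthogonal_spans _ (Y1 @` ball s0 r) (Y2 @` ball t0 r) (Y1 s0) (Y2 t0)
    ltac:(by move=> _ _ [s bs <-] [t bt <-]; exact: Y12)
    (ex_intro2 _ _ s0 bs0 erefl) (nz _ (Y1r _ bs0)) (ex_intro2 _ _ t0 bt0 erefl) (nz _ (Y2r _ bt0)).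
have {}Y1Q s : ball s0 r s -> Y1 s *m Q1^T *m Q1 = Y1 s by move=> bs; apply: Y1Q; exists s.
have {}Y2Q t : ball t0 r t -> Y2 t *m Q2^T *m Q2 = Y2 t by move=> bt; apply: Y2Q; exists t.
have Q21 : Q2 *m Q1^T = 0 by apply: trmx_inj; rewrite trmx_mul trmxK Q12 trmx0.
pose K := Q1^T *m Q1.
have K_sym : K^T = K by rewrite trmx_mul trmxK.
have Y1K s : ball s0 r s -> Y1 s *m K = Y1 s by move=> bs; rewrite mulmxA Y1Q.
have Y2K t : ball t0 r t -> Y2 t *m K = 0.
  by move=> bt; rewrite mulmxA -(Y2Q t bt) -(mulmxA _ Q2) Q21 mulmx0 mul0mx.
have immY1 s : ball s0 r s -> immersive Y1 s.
  by move=> bs; exact: immersive_left_inverse os sY1 Y1E bs.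
have immY2 t : ball t0 r t -> immersive Y2 t.
  by move=> bt; exact: immersive_left_inverse ot sY2 Y2E bt.
have XPsi y : ball (row_mx s0 t0) r y -> X (Psi y) = Y1 (lsubmx y) + Y2 (rsubmx y).
  by move=> /fY[<- <-]; rewrite focal_map_sum.
have sXPsi : smooth_on (ball (row_mx s0 t0) r) (fun y => X (Psi y)).
  by move=> k; exact: (Ck_comp oU oV VU (sPsi k) (sX k)).
have immXPsi y : ball (row_mx s0 t0) r y -> immersive (fun y => X (Psi y)) y.
  move=> by_; have [Uy uJ] := PsiU y by_.
  rewrite /immersive -/(jacobian_mx (fun y => X (Psi y)) y).
  rewrite (jacobian_reparam oU oV sX sPsi VU (fun v _ => erefl) by_) -row_leq_rank.
  by rewrite (eqmxMfull _ _) ?row_full_unit// row_leq_rank; exact: immX.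
have HXPsi y : ball (row_mx s0 t0) r y ->
    mean_curv (fun y => X (Psi y)) y = c *: (Y2 (rsubmx y) - Y1 (lsubmx y)).
  move=> by_.
  rewrite (mean_curv_reparam oU oV sX sPsi VU (fun v _ => erefl) immX immXPsi hr by_).
  have [<- <-] := fY y by_.
  by rewrite focal_map_diff scalerA mulfV ?scale1r// lt0r_neq0.
have rXPsi y : ball (row_mx s0 t0) r y -> dot (X (Psi y)) (X (Psi y)) = 1.
  by move=> by_; apply: hr; exact: VU.
have min1 s : ball s0 r s -> mean_curv Y1 s = 0.
  move=> bs; have := minimal_factor1 os ot oV VV sY1 sY2 immY1 immY2 XPsi K_sym Y1K Y2K
    m_gt0 half0 sXPsi rXPsi Y1r HXPsi (bst s t0 bs bt0).
  by rewrite row_mxKl.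
have min2 t : ball t0 r t -> mean_curv Y2 t = 0.
  move=> bt; have := minimal_factor2 os ot oV VV sY1 sY2 immY1 immY2 XPsi K_sym Y1K Y2K
    m_gt0 half0 sXPsi rXPsi Y2r HXPsi (bst s0 t bs0 bt).
  by rewrite row_mxKr.
have enorm_half (v : 'rV[R]_n.+1) : dot v v = 2^-1 -> enorm v = (Num.sqrt 2)^-1.
  by move=> h; rewrite /enorm h sqrtrV// ler0n.
have [W oW XW] := openX oPsi (fun _ => ltac:(by move=> [y by_ <-]; exact: VU)).
exists m1, m2, n1, n2, ((fun s => Y1 s *m Q1^T) @` ball s0 r), ((fun t => Y2 t *m Q2^T) @` ball t0 r),
  (col_mx Q1 Q2), W; split.
- by split=> //; move: n12; lia.
- by apply: (factor_submanifold r0 sY1 Y1E QQ1 Y1Q _ min1) => s bs; exact: enorm_half (Y1r s bs).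
- by apply: (factor_submanifold r0 sY2 Y2E QQ2 Y2Q _ min2) => t bt; exact: enorm_half (Y2r t bt).
- exact: col_mx_orthonormal.
split=> //.
  suff : (M `&` W) (X u0) by case.
  rewrite -XW; exists u0 => //; exists (row_mx s0 t0) => //; exact: ballxx.
rewrite -XW; apply/seteqP; split=> [_ [_ [y by_ <-] <-]|_ [_ [s bs <-] [_ [t bt <-] <-]]].
  have [bs bt] := VV y by_; rewrite XPsi//.
  exists (Y1 (lsubmx y) *m Q1^T); first by exists (lsubmx y).
  exists (Y2 (rsubmx y) *m Q2^T); first by exists (rsubmx y).
  by rewrite mul_row_col Y1Q// Y2Q.
exists (Psi (row_mx s t)); first by exists (row_mx s t) => //; exact: bst.
by rewrite XPsi ?row_mxKl ?row_mxKr ?mul_row_col ?Y1Q ?Y2Q//; exact: bst.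
Qed.

End LocalProduct.

End Calculus.

Theorem theorem3p16 (R : realType) (m n : nat) (M : set 'rV[R]_n.+1)
    (hm : (2 < m)%N)
    (hM : sphere_submanifold m 1 M)
    (hbih : proper_biharmonic m M)
    (hH : parallel_mean_curv m M)
    (hA : parallel_weingarten_H m M)
    (hnorm : mean_curv_norm_in m M 0 ((m%:R - 2) / m%:R)) :
  forall p, M p -> local_product_at m M p.
Proof.
move=> p Mp; have [Msph _ _ charts] := hM.
have [U [X [XU [u0 Uu0 <-]]]] := charts p Mp.
have [oU sX immX _ openX] := XU.
have m_gt0 : (0 < m)%N by exact: leq_trans hm.
have mR : 0 < m%:R :> R by rewrite ltr0n.
have hr u : U u -> dot (X u) (X u) = 1.
  move=> Uu; have [W _ e] := openX U oU (fun _ => id).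
  have : (X @` U) (X u) by exists u.
  by rewrite e => -[/Msph /= XS _]; rewrite -enorm_sqr XS expr1n.
have [rr rr0 bU] : exists2 rr : R, 0 < rr & ball u0 rr `<=` U.
  by have /nbhs_ballP[rr /= rr0 h] := open_nbhs_nbhs (conj oU Uu0); exists rr.
have /andP[c0 c1] := hnorm U X XU u0 Uu0.
set c := enorm (mean_curv X u0) in c0 c1.
have {}c1 : c < 1.
  by apply: lt_le_trans c1 _; rewrite ler_pdivrMr// mul1r gerBl ler0n.
have Xbih u : U u -> bitension (induced_metric X) X u = 0 by exact: hbih.1.
have Xpar u : U u -> forall i, nabla_perp X i (mean_curv X) u = 0 by exact: hH.
have Xwein u : U u -> forall i j k, nabla_end X (weingarten X (mean_curv X)) i j k u = 0.
  exact: hA.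
have cH u : ball u0 rr u -> dot (mean_curv X u) (mean_curv X u) = c ^+ 2.
  by move=> bu; rewrite enorm_sqr; exact: (mean_curv_norm_const oU sX immX hr Xpar rr0 bU bu).
have oB : open (ball u0 rr) by exact: ball_open.
have bu0 : ball u0 rr u0 by exact: ballxx.
have sB : smooth_on (ball u0 rr) X by move=> k; exact: Ck_sub bU (sX k).
have [m1 [m2 [E1 [E2 [m1_gt0 m2_gt0 em E1_inj E2_inj]]]]] :=
  principal_splitting oB sB (fun u bu => immX u (bU u bu)) m_gt0 (fun u bu => hr u (bU u bu))
    (fun u bu => Xpar u (bU u bu)) (fun u bu => Xwein u (bU u bu))
    (fun u bu => Xbih u (bU u bu)) c0 cH c1 bu0.
subst m.
apply: (local_product_chart oB sB (fun u bu => immX u (bU u bu)) _ m1_gt0 m2_gt0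
  (fun u bu => hr u (bU u bu)) (fun u bu => Xpar u (bU u bu)) (fun u bu => Xwein u (bU u bu))
  (fun u bu => Xbih u (bU u bu)) c0 cH bu0 E1_inj E2_inj).
by move=> O oO OB; apply: openX => // u /OB /bU.
Qed.
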